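(* Let $S^{(1)},\dots,S^{(m)}$ be simple symmetric random walks and $Z^{(1)},\dots,Z^{(r)}$ be recurrent random walks in random environment in $I$ independent environments, as described in the context. (i) If $m\ge 3$ and $r\ge 1$, then, for $\mathsf P$-almost every environment $\omega$, $P^0_\omega\big[S_n^{(1)}=S_n^{(2)}=S_n^{(3)}=Z_n^{(1)}\text{ for infinitely many } n\big]=0$; a fortiori, almost surely, $S^{(1)},\dots,S^{(m)},Z^{(1)},\dots,Z^{(r)}$ meet simultaneously only a finite number of times. (ii) If $m=2$ and $r\ge I=1$, then, for $\mathsf P$-almost every environment $\omega$, $P^0_\omega\big[S_n^{(1)}=S_n^{(2)}=Z_n^{(1)}=\dots=Z_n^{(r)}\text{ for infinitely many } n\big]=1$. (iii) If $m=2$ and $r\ge I\ge 2$, then, for $\mathsf P$-almost every environment $\omega$, $P^0_\omega\big[S_n^{(1)}=S_n^{(2)}=Z_n^{(1)}=Z_n^{(2)}\text{ for infinitely many } n\big]=0$; a fortiori, almost surely, $S^{(1)},S^{(2)},Z^{(1)},\dots,Z^{(r)}$ meet simultaneously only a finite number of times.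
   Context: Setting. Let $d,m,r$ be nonnegative integers with $m+r=d\ge1$ and let $I\le r$. On a probability space $(\Omega,\mathcal F,\mathsf P)$ (expectation $\mathsf E$) there are $r$ collections $\omega^{(j)}=(\omega^{(j)}_x)_{x\in\mathbb Z}$, $j\in\{1,\dots,r\}$, each made of i.i.d. random variables with values in $(0,1)$, such that $\omega^{(1)},\dots,\omega^{(I)}$ are independent and, for every $j\in\{I+1,\dots,r\}$, there is an index $J_j\in\{1,\dots,I\}$ with $\omega^{(j)}\equiv\omega^{(J_j)}$ (exact copy). A realization $\omega=(\omega^{(1)},\dots,\omega^{(r)})$ is called an environment. With $\rho^{(j)}_k=(1-\omega^{(j)}_k)/\omega^{(j)}_k$, assume there is $\varepsilon_0\in(0,1/2)$ such that for every $j\in\{1,\dots,r\}$: $\mathsf P[\omega^{(j)}_0\in[\varepsilon_0,1-\varepsilon_0]]=1$, $\mathsf E[\log\rho^{(j)}_0]=0$ and $\mathsf E[(\log\rho^{(j)}_0)^2]>0$. Given $\omega$ and $x\in\mathbb Z^d$, under the quenched law $P^x_\omega$ the processes $S^{(1)},\dots,S^{(m)},Z^{(1)},\dots,Z^{(r)}$ are independent Markov chains on $\mathbb Z$ with $(S_0^{(1)},\dots,S_0^{(m)},Z_0^{(1)},\dots,Z_0^{(r)})=x$ almost surely, where each $S^{(i)}$ jumps by $+1$ or $-1$ with probability $1/2$ each, and $P^x_\omega[Z^{(j)}_{n+1}=y+1\mid Z^{(j)}_n=y]=\omega^{(j)}_y=1-P^x_\omega[Z^{(j)}_{n+1}=y-1\mid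 Z^{(j)}_n=y]$ for $y\in\mathbb Z$, $n\in\mathbb N$. The superscript $0$ in $P^0_\omega$ is the origin of $\mathbb Z^d$. Walks ''meet simultaneously'' at time $n$ if they are all at the same site at time $n$. *)

(* Defs.v *)
From HB Require Import structures.
From mathcomp Require Import all_boot all_order all_algebra.
From mathcomp Require Import finmap.
From mathcomp Require Import all_classical all_reals all_analysis.

Set Implicit Arguments.
Unset Strict Implicit.
Unset Printing Implicit Defensive.

Import Order.TTheory GRing.Theory Num.Theory.
Import numFieldNormedType.Exports.

Local Open Scope classical_set_scope.
Local Open Scope ring_scope.

HB.instance Definition _ := isPointed.Build int 0.

HB.instance Definition _ := @isMeasurable.Build default_measure_display
  int discrete_measurable discrete_measurable0
  discrete_measurableC discrete_measurableU.

Section Independence.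
Context d (T : measurableType d) (R : realType) (P : probability T R).

(* The families of events [G k], k : K, are independent: product rule over
   every finite subfamily. *)
Definition mutually_independent (K : choiceType) (G : K -> set_system T) : Prop :=
  forall (J : {fset K}) (E : K -> set T),
    (forall k, k \in J -> G k (E k)) ->
    P (\bigcap_(k in [set` J]) E k) = (\prod_(k <- J) P (E k))%E.

Definition process_sigma_algebra d' (T' : measurableType d') (K : Type)
    (X : K -> T -> T') : set_system T :=
  <<s \bigcup_k preimage_set_system setT (X k) measurable >>.

Definition identically_distributed (K : Type) (X : K -> {RV P >-> R}) : Prop :=
  forall (k l : K) (B : set R), measurable B ->
    distribution P (X k) B = distribution P (X l) B.

Definition iid (K : choiceType) (X : K -> {RV P >-> R}) : Prop :=
  mutually_independent (fun k => process_sigma_algebra (fun _ : unit => X k)) /\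
  identically_distributed X.

End Independence.

(* [env j x] is the probability of a jump from x to x + 1 in environment j. *)
Definition env (R : realType) (r : nat) : Type := 'I_r -> int -> R.

Definition rho (R : realType) (p : R) : R := (1 - p) / p.

(* Indices are 0-based: [omega j] is the paper's omega^(j+1), so that the
   independent environments are the [omega j] with j < I. *)
Record random_environment d (Om : measurableType d) (R : realType)
    (P : probability Om R) (r I : nat) (leIr : (I <= r)%N)
    (omega : 'I_r -> int -> {RV P >-> R}) : Prop := RandomEnvironment {
  env_range : forall j x w, 0 < omega j x w < 1;
  env_iid : forall j, iid (omega j);
  env_independent : mutually_independent P
    (fun j : 'I_I => process_sigma_algebra (omega (widen_ord leIr j)));
  env_copy : forall j : 'I_r, (I <= j)%N ->
    exists J : 'I_I, forall x w, omega j x w = omega (widen_ord leIr J) x w;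
  env_sinai : exists eps0 : R, 0 < eps0 < 1 / 2 /\
    forall j : 'I_r,
      [/\ P [set w | eps0 <= omega j 0 w <= 1 - eps0] = 1%E,
          ('E_P[fun w => ln (rho (omega j 0%R w))] = 0)%E &
          (0 < 'E_P[fun w => (ln (rho (omega j 0 w)) ^+ 2)%R])%E]
}.

Definition realization d (Om : measurableType d) (R : realType)
    (P : probability Om R) (r : nat) (omega : 'I_r -> int -> {RV P >-> R})
    (w : Om) : env R r := fun j x => omega j x w.

Section Walks.
Context d (T : measurableType d) (R : realType) (Q : probability T R).

Definition nn_transition (p : int -> R) (y z : int) : R :=
  if z == y + 1 then p y else if z == y - 1 then 1 - p y else 0.

(* The Markov property and the transition probabilities are stated together,
   conditional probabilities being multiplied out. *)
Definition markov_chain (X : nat -> {mfun T >-> int}) (x : int)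
    (p : int -> R) : Prop :=
  Q [set t | X 0%N t = x] = 1%E /\
  forall (n : nat) (y : nat -> int),
    Q [set t | forall k, (k <= n.+1)%N -> X k t = y k] =
    (Q [set t | forall k, (k <= n)%N -> X k t = y k] *
      (nn_transition p (y n) (y n.+1))%:E)%E.

Definition quenched_law (m r : nat) (S : 'I_m -> nat -> {mfun T >-> int})
    (Z : 'I_r -> nat -> {mfun T >-> int}) (e : env R r)
    (x : 'rV[int]_(m + r)) : Prop :=
  [/\ mutually_independent Q (fun k : 'I_m + 'I_r =>
        process_sigma_algebra
          (match k with inl i => S i | inr j => Z j end)),
      forall i : 'I_m,
        markov_chain (S i) (x ord0 (lshift r i)) (fun=> 1 / 2) &
      forall j : 'I_r,
        markov_chain (Z j) (x ord0 (rshift m j)) (e j)].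

End Walks.

(* The first [a] walks S and the first [b] walks Z are all at the same site
   at time n. *)
Definition meet (T : Type) (m r : nat) (S : 'I_m -> nat -> T -> int)
    (Z : 'I_r -> nat -> T -> int) (a b n : nat) (t : T) : Prop :=
  exists y : int,
    (forall i : 'I_m, (i < a)%N -> S i n t = y) /\
    (forall j : 'I_r, (j < b)%N -> Z j n t = y).

Definition meet_infinitely_often (T : Type) (m r : nat)
    (S : 'I_m -> nat -> T -> int) (Z : 'I_r -> nat -> T -> int)
    (a b : nat) : set T :=
  [set t | infinite_set [set n | meet S Z a b n t]].

(* Main.v *)
(* In every environment the walk is reversible, and the meetings are governed by
   return probabilities of the walks at one site.

   (i) A simple walk is at a given site at time n with probability O(n^(-1/2)),
   so three of them meet Z at time n with probability O(n^(-3/2)), which is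
   summable; Borel-Cantelli concludes.

   (iii) The two simple walks contribute a factor 1/n.  The remaining sum over n
   of the probability that Z1 and Z2 are at the same site is split dyadically.
   By first-hit decomposition at each site, the sum over n of p_n q_n (0, y) is at
   most the sum of the return products p_n q_n (y, y), whose mean factorises since
   the environments are independent.  A return probability at y can only be
   large if the potential rises far before it falls a little on both sides of y,
   a gambler's ruin event on two independent halves, while remote sites are
   screened by high barriers of the potential.  The resulting series converges
   in mean, hence almost surely.

   (ii) Infinitely often, at well separated scales N, the potential has a valley
   with sharp bottom b, no barrier of height 5N/4 on the way to b, and walls of
   height 7N on both sides; independent blocks of sites give this almost surely.
   At such a scale all the walks Z have return probabilities to b bounded below,
   while the two simple walks give 1/n: the mean number of joint visits to b
   between times 2^(4N) and 2^(6N) is comparable to N, as is the conditional mean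
   after the first one, so a joint visit occurs with probability bounded below,
   whatever the past. *)

Require Import Defs.
From HB Require Import structures.
From mathcomp Require Import all_boot all_order all_algebra.
From mathcomp Require Import finmap.
From mathcomp Require Import all_classical all_reals all_analysis.
From mathcomp Require Import ring lra zify.
From mathcomp Require Import measurable_realfun.

Set Implicit Arguments.
Unset Strict Implicit.
Unset Printing Implicit Defensive.

Import Order.TTheory GRing.Theory Num.Theory.
Import numFieldNormedType.Exports.

Local Open Scope classical_set_scope.
Local Open Scope ring_scope.

(** * Finite-range chains and first hits *)

(** Walks are handled through iterates of one-step operators on real functions ([mop], [ker],
    [surv]), and the quenched law enters only through [pr_path_ok]; arguments with stopping times
    become inductions on time. The rates of the scales in (ii) come from e^(1/2) <= 2 <= e: 2^(4N)
    >= e^(2N) exceeds the order e^(5N/4) of the time needed to reach the bottom, 2^(6N) <= e^(6N) is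
    too short to climb a wall of height 7N, and the sum of 1/n between the two times is still of
    order N. The delicate point is that the return probability at the bottom must not degrade with
    N, otherwise the chances of meeting at successive scales might be summable. The sum of e^(V(b) -
    V(i)) over the valley must therefore be bounded uniformly in N, with probability bounded below;
    a Lyapunov function of the climb above the running minimum provides this. In (iii) the obstacle
    is that a fixed environment may have sites where return probabilities do not decay; only their
    mean over environments is small. Ellipticity holds only almost surely, so the environments are
    clipped to make all bounds hold surely. *)

Section Chain.
Variables (R : realType) (E : eqType) (M : finType).
Variables (step : E -> M -> E) (wt : E -> M -> R).

Definition mop (f : E -> R) (x : E) : R := \sum_mv wt x mv * f (step x mv).

Definition ker (n : nat) (x y : E) : R := iter n mop (fun z => (z == y)%:R) x.

Arguments ker : simpl never.

Fixpoint first_hit (b : E) (n : nat) (x : E) : R :=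
  match n with
  | 0 => (x == b)%:R
  | n'.+1 => if x == b then 0 else mop (first_hit b n') x
  end.

(** The probability that the chain, at [x] at time [n], satisfies [ok] at all times from [n] to
    [n + N]. The dependence of [ok] on time covers constraints that start late ([apart]) or bear on
    the last time only ([surv_lastE]). *)
Fixpoint surv (ok : nat -> pred E) (N n : nat) (x : E) : R :=
  match N with
  | 0 => (ok n x)%:R
  | N'.+1 => (ok n x)%:R * mop (surv ok N' n.+1) x
  end.

Lemma mop_ext f g : (forall x, f x = g x) -> forall x, mop f x = mop g x.
Proof. by move=> fg x; apply: eq_bigr => mv _; rewrite fg. Qed.

Lemma iter_mop_ext n f g : (forall x, f x = g x) ->
  forall x, iter n mop f x = iter n mop g x.
Proof. by move=> fg; elim: n => // n IH x; apply: mop_ext. Qed.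

Lemma mopD f g x : mop (fun z => f z + g z) x = mop f x + mop g x.
Proof. by rewrite /mop -big_split/=; apply: eq_bigr => mv _; rewrite mulrDr. Qed.

Lemma mopZ a f x : mop (fun z => a * f z) x = a * mop f x.
Proof. by rewrite /mop mulr_sumr; apply: eq_bigr => mv _; rewrite mulrCA. Qed.

Lemma mop_sum (I : Type) (s : seq I) (P : pred I) (f : I -> E -> R) x :
  mop (fun z => \sum_(i <- s | P i) f i z) x = \sum_(i <- s | P i) mop (f i) x.
Proof.
rewrite /mop exchange_big/=; apply: eq_bigr => mv _.
by rewrite mulr_sumr.
Qed.

Lemma iter_mop_sum n (I : Type) (s : seq I) (P : pred I) (f : I -> E -> R) x :
  iter n mop (fun z => \sum_(i <- s | P i) f i z) x =
  \sum_(i <- s | P i) iter n mop (f i) x.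
Proof.
elim: n x => // n IH x; rewrite iterS.
by rewrite (mop_ext IH) mop_sum.
Qed.

Lemma iter_mopZ n a f x :
  iter n mop (fun z => a * f z) x = a * iter n mop f x.
Proof. by elim: n x => // n IH x; rewrite iterS (mop_ext IH) mopZ. Qed.

Lemma iter_mopD n f g x :
  iter n mop (fun z => f z + g z) x = iter n mop f x + iter n mop g x.
Proof. by elim: n x => // n IH x; rewrite !iterS (mop_ext IH) mopD. Qed.

Lemma kerS n x y : ker n.+1 x y = mop (fun z => ker n z y) x.
Proof. by []. Qed.

(** First-passage decomposition, by induction on the first step; it stands in for the strong Markov
    property. *)
Lemma ker_first_hit n x b :
  ker n x b = \sum_(k < n.+1) first_hit b k x * ker (n - k) b b.
Proof.
elim: n x => [|n IH] x.
  rewrite big_ord1 /= /ker /= eqxx mulr1 //.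
rewrite big_ord_recl; have [->|xb] := eqVneq x b.
  by rewrite /= eqxx mul1r big1 ?addr0// => i _; rewrite /bump /= mul0r.
rewrite /= (negbTE xb) mul0r add0r kerS (mop_ext IH) mop_sum; apply: eq_bigr => i _.
rewrite /bump/= add1n subSS.
rewrite /mop mulr_suml; apply: eq_bigr => mv _; rewrite mulrA //.
Qed.

Hypothesis wt_ge0 : forall x mv, 0 <= wt x mv.
Hypothesis wt_sum1 : forall x, \sum_mv wt x mv = 1.

Lemma mop_le f g x : (forall mv, f (step x mv) <= g (step x mv)) ->
  mop f x <= mop g x.
Proof. by move=> fg; apply: ler_sum => mv _; apply: ler_wpM2l. Qed.

Lemma mop_cst a x : mop (fun=> a) x = a.
Proof. by rewrite /mop -mulr_suml wt_sum1 mul1r. Qed.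

Lemma mop_ge0 f x : (forall mv, 0 <= f (step x mv)) -> 0 <= mop f x.
Proof. by move=> f0; apply: sumr_ge0 => mv _; apply: mulr_ge0. Qed.

Lemma iter_mop_le n f g : (forall x, f x <= g x) ->
  forall x, iter n mop f x <= iter n mop g x.
Proof. by move=> fg; elim: n => // n IH x; apply: mop_le => mv; apply: IH. Qed.

Lemma iter_mop_ge0 n f : (forall x, 0 <= f x) ->
  forall x, 0 <= iter n mop f x.
Proof. by move=> fg; elim: n => // n IH x; apply: mop_ge0 => mv; apply: IH. Qed.

Lemma iter_mop_cst n a x : iter n mop (fun=> a) x = a.
Proof.
by elim: n x => // n IH x; rewrite iterS (mop_ext IH) mop_cst.
Qed.

Lemma ker_ge0 n x y : 0 <= ker n x y.
Proof. by apply: iter_mop_ge0 => z. Qed.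

Lemma ker_le1 n x y : ker n x y <= 1.
Proof.
rewrite -(iter_mop_cst n 1 x); apply: iter_mop_le => z.
by case: (z == y) => //=.
Qed.

Lemma first_hit_ge0 b n x : 0 <= first_hit b n x.
Proof.
by elim: n x => [|n IH] x //=; case: ifP => // _; apply: mop_ge0 => mv; apply: IH.
Qed.

Lemma surv_first_hit b n m x :
  surv (fun _ z => z != b) n m x = 1 - \sum_(k < n.+1) first_hit b k x.
Proof.
elim: n m x => [|n IH] m x.
  rewrite big_ord1 /=; case: eqP => /= _; rewrite ?subrr ?subr0//.
rewrite /= big_ord_recl /= (mop_ext (IH m.+1)).
have [->|xb] := eqVneq x b.
  rewrite /= mul0r big1 ?addr0 ?subrr// => i _.
rewrite /= mul1r add0r /bump /=.
transitivity (mop (fun z => 1 + (-1) * \sum_(k < n.+1) first_hit b k z) x).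
  by apply: mop_ext => z; rewrite mulN1r.
rewrite mopD mop_cst mopZ mulN1r mop_sum; congr (_ - _).
Qed.

Lemma surv_ge0 ok n m x : 0 <= surv ok n m x.
Proof.
elim: n m x => [|n IH] m x //=; apply: mulr_ge0 => //.
by apply: mop_ge0 => mv; apply: IH.
Qed.

Lemma first_hit_sum_le1 b n x : \sum_(k < n) first_hit b k x <= 1.
Proof.
case: n => [|n]; first by rewrite big_ord0.
by have := surv_ge0 (fun _ z => z != b) n 0 x; rewrite surv_first_hit subr_ge0.
Qed.

(** Used in two directions: with the hitting probability bounded by 1 it bounds mean visits
    ([kerw_pair_sum]); solved for the hitting probability it is the second-moment argument of
    [joint_hit_lower]. The proof exchanges the sums over the first hit and the remaining time and
    lets the latter run up to [B]. *)
Lemma ker_sum_first_hit B x b :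
  \sum_(n < B) ker n x b <=
  (\sum_(k < B) first_hit b k x) * \sum_(j < B) ker j b b.
Proof.
under eq_bigr do rewrite ker_first_hit.
rewrite mulr_suml.
have -> : \sum_(i < B) \sum_(k < i.+1) first_hit b k x * ker (i - k) b b =
  \sum_(k < B) first_hit b k x * \sum_(i < B | (k <= i)%N) ker (i - k) b b.
  under [RHS]eq_bigr do rewrite mulr_sumr.
  rewrite (exchange_big_dep xpredT)//=; apply: eq_bigr => i _.
  rewrite (big_ord_widen_cond B xpredT
    (fun k : nat => first_hit b k x * ker (i - k) b b)) ?ltn_ord//.
apply: ler_sum => k _; apply: ler_wpM2l; first exact: first_hit_ge0.
rewrite -(big_mkord (fun i => (k <= i)%N) (fun i => ker (i - k) b b)).
rewrite -(big_mkord xpredT (fun i => ker i b b)).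
have kB : (k <= B)%N by exact: ltnW.
rewrite (big_cat_nat _ kB) //= big_nat_cond big_pred0 ?add0r; last first.
  by move=> i; apply/negbTE; lia.
rewrite -{1}(add0n (k : nat)) big_addn.
under eq_bigl do rewrite leq_addl.
under eq_bigr do rewrite addnK.
rewrite [leRHS](big_cat_nat _ (leq_subr k B)) //= lerDl.
by apply: sumr_ge0 => i _; apply: ker_ge0.
Qed.

(* [X] is an invariant of the reachable states, indexed by time. *)
Lemma surv_avoid (ok : nat -> pred E) b (X : nat -> pred E) B N n (s : R) x :
  0 <= s ->
  (forall k z mv, X k z -> X k.+1 (step z mv)) ->
  (forall k z, (n <= k)%N -> X k z -> ok k z -> z != b) ->
  (forall z, X (n + B).+1 z -> surv ok N (n + B).+1 z <= s) ->
  X n x ->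
  surv ok (B + N).+1 n x <= surv (fun _ z => z != b) B n x * s.
Proof.
move=> s0 Xstep okb; elim: B n x okb => [|B IH] n x okb hs Xx.
  rewrite add0n /=.
  have H : mop (surv ok N n.+1) x <= s.
    rewrite -[leRHS](mop_cst s x); apply: mop_le => mv.
    by have := hs (step x mv); rewrite addn0; apply; apply: Xstep.
  have [okx|nok] := boolP (ok n x).
    by rewrite (okb n x) // !mul1r.
  by rewrite mul0r mulr_ge0.
rewrite addSn [surv ok _ _ _]/= [surv _ B.+1 _ _]/= -mulrA.
have H : mop (surv ok (B + N).+1 n.+1) x <=
         mop (surv (fun _ z => z != b) B n.+1) x * s.
  rewrite mulrC -mopZ; apply: mop_le => mv; rewrite mulrC; apply: IH.
  - by move=> k z nk; apply: okb; apply: ltnW.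
  - by move=> z; rewrite addSnnS; apply: hs.
  - exact: Xstep.
have [okx|nok] := boolP (ok n x).
  by rewrite (okb n x) // !mul1r.
rewrite mul0r !mulr_ge0 //; apply: mop_ge0 => mv; exact: surv_ge0.
Qed.

(** Dropping the constraints of the first [B] steps only increases survival, and a bound uniform
    over the states allowed by [X] at time [n + B] passes through the averaging. *)
Lemma surv_start (ok : nat -> pred E) (X : nat -> pred E) B N n (s : R) x :
  0 <= s ->
  (forall k z mv, X k z -> X k.+1 (step z mv)) ->
  (forall z, X (n + B)%N z -> surv ok N (n + B) z <= s) ->
  X n x -> surv ok (B + N) n x <= s.
Proof.
move=> s0 Xstep; elim: B n x => [|B IH] n x hs Xx.
  by have := hs x; rewrite addn0 add0n; apply.
rewrite addSn /=.
have H : mop (surv ok (B + N) n.+1) x <= s.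
  rewrite -[leRHS](mop_cst s x); apply: mop_le => mv; apply: IH.
    by move=> z; rewrite addSnnS; apply: hs.
  exact: Xstep.
by case: (ok n x); rewrite ?mul1r ?mul0r.
Qed.

(** Links survival to the law at a single time: a constraint at the last time only leaves a plain
    iterate of the operator. *)
Lemma surv_lastE (ok : pred E) n m x :
  surv (fun k z => (k < m + n)%N || ok z) n m x =
  iter n mop (fun z => (ok z)%:R) x.
Proof.
elim: n m x => [|n IH] m x; first by rewrite /= addn0 ltnn.
rewrite /= -{1}(addn0 m) ltn_add2l /= mul1r; apply: mop_ext => z.
by rewrite -(IH m.+1) addSnnS.
Qed.

End Chain.

(** * Independent walks as one product chain *)

Section ProductChain.
Variables (R : realType).

Definition wstep (z : int) (b : bool) : int := if b then z + 1 else z - 1.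
Definition wwt (e : int -> R) (z : int) (b : bool) : R :=
  if b then e z else 1 - e z.

Local Notation wop e := (mop wstep (wwt e)).

Lemma wopE (e : int -> R) f x :
  wop e f x = e x * f (x + 1) + (1 - e x) * f (x - 1).
Proof. by rewrite /mop big_bool /= . Qed.

Lemma wwt_sum1 (e : int -> R) x : \sum_b wwt e x b = 1.
Proof. by rewrite big_bool /= addrC subrK. Qed.

Lemma wwt_ge0 (e : int -> R) : (forall k, 0 < e k < 1) ->
  forall x b, 0 <= wwt e x b.
Proof. by move=> he x [] /=; have /andP[] := he x; lra. Qed.

Variables (K : finType).
Implicit Types (e : K -> int -> R).

Definition pstep (x : {ffun K -> int}) (s : {ffun K -> bool}) : {ffun K -> int} :=
  [ffun k => wstep (x k) (s k)].
Definition pwt e (x : {ffun K -> int}) (s : {ffun K -> bool}) : R :=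
  \prod_k wwt (e k) (x k) (s k).

Lemma pwt_ge0 e : (forall k z, 0 < e k z < 1) -> forall x s, 0 <= pwt e x s.
Proof. by move=> he x s; apply: prodr_ge0 => k _; apply: wwt_ge0. Qed.

Lemma pwt_sum1 e x : \sum_s pwt e x s = 1.
Proof.
rewrite /pwt -(bigA_distr_bigA (fun k b => wwt (e k) (x k) b)) /=.
by rewrite big1 // => k _; rewrite wwt_sum1.
Qed.

Lemma mop_prod e (f : K -> int -> R) x :
  mop pstep (pwt e) (fun z => \prod_k f k (z k)) x =
  \prod_k wop (e k) (f k) (x k).
Proof.
rewrite /mop bigA_distr_bigA; apply: eq_bigr => s _.
by rewrite /pwt -big_split; apply: eq_bigr => k _; rewrite ffunE.
Qed.

Lemma iter_mop_prod e n (f : K -> int -> R) x :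
  iter n (mop pstep (pwt e)) (fun z => \prod_k f k (z k)) x =
  \prod_k iter n (wop (e k)) (f k) (x k).
Proof.
elim: n x => // n IH x; rewrite iterS (mop_ext _ _ IH).
by rewrite (mop_prod e (fun k => iter n (wop (e k)) (f k))).
Qed.

(** The indicator of a point is a product of coordinate indicators, and the joint operator preserves
    products. *)
Lemma ker_prod e n x y :
  ker pstep (pwt e) n x y = \prod_k ker wstep (wwt (e k)) n (x k) (y k).
Proof.
rewrite /ker -iter_mop_prod; apply: iter_mop_ext => z.
have [->|zy] := eqVneq z y.
  by rewrite big1 // => k _; rewrite eqxx.
have [k zk] : exists k, z k != y k.
  by apply/existsP; rewrite -negb_forall; apply: contra zy => /forallP H;
    apply/eqP/ffunP => k; apply/eqP.
by rewrite (bigD1 k) //= (negbTE zk) mul0r.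
Qed.

End ProductChain.
Arguments pstep {K}.

Notation wop e := (mop wstep (wwt e)).
Notation kerw e := (ker wstep (wwt e)).

(** * Walks with conductances *)

Section Walk.
Variable R : realType.
Implicit Types (e c : int -> R) (f g : int -> R).

(** A nearest-neighbour walk sees after [n] steps only the sites within distance [n] of the right
    parity. Both finite range ([kerw_far]) and parity ([kerw_neq0]) follow from this. *)
Lemma iter_wop_local e n f g x :
  (forall i : nat, (i <= n)%N -> f (x - n%:Z + (i%:Z *+ 2)) = g (x - n%:Z + (i%:Z *+ 2))) ->
  iter n (wop e) f x = iter n (wop e) g x.
Proof.
elim: n x => [|n IH] x H.
  by have := H 0%N (leqnn _); have -> : x - 0%:Z + 0%:Z *+ 2 = x by lia.
rewrite !iterS !wopE (IH (x + 1)) 1?(IH (x - 1)) //.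
  move=> i ni; have := H i (leqW ni).
  by have -> : x - n.+1%:Z + i%:Z *+ 2 = x - 1 - n%:Z + i%:Z *+ 2 by lia.
move=> i ni; have := H i.+1 ni.
by have -> : x - n.+1%:Z + i.+1%:Z *+ 2 = x + 1 - n%:Z + i%:Z *+ 2 by lia.
Qed.

Lemma kerw_far e n x y : n%:Z < `|y - x| -> kerw e n x y = 0.
Proof.
move=> H; rewrite /ker (@iter_wop_local _ _ _ (fun=> 0)).
  by rewrite iter_mop_cst // => z; rewrite wwt_sum1.
by move=> i ni; case: eqP => //= E; exfalso; lia.
Qed.

Lemma kerw_neq0 e n x y : kerw e n x y != 0 ->
  exists2 i : nat, (i <= n)%N & y = x - n%:Z + i%:Z *+ 2.
Proof.
move=> H; have [//|nex] := pselect (exists2 i : nat, (i <= n)%N & y = x - n%:Z + i%:Z *+ 2).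
exfalso; move/eqP: H; apply; rewrite /ker (@iter_wop_local _ _ _ (fun=> 0)).
  by rewrite iter_mop_cst // => z; rewrite wwt_sum1.
by move=> i ni; case: eqP => //= E; exfalso; apply: nex; exists i.
Qed.

Lemma kerw_last e n x y :
  kerw e n.+1 x y = kerw e n x (y - 1) * e (y - 1) +
                    kerw e n x (y + 1) * (1 - e (y + 1)).
Proof.
rewrite /ker iterSr.
under (iter_mop_ext _ _ n (g := fun z => e (y - 1) * (z == y - 1)%:R +
  (1 - e (y + 1)) * (z == y + 1)%:R)) => z.
  rewrite wopE.
  have -> : (z + 1 == y) = (z == y - 1) by lia.
  have -> : (z - 1 == y) = (z == y + 1) by lia.
  by congr (_ + _); case: eqP => [->|_] //=; rewrite !mulr0.
rewrite /= [X in _ = X + _]mulrC [X in _ = _ + X]mulrC -!iter_mopZ.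
elim: n x => // n IH x; rewrite !iterS -mopD; apply: mop_ext => z; exact: IH.
Qed.

(* The walk on the integers with conductance [c k] on the edge (k, k + 1). *)
Definition ec c (k : int) : R := c k / (c (k - 1) + c k).
(** The reversible measure of this walk: [ec_piw] and [ecN_piw] give its flow through the two edges
    at [k]. *)
Definition piw c (k : int) : R := c (k - 1) + c k.

Section Conductances.
Variable c : int -> R.
Hypothesis c0 : forall k, 0 < c k.

Lemma piw_gt0 k : 0 < piw c k.
Proof. by rewrite /piw addr_gt0. Qed.

Lemma ec_piw k : ec c k * piw c k = c k.
Proof. by rewrite /ec mulfVK// gt_eqF// piw_gt0. Qed.

Lemma ecN_piw k : (1 - ec c k) * piw c k = c (k - 1).
Proof. by rewrite mulrBl mul1r ec_piw /piw addrK. Qed.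

Lemma ec01 k : 0 < ec c k < 1.
Proof.
by rewrite /ec divr_gt0 ?addr_gt0//= ltr_pdivrMr ?addr_gt0// mul1r ltrDr.
Qed.

Lemma ec_V k : ec c k / c k = (piw c k)^-1.
Proof.
by rewrite -{1}(ec_piw k) invfM mulrA divff ?mul1r// gt_eqF//; case/andP: (ec01 k).
Qed.

Lemma ecN_V k : (1 - ec c k) / c (k - 1) = (piw c k)^-1.
Proof.
rewrite -{1}(ecN_piw k) invfM mulrA divff ?mul1r// gt_eqF//.
by case/andP: (ec01 k) => _; rewrite subr_gt0.
Qed.

Let wt0 := wwt_ge0 ec01.
Let wt1 := wwt_sum1 (ec c).

(** Induction that expands the first step on the left and the last step on the right, both flows
    across an edge being its conductance. *)
Lemma kerw_rev n x y : piw c x * kerw (ec c) n x y = piw c y * kerw (ec c) n y x.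
Proof.
elim: n x y => [|n IH] x y.
  by rewrite /ker /= eq_sym; case: eqP => [->|]; rewrite ?mulr0.
rewrite kerS wopE kerw_last [RHS]mulrDr.
rewrite [X in _ = X + _]mulrA [X in _ = _ + X]mulrA -!(IH _ y).
have E1 := ecN_piw x; have E2 := ec_piw x.
have E3 := ecN_piw (x + 1); have E4 := ec_piw (x - 1).
rewrite addrK in E3.
set p1 := kerw _ n (x + 1) y; set p2 := kerw _ n (x - 1) y.
transitivity (c x * p1 + c (x - 1) * p2); last first.
  by rewrite -[in LHS]E3 -[in LHS]E4; ring.
by rewrite -[in RHS]E1 -[in RHS]E2; ring.
Qed.

Lemma kerw_le_pi n x y : kerw (ec c) n x y <= piw c y / piw c x.
Proof.
rewrite ler_pdivlMr ?piw_gt0// mulrC kerw_rev ler_piMr// ?ker_le1//.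
by rewrite ltW ?piw_gt0.
Qed.

End Conductances.
End Walk.

Section WalkEstimates.
Variable R : realType.
Variable c : int -> R.
Hypothesis c0 : forall k, 0 < c k.
Local Notation e := (ec c).
Local Notation p := (kerw e).
Let wt0 := wwt_ge0 (ec01 c0).
Let wt1 := wwt_sum1 e.

(** Sums over all integers are avoided by finite windows: a lower bound when [f] is nonnegative, an
    equality when [f] vanishes outside the window ([iter_wop_windowE]). *)
Lemma iter_wop_window n lo (l : nat) (f : int -> R) x :
  (forall z, 0 <= f z) ->
  \sum_(j < l) f (lo + j%:Z) * p n x (lo + j%:Z) <= iter n (wop e) f x.
Proof.
move=> f0; rewrite /ker.
under eq_bigr do rewrite -iter_mopZ.
rewrite -iter_mop_sum; apply: iter_mop_le => // z.
have [zin|zout] := boolP ((lo <= z) && (z < lo + l%:Z)).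
  have jl : (`|(z - lo)%R|%N < l)%N by lia.
  have zE : z = lo + (Ordinal jl : nat)%:Z by rewrite /=; lia.
  rewrite (bigD1 (Ordinal jl)) //= -zE eqxx mulr1 big1 ?addr0 // => i ij.
  case: eqP => //= E; rewrite ?mulr0//; exfalso; move/eqP: ij; apply.
  by apply: val_inj => /=; lia.
rewrite big1 // => i _; case: eqP => E; rewrite ?mulr0 //.
by exfalso; move/negP: zout; apply; have := ltn_ord i; lia.
Qed.

Lemma iter_wop_windowE n lo (l : nat) (f : int -> R) x :
  (forall z, ~~ ((lo <= z) && (z < lo + l%:Z)) -> f z = 0) ->
  iter n (wop e) f x = \sum_(j < l) f (lo + j%:Z) * p n x (lo + j%:Z).
Proof.
move=> f0; rewrite /ker.
under [RHS]eq_bigr do rewrite -iter_mopZ.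
rewrite -iter_mop_sum; apply: iter_mop_ext => // z.
have [zin|zout] := boolP ((lo <= z) && (z < lo + l%:Z)).
  have jl : (`|(z - lo)%R|%N < l)%N by lia.
  have zE : z = lo + (Ordinal jl : nat)%:Z by rewrite /=; lia.
  rewrite (bigD1 (Ordinal jl)) //= -zE eqxx mulr1 big1 ?addr0 // => i ij.
  case: eqP => //= E; rewrite ?mulr0//; exfalso; move/eqP: ij; apply.
  by apply: val_inj => /=; lia.
rewrite f0 // big1 // => i _; case: eqP => E; rewrite ?mulr0 //.
by exfalso; move/negP: zout; apply; have := ltn_ord i; lia.
Qed.

(** Chapman-Kolmogorov over a window containing every site reachable in [n] steps, so that cutting
    off outside it changes nothing. *)
Lemma kerD n m x y lo (l : nat) : lo <= x - n%:Z -> x + n%:Z < lo + l%:Z ->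
  p (n + m) x y = \sum_(j < l) p n x (lo + j%:Z) * p m (lo + j%:Z) y.
Proof.
move=> h1 h2; rewrite /ker iterD.
transitivity (iter n (wop e) (fun z => ((lo <= z) && (z < lo + l%:Z))%:R *
    iter m (wop e) (fun z => (z == y)%:R) z) x).
  apply: iter_wop_local => i ni.
  have -> : (lo <= x - n%:Z + i%:Z *+ 2) && (x - n%:Z + i%:Z *+ 2 < lo + l%:Z).
    by lia.
  by rewrite mul1r.
rewrite (@iter_wop_windowE n lo l); last by move=> z /negbTE ->; rewrite mul0r.
apply: eq_bigr => j _; rewrite mulrC; congr (_ * _).
have -> : (lo <= lo + j%:Z) && (lo + j%:Z < lo + l%:Z).
  by have := ltn_ord j; lia.
by rewrite mul1r.
Qed.

Lemma mop_convex (f : int -> R) x : (wop e f x) ^+ 2 <= wop e (fun z => f z ^+ 2) x.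
Proof.
rewrite !wopE; have /andP[] := ec01 c0 x; set a := e x.
set u := f (x + 1); set v := f (x - 1); move=> a0 a1.
have -> : a * u ^+ 2 + (1 - a) * v ^+ 2 =
  (a * u + (1 - a) * v) ^+ 2 + a * (1 - a) * (u - v) ^+ 2 by ring.
by rewrite lerDl mulr_ge0 ?sqr_ge0// mulr_ge0 ?subr_ge0 ?ltW.
Qed.

(** Invariance of [piw]. Since [f] vanishes on both sides of each end of the window, the shifts of
    index leave no boundary term. *)
Lemma pi_mop_sum (f : int -> R) lo (l : nat) : (forall z, 0 <= f z) ->
  f (lo - 1) = 0 -> f lo = 0 ->
  f (lo + l%:Z) = 0 -> f (lo + l%:Z - 1) = 0 ->
  \sum_(j < l) piw c (lo + j%:Z) * wop e f (lo + j%:Z) =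
  \sum_(j < l) piw c (lo + j%:Z) * f (lo + j%:Z).
Proof.
move=> f0 f1 f2 f3 f4.
have E z : piw c z * wop e f z = c z * f (z + 1) + c (z - 1) * f (z - 1).
  have E1 := ec_piw c0 z; have E2 := ecN_piw c0 z.
  by rewrite wopE -[in RHS]E1 -[in RHS]E2; ring.
under eq_bigr do rewrite E.
rewrite big_split /=.
have shift1 : forall (g : int -> R), g lo = 0 -> g (lo + l%:Z) = 0 ->
   \sum_(j < l) g (lo + j%:Z + 1) = \sum_(j < l) g (lo + j%:Z).
  move=> g g0 g1; have : \sum_(j < l.+1) g (lo + j%:Z) = \sum_(j < l) g (lo + j%:Z).
    by rewrite big_ord_recr /= g1 addr0.
  move=> <-; rewrite big_ord_recl /= addr0 g0 add0r; apply: eq_bigr => j _.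
  by congr g; rewrite /bump /=; lia.
have -> : \sum_(j < l) c (lo + j%:Z) * f (lo + j%:Z + 1) =
          \sum_(j < l) c (lo + j%:Z - 1) * f (lo + j%:Z).
  rewrite -(shift1 (fun z => c (z - 1) * f z)) ?f2 ?f3 ?mulr0 //.
  by apply: eq_bigr => j _; rewrite addrK.
have -> : \sum_(j < l) c (lo + j%:Z - 1) * f (lo + j%:Z - 1) =
          \sum_(j < l) c (lo + j%:Z) * f (lo + j%:Z).
  rewrite -(shift1 (fun z => c (z - 1) * f (z - 1))) ?f1 ?f4 ?mulr0 //.
  by apply: eq_bigr => j _; rewrite addrK.
rewrite -big_split /=; apply: eq_bigr => j _; rewrite /piw; ring.
Qed.

Lemma ker_return_pi n b lo (l : nat) :
  lo <= b - n%:Z -> b + n%:Z < lo + l%:Z ->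
  piw c b * p (n + n) b b = \sum_(j < l) piw c (lo + j%:Z) * p n (lo + j%:Z) b ^+ 2.
Proof.
move=> h1 h2; rewrite (kerD _ _ h1 h2) mulr_sumr; apply: eq_bigr => j _.
by rewrite mulrA kerw_rev // -mulrA expr2.
Qed.

(** By [ker_return_pi] both sides are squared norms in the space weighted by [piw], and the operator
    is a contraction there by convexity of the square ([mop_convex]) and invariance
    ([pi_mop_sum]). *)
Lemma ker_return_antitone n b : p (n.+1 + n.+1) b b <= p (n + n) b b.
Proof.
rewrite -(ler_pM2l (piw_gt0 c0 b)).
(* The window is wide enough for the kernel of [n] steps to vanish at both ends, as [pi_mop_sum]
   requires. *)
pose lo := b - n.+3%:Z; pose l := (2 * n.+4)%N.
rewrite !(@ker_return_pi _ _ lo l) /lo /l; try lia.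
have H z : n%:Z < `|z - b| -> p n z b ^+ 2 = 0.
  by move=> hz; rewrite kerw_far ?expr0n// distrC.
rewrite -[leRHS](@pi_mop_sum (fun z => p n z b ^+ 2)); first last.
- by rewrite H //; lia.
- by rewrite H //; lia.
- by rewrite H //; lia.
- by rewrite H //; lia.
- by move=> z; apply: sqr_ge0.
apply: ler_sum => j _; rewrite ler_pM2l ?piw_gt0//.
exact: (mop_convex (fun z => p n z b)).
Qed.

Lemma ker_return_le m n b : (m <= n)%N -> p (n + n) b b <= p (m + m) b b.
Proof.
move=> /subnK <-; elim: (n - m)%N => // k; apply: le_trans.
exact: ker_return_antitone.
Qed.

(** The Green function at [y] of the walk killed on reaching [y + n]: [piw c y] times the resistance
    between the start and [y + n], the start being moved to [y] when it lies to the left, which is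
    the role of [Num.max]. *)
Definition green_fun (y : int) (n : nat) (x : int) : R :=
  piw c y * \sum_(absz (Num.max (x - y) 0) <= i < n) (c (y + i%:Z))^-1.

Lemma green_fun_ge0 y n x : 0 <= green_fun y n x.
Proof.
apply: mulr_ge0; first exact/ltW/piw_gt0.
apply: sumr_ge0 => i _.
by rewrite invr_ge0 ltW.
Qed.

Lemma green_funE y n x : x < y + n%:Z ->
  (x == y)%:R + wop e (green_fun y n) x = green_fun y n x.
Proof.
move=> xn; rewrite wopE /green_fun.
have [xy|yx|xy] := ltgtP x y.
- have -> : absz (Num.max (x + 1 - y) 0) = 0%N by lia.
  have -> : absz (Num.max (x - 1 - y) 0) = 0%N by lia.
  have -> : absz (Num.max (x - y) 0) = 0%N by lia.
  by rewrite /= add0r; ring.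
- have [j xE] : exists j : nat, x = y + j.+1%:Z.
    by exists (`|x - y|.-1)%N; lia.
  have -> : absz (Num.max (x + 1 - y) 0) = j.+2 by lia.
  have -> : absz (Num.max (x - 1 - y) 0) = j by lia.
  have -> : absz (Num.max (x - y) 0) = j.+1 by lia.
  have jn : (j.+1 < n)%N by lia.
  rewrite [\sum_(j <= i < n) _]big_ltn; last exact: ltnW.
  rewrite [\sum_(j.+1 <= i < n) _]big_ltn //.
  have H1 := ec_V c0 x; have H2 := ecN_V c0 x.
  have -> : y + j.+1%:Z = x by lia.
  have -> : y + j%:Z = x - 1 by lia.
  set s := \sum_(_ <= _ < _) _.
  rewrite /= add0r.
  transitivity (piw c y * ((1 - e x) / c (x - 1) + (1 - e x) / c x + s)).
    by ring.
  by rewrite H2 -H1; ring.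
- subst y; have n0 : (0 < n)%N by lia.
  have -> : absz (Num.max (x + 1 - x) 0) = 1%N by lia.
  have -> : absz (Num.max (x - 1 - x) 0) = 0%N by lia.
  have -> : absz (Num.max (x - x) 0) = 0%N by lia.
  rewrite [\sum_(0 <= i < n) _]big_ltn // addr0.
  set s := \sum_(_ <= _ < _) _.
  have H : piw c x * (e x / c x) = 1 by rewrite ec_V // divff // gt_eqF ?piw_gt0.
  rewrite -[LHS]/(1 + _) -[X in X + _ = _]H.
  by ring.
Qed.

Definition visits (m : nat) (y x : int) : R := \sum_(i < m) p i x y.

Lemma visitsS m y x : visits m.+1 y x = (x == y)%:R + wop e (visits m y) x.
Proof.
rewrite /visits big_ord_recl /= mop_sum; congr (_ + _).
Qed.

Lemma visits_nd m y x : visits m y x <= visits m.+1 y x.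
Proof. by rewrite /visits big_ord_recr /= lerDl; apply: ker_ge0. Qed.

(** Induction on time with the Poisson equation [green_funE]: visits before reaching [y + n] are
    counted by [green_fun], later ones by the visits from [y + n]. *)
Lemma green_bound y (n m : nat) x : x <= y + n%:Z ->
  visits m y x <= visits m y (y + n%:Z) + green_fun y n x.
Proof.
elim: m x => [|m IH] x.
  by rewrite /visits !big_ord0 add0r green_fun_ge0.
rewrite le_eqVlt => /orP[/eqP ->|xn]; first by rewrite lerDl green_fun_ge0.
rewrite visitsS -(green_funE xn) addrCA lerD2l.
apply: (@le_trans _ _ (wop e (fun z => visits m y (y + n%:Z) + green_fun y n z) x)).
  by apply: mop_le => // mv; apply: IH; case: mv; rewrite /wstep; lia.
by rewrite mopD (mop_cst _ wt1) lerD2r visits_nd.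
Qed.

(* Before hitting [y + n] the number of visits to [y] is controlled by the
   resistance between the two points; afterwards reversibility makes [y]
   unlikely. *)
Lemma return_bound y n m :
  p (m + m) y y <= piw c y * (\sum_(i < n) (c (y + i%:Z))^-1) / m.+1%:R +
                   2 * (piw c y / piw c (y + n%:Z)).
Proof.
have m0 : (0 : R) < m.+1%:R by rewrite ltr0n.
rewrite -(ler_pM2l m0) mulrDr [m.+1%:R * (_ / _)]mulrCA mulfV ?gt_eqF// mulr1.
(* Return probabilities decrease along even times, so the one at time [m + m] is at most the average
   of those before it. *)
have H1 : m.+1%:R * p (m + m) y y <= \sum_(i < m.+1) p (i + i) y y.
  rewrite mulr_natl -[X in _ *+ X]card_ord -sumr_const.
  by apply: ler_sum => i _; apply: ker_return_le; rewrite -ltnS.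
apply: (le_trans H1).
have H2 : \sum_(i < m.+1) p (i + i) y y <= visits (m + m).+1 y y.
  elim: (m) => [|k IH]; first by rewrite /visits !big_ord1.
  rewrite big_ord_recr /= [leRHS]/visits [leRHS]big_ord_recr /=.
  apply: lerD => //; apply: (le_trans IH); rewrite addSn addnS.
  exact: visits_nd.
apply: (le_trans H2).
have yn : y <= y + n%:Z by lia.
apply: (le_trans (green_bound _ yn)); rewrite addrC; apply: lerD.
  by rewrite /green_fun subrr maxxx absz0 big_mkord.
rewrite [leRHS]mulrA; apply: (@le_trans _ _ ((m + m).+1%:R * (piw c y / piw c (y + n%:Z)))).
  rewrite mulr_natl -[X in _ *+ X]card_ord -sumr_const; apply: ler_sum => i _.
  exact: kerw_le_pi.
apply: ler_wpM2r; first by rewrite divr_ge0 ?ltW ?piw_gt0.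
by rewrite -natrM ler_nat; lia.
Qed.

(** A walk found at or beyond [k] has passed through [i] and then visited [k], so the probability is
    at most the mean number of visits to [k] from [i]. [H] treats a start to the left of [k], the
    final induction the passage through [i]. *)
Lemma exit_visits (k i : int) n x : x <= i -> i < k ->
  iter n (wop e) (fun z => (k <= z)%R%:R) x <= visits n.+1 k i.
Proof.
move=> xi ik.
have H m z : z <= k ->
    iter m (wop e) (fun z => (k <= z)%R%:R) z <= visits m.+1 k z.
  elim: m z => [|m IH] z zk.
    by rewrite /visits big_ord1 /ker /= eq_le zk.
  move: zk; rewrite le_eqVlt => /orP[/eqP ->|zk].
    rewrite visitsS eqxx; apply: (@le_trans _ _ 1).
      apply: (@le_trans _ _ (iter m.+1 (wop e) (fun=> 1) k)); last by rewrite (iter_mop_cst _ wt1).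
      apply: iter_mop_le => // t.
      by case: (k <= t)%R; rewrite ?ler01.
    rewrite lerDl; apply: mop_ge0 => // mv; rewrite /visits; apply: sumr_ge0 => j _.
    exact: ker_ge0.
  rewrite visitsS lt_eqF // add0r iterS; apply: mop_le => // mv; apply: IH.
  by case: mv; rewrite /wstep; lia.
elim: n x xi => [|n IH] x xi; first by
  rewrite /=; case: (leP k x) => [|_]; [lia|]; rewrite /visits big_ord1; apply: ker_ge0.
move: xi; rewrite le_eqVlt => /orP[/eqP ->|xi]; first by apply: H; lia.
apply: le_trans (visits_nd _ _ _); rewrite iterS -[leRHS](mop_cst wstep wt1 _ x).
by apply: mop_le => // mv; apply: IH; case: mv; rewrite /wstep; lia.
Qed.

Lemma exit_bound (k i : int) n x : x <= i -> i < k ->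
  iter n (wop e) (fun z => (k <= z)%R%:R) x <= n.+1%:R * (piw c k / piw c i).
Proof.
move=> xi ik; apply: (le_trans (exit_visits n xi ik)).
rewrite mulr_natl -[X in _ *+ X]card_ord -sumr_const; apply: ler_sum => j _.
exact: kerw_le_pi.
Qed.

(** Cauchy-Schwarz: by reversibility the return probability at time [n + n] dominates the weighted
    square sum of the kernel at time [n], whose mass in the window is at least [s]. *)
Lemma return_lower n b lo (l : nat) s :
  0 <= s -> s <= iter n (wop e) (fun z => ((lo <= z) && (z < lo + l%:Z))%:R) b ->
  s ^+ 2 * piw c b <= p (n + n) b b * \sum_(j < l) piw c (lo + j%:Z).
Proof.
move=> s0 hs; set Pi := \sum_(j < l) _.
set S := iter _ _ _ _ in hs.
have SE : S = \sum_(j < l) p n b (lo + j%:Z).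
  rewrite /S (@iter_wop_windowE _ lo l) => [|z /negbTE -> //].
  apply: eq_bigr => j _; rewrite -[RHS]mul1r; congr (_ * _).
  have -> // : (lo <= lo + j%:Z) && (lo + j%:Z < lo + l%:Z).
  by have := ltn_ord j; lia.
have [l0|l0] := posnP l.
  have s1 : s <= 0 by apply: (le_trans hs); rewrite SE big1 // => j; have := ltn_ord j; rewrite [X in (_ < X)%N]l0.
  have -> : s = 0 by apply/eqP; rewrite eq_le s1.
  by rewrite expr0n mul0r mulr_ge0 ?ker_ge0 // sumr_ge0 // => j _; rewrite ltW ?piw_gt0.
have Pi0 : 0 < Pi.
  rewrite /Pi (bigD1 (Ordinal l0)) //= ltr_wpDr ?piw_gt0//.
  by apply: sumr_ge0 => j _; rewrite ltW ?piw_gt0.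
have H : \sum_(j < l) p n (lo + j%:Z) b * p n b (lo + j%:Z) <= p (n + n) b b.
  rewrite [leRHS]/ker iterD.
  apply: (@iter_wop_window n lo l (fun z => p n z b)) => z.
  exact: ker_ge0.
apply: (@le_trans _ _ (S ^+ 2 * piw c b)).
  by rewrite ler_pM2r ?piw_gt0// ler_sqr ?nnegrE// (le_trans s0).
rewrite -(ler_pM2r Pi0) in H.
apply: le_trans H.
(* Cauchy-Schwarz in the form of a completed square for every [t]; the optimum is [t = S / Pi]. *)
have H2 t : 2 * t * S - t ^+ 2 * Pi <=
    \sum_(j < l) p n b (lo + j%:Z) ^+ 2 / piw c (lo + j%:Z).
  rewrite SE mulr_sumr mulr_sumr -sumrB; apply: ler_sum => j _.
  set q := p _ _ _; set w := piw _ _.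
  have w0 : 0 < w by exact: piw_gt0.
  rewrite ler_pdivlMr // -subr_ge0.
  have -> : q ^+ 2 - (2 * t * q - t ^+ 2 * w) * w = (q - t * w) ^+ 2 by ring.
  exact: sqr_ge0.
have := H2 (S / Pi).
have -> : 2 * (S / Pi) * S - (S / Pi) ^+ 2 * Pi = S ^+ 2 / Pi.
  by field; rewrite gt_eqF.
rewrite ler_pdivrMr // => H3.
apply: (@le_trans _ _ ((\sum_(j < l) p n b (lo + j%:Z) ^+ 2 / piw c (lo + j%:Z)) * Pi * piw c b)).
  by rewrite ler_pM2r ?piw_gt0.
rewrite mulrAC ler_pM2r // mulr_suml; apply: ler_sum => j _.
have w0 : 0 < piw c (lo + j%:Z) by exact: piw_gt0.
have h := kerw_rev c0 n b (lo + j%:Z).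
have -> : p n b (lo + j%:Z) ^+ 2 / piw c (lo + j%:Z) * piw c b =
  p n b (lo + j%:Z) * (piw c b * p n b (lo + j%:Z)) / piw c (lo + j%:Z) by ring.
by rewrite h mulrCA mulrAC divff ?gt_eqF// mul1r mulrC.
Qed.

End WalkEstimates.

(** * Hitting times and gambler's ruin *)

Section Hitting.
Variable R : realType.
Variable c : int -> R.
Hypothesis c0 : forall k, 0 < c k.
Local Notation e := (ec c).
Let wt0 := wwt_ge0 (ec01 c0).
Let wt1 := wwt_sum1 e.

(** The mean time to reach [y + n] from [y + j] for the walk reflected at [y], steps made at [y]
    itself not being counted. *)
Definition hit_time (y : int) (n j : nat) : R :=
  \sum_(j <= i < n) (c (y + i%:Z))^-1 * \sum_(l < i) piw c (y + l.+1%:Z).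

(** The gambler's ruin probability of reaching [y] before [y + n] from [y + j], as a ratio of
    resistances. *)
Definition hit_left (y : int) (n j : nat) : R :=
  (\sum_(j <= i < n) (c (y + i%:Z))^-1) / (\sum_(0 <= i < n) (c (y + i%:Z))^-1).

Lemma hit_time_ge0 y n j : 0 <= hit_time y n j.
Proof.
apply: sumr_ge0 => i _; apply: mulr_ge0; first by rewrite invr_ge0 ltW.
by apply: sumr_ge0 => l _; apply/ltW/piw_gt0.
Qed.

Lemma hit_left_ge0 y n j : 0 <= hit_left y n j.
Proof. by apply: divr_ge0; apply: sumr_ge0 => i _; rewrite invr_ge0 ltW. Qed.

Lemma hit_timeE y n j : (0 < j < n)%N ->
  1 + (e (y + j%:Z) * hit_time y n j.+1 + (1 - e (y + j%:Z)) * hit_time y n j.-1) =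
  hit_time y n j.
Proof.
case: j => // j /= jn; rewrite /hit_time [in RHS]big_ltn //.
rewrite [\sum_(j <= i < n) _]big_ltn; last exact: ltnW.
rewrite [X in _ = _ + X](_ : _ = \sum_(j.+2 <= i < n)
  (c (y + i%:Z))^-1 * \sum_(l < i) piw c (y + l.+1%:Z)); last by [].
rewrite [\sum_(j.+1 <= i < n) _]big_ltn // big_ord_recr /=.
set x := y + j.+1%:Z; have -> : y + j%:Z = x - 1 by rewrite /x; lia.
set s := \sum_(j.+2 <= _ < _) _; set S := \sum_(l < j) _.
have H1 := ec_V c0 x; have H2 := ecN_V c0 x.
have H3 : (e x / c x) * piw c x = 1 by rewrite H1 mulVf // gt_eqF ?piw_gt0.
have -> : 1 + (e x * s + (1 - e x) * ((c (x - 1))^-1 * S +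
    ((c x)^-1 * (S + piw c x) + s))) =
  1 - (e x / c x) * piw c x + ((1 - e x) / c (x - 1) - e x / c x) * S +
  ((c x)^-1 * (S + piw c x) + s) by ring.
by rewrite H3 H2 H1 !subrr mul0r !add0r.
Qed.

Lemma hit_leftE y n j : (0 < j < n)%N ->
  e (y + j%:Z) * hit_left y n j.+1 + (1 - e (y + j%:Z)) * hit_left y n j.-1 =
  hit_left y n j.
Proof.
case: j => // j /= jn; rewrite /hit_left !mulrA -mulrDl; congr (_ / _).
rewrite [in RHS]big_ltn //.
rewrite [\sum_(j <= i < n) _]big_ltn; last exact: ltnW.
rewrite [\sum_(j.+1 <= i < n) _]big_ltn //.
set x := y + j.+1%:Z; have -> : y + j%:Z = x - 1 by rewrite /x; lia.
set s := \sum_(j.+2 <= _ < _) _.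
have H1 := ec_V c0 x; have H2 := ecN_V c0 x.
transitivity ((1 - e x) / c (x - 1) - e x / c x + (c x)^-1 + s); first by ring.
by rewrite H1 H2 subrr add0r.
Qed.

Definition avoid (b : int) (k : nat) (x : int) : R :=
  surv wstep (wwt e) (fun _ z => z != b) k 0 x.

Lemma avoidE b k x : avoid b k x = 1 - \sum_(i < k.+1) first_hit wstep (wwt e) b i x.
Proof. by rewrite /avoid surv_first_hit. Qed.

Lemma avoid_le1 b k x : avoid b k x <= 1.
Proof.
by rewrite avoidE gerBl sumr_ge0 // => i _; apply: first_hit_ge0.
Qed.

Lemma avoidS b k x : avoid b k.+1 x = (x != b)%:R * wop e (avoid b k) x.
Proof.
rewrite /avoid /=; congr (_ * _); apply: mop_ext => z.
by rewrite !surv_first_hit.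
Qed.

(** The sum of tails is the mean of the hitting time truncated at [m]. Up to the exit from the
    interval the time is controlled by [hit_time]; on reaching [y] the walk is given up and the
    whole of [m] is paid. *)
Lemma avoid_sum_le y n m j : (0 < n)%N -> (j <= n)%N ->
  \sum_(k < m) avoid (y + n%:Z) k (y + j%:Z) <=
  hit_time y n j + m%:R * hit_left y n j.
Proof.
move=> n0; elim: m j => [|m IH] j jn.
  by rewrite big_ord0 mul0r addr0 hit_time_ge0.
move: jn; rewrite leq_eqVlt => /orP[/eqP ->|jn].
  rewrite big1 => [|k _].
    apply: addr_ge0; first exact: hit_time_ge0.
    by apply: mulr_ge0 => //; exact: hit_left_ge0.
  by case: (k : nat) => [|k']; rewrite ?avoidS /avoid /= eqxx ?mul0r.
have [->|j0] := posnP j.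
  apply: (@le_trans _ _ (m.+1%:R)).
    rewrite -[X in X%:R]card_ord -sumr_const; apply: ler_sum => k _.
    exact: avoid_le1.
  rewrite /hit_left divff ?mulr1 ?lerDr ?hit_time_ge0//.
  rewrite big_mkord (bigD1 (Ordinal n0)) //= gt_eqF // ltr_wpDr ?invr_gt0//.
  by apply: sumr_ge0 => i _; rewrite invr_ge0 ltW.
have xb : y + j%:Z != y + n%:Z by lia.
rewrite big_ord_recl {1}/avoid /= xb.
under eq_bigr do rewrite /bump /= add1n avoidS xb mul1r.
rewrite -mop_sum wopE.
have -> : y + j%:Z + 1 = y + j.+1%:Z by lia.
have -> : y + j%:Z - 1 = y + j.-1%:Z by lia.
have jn0 : (0 < j < n)%N by rewrite j0.
have /andP[e0 e1] := ec01 c0 (y + j%:Z).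
rewrite -(hit_timeE y jn0) -addrA lerD2l.
apply: (@le_trans _ _ (e (y + j%:Z) * (hit_time y n j.+1 + m%:R * hit_left y n j.+1) +
  (1 - e (y + j%:Z)) * (hit_time y n j.-1 + m%:R * hit_left y n j.-1))).
  apply: lerD; apply: ler_wpM2l.
  - exact: ltW.
  - exact: IH.
  - by rewrite subr_ge0 ltW.
  - by apply: IH; lia.
have -> : e (y + j%:Z) * (hit_time y n j.+1 + m%:R * hit_left y n j.+1) +
  (1 - e (y + j%:Z)) * (hit_time y n j.-1 + m%:R * hit_left y n j.-1) =
  e (y + j%:Z) * hit_time y n j.+1 + (1 - e (y + j%:Z)) * hit_time y n j.-1 +
  m%:R * (e (y + j%:Z) * hit_left y n j.+1 + (1 - e (y + j%:Z)) * hit_left y n j.-1).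
  by ring.
rewrite lerD2l hit_leftE //; apply: ler_wpM2r; first exact: hit_left_ge0.
by rewrite ler_nat.
Qed.

(** Markov's inequality: the avoidance probability decreases in time, so [m.+1] times its last value
    is at most the sum bounded in [avoid_sum_le]. *)
Lemma first_hit_lower y n m j : (0 < n)%N -> (j <= n)%N ->
  1 - hit_time y n j / m.+1%:R - hit_left y n j <=
  \sum_(k < m.+1) first_hit wstep (wwt e) (y + n%:Z) k (y + j%:Z).
Proof.
move=> n0 jn; have m0 : (0 : R) < m.+1%:R by rewrite ltr0n.
have H : m.+1%:R * avoid (y + n%:Z) m (y + j%:Z) <=
    \sum_(k < m.+1) avoid (y + n%:Z) k (y + j%:Z).
  rewrite mulr_natl -[X in _ *+ X]card_ord -sumr_const; apply: ler_sum => k _.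
  rewrite !avoidE lerD2l lerN2.
  rewrite [leRHS](big_ord_widen m.+1 (fun i => first_hit wstep (wwt e) (y + n%:Z) i (y + j%:Z))) //.
  rewrite (big_ord_widen m.+1 (fun i => first_hit wstep (wwt e) (y + n%:Z) i (y + j%:Z))) ?ltn_ord //.
  rewrite [leRHS](bigID (fun i : 'I_m.+1 => (i < k.+1)%N)) /=.
  have -> : \sum_(i < m.+1 | (i < m.+1)%N && (i < k.+1)%N)
     first_hit wstep (wwt e) (y + n%:Z) i (y + j%:Z) =
    \sum_(i < m.+1 | (i < k.+1)%N)
     first_hit wstep (wwt e) (y + n%:Z) i (y + j%:Z).
    by apply: eq_bigl => i; rewrite ltn_ord.
  by rewrite lerDl; apply: sumr_ge0 => i _; apply: first_hit_ge0.
have K := le_trans H (avoid_sum_le y m.+1 n0 jn).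
have {}K : avoid (y + n%:Z) m (y + j%:Z) <= (hit_time y n j + m.+1%:R * hit_left y n j) / m.+1%:R.
  by rewrite ler_pdivlMr // mulrC.
rewrite avoidE mulrDl [m.+1%:R * hit_left _ _ _]mulrC mulfK ?gt_eqF // in K.
by rewrite -addrA -opprD lerBlDr addrC -lerBlDr.
Qed.

End Hitting.

Section Reflection.
Variables (R : realType) (c : int -> R).
Hypothesis c0 : forall k, 0 < c k.

(** Reflection sends the edge from [k] to [k + 1] to the edge from [- k - 1] to [- k], which is
    indexed by its left end. *)
Definition reflc (k : int) : R := c (- k - 1).

Lemma reflc_gt0 k : 0 < reflc k. Proof. exact: c0. Qed.

Lemma ec_reflc k : ec reflc k = 1 - ec c (- k).
Proof.
have H := piw_gt0 c0 (- k).
rewrite /ec /reflc; have -> : - (k - 1) - 1 = - k by lia.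
by move: H; rewrite /piw => H; field; rewrite ?gt_eqF // addrC gt_eqF.
Qed.

Lemma iter_wop_reflc n f x :
  iter n (wop (ec reflc)) f x = iter n (wop (ec c)) (fun z => f (- z)) (- x).
Proof.
elim: n x => [|n IH] x; first by rewrite /= opprK.
rewrite !iterS !wopE !IH ec_reflc.
have -> : - (x + 1) = - x - 1 by lia.
have -> : - (x - 1) = - x + 1 by lia.
by ring.
Qed.

Lemma kerw_reflc n x y : kerw (ec reflc) n x y = kerw (ec c) n (- x) (- y).
Proof.
rewrite /ker iter_wop_reflc; apply: iter_mop_ext => z.
by have -> : (- z == y) = (z == - y) by lia.
Qed.

End Reflection.

(** * Simple random walk *)

Section SimpleWalk.
Variable R : realType.
Local Notation hp := (fun=> 1 / 2 : R).

Lemma ec_cst1 : ec (fun=> 1 : R) = hp.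
Proof. by apply/funext => k; rewrite /ec. Qed.

Lemma kerw_half_binom n x i : kerw hp n x (x - n%:Z + i%:Z *+ 2) = 'C(n, i)%:R / 2 ^+ n.
Proof.
elim: n x i => [|n IH] x i.
  rewrite /ker /= expr0 divr1; case: i => [|i]; first by rewrite bin0; have -> : (x == x - 0%:Z + 0%:Z *+ 2) by lia.
  by rewrite bin0n; have -> : (x == x - 0%:Z + i.+1%:Z *+ 2) = false by lia.
rewrite kerS wopE.
have -> : x - n.+1%:Z + i%:Z *+ 2 = x - 1 - n%:Z + i%:Z *+ 2 by lia.
rewrite [kerw _ n (x - 1) _]IH; case: i => [|i].
  rewrite kerw_far; last by lia.
  by rewrite !bin0 exprS; field; rewrite expf_neq0 // pnatr_eq0.
have -> : x - 1 - n%:Z + i.+1%:Z *+ 2 = x + 1 - n%:Z + i%:Z *+ 2 by lia.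
rewrite IH binS natrD exprS; field; by rewrite expf_neq0 // pnatr_eq0.
Qed.

Definition srw_return (j : nat) : R := 'C(j + j, j)%:R / 2 ^+ (j + j).

Lemma kerw_half_return j x : kerw hp (j + j) x x = srw_return j.
Proof.
rewrite /srw_return -(kerw_half_binom _ x); congr (kerw _ _ _ _); lia.
Qed.

Lemma srw_return0 : srw_return 0 = 1.
Proof. by rewrite /srw_return bin0 expr0 divr1. Qed.

Lemma srw_returnS j :
  srw_return j.+1 * (2 * j.+1%:R) = srw_return j * (2 * j%:R + 1).
Proof.
rewrite /srw_return addSn addnS !exprS.
have p0 : (2 : R) ^+ (j + j) != 0 by rewrite expf_neq0 // pnatr_eq0.
have H : 'C((j + j).+2, j.+1)%:R * j.+1%:R = 2 * 'C(j + j, j)%:R * (2 * j%:R + 1) :> R.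
  have H1 : ((j + j).+2 * 'C((j + j).+1, j) = j.+1 * 'C((j + j).+2, j.+1))%N.
    exact: mul_bin_diag.
  have H2 : ((j + j).+1 * 'C(j + j, j) = j.+1 * 'C((j + j).+1, j))%N.
    by rewrite (mul_bin_down (j + j).+1 j) subSn ?leq_addr// addnK.
  have H3 : ('C((j + j).+2, j.+1) * j.+1 = 2 * 'C(j + j, j) * (2 * j + 1))%N.
    by rewrite mulnC -H1; nia.
  by rewrite -natrM H3 !natrM natrD natrM.
rewrite -[in RHS]mulrA [_^-1 * _]mulrC mulrA.
transitivity ('C((j + j).+2, j.+1)%:R * j.+1%:R / (2 * 2 ^+ (j + j)) : R).
  by field.
by rewrite H; field.
Qed.

Lemma srw_return_ge0 j : 0 <= srw_return j.
Proof. by rewrite divr_ge0 ?exprn_ge0. Qed.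

(** By the recursion [srw_returnS] the square of the return probability times [2 * j + 1] is
    nonincreasing; times [4 * j] it is nondecreasing, which gives [srw_return_lower]. *)
Lemma srw_return_upper j : srw_return j ^+ 2 * (2 * j%:R + 1) <= 1.
Proof.
elim: j => [|j IH]; first by rewrite srw_return0 expr1n mul1r mulr0 add0r.
have E := srw_returnS j.
have j0 : (0 : R) <= j%:R by rewrite ler0n.
rewrite -[j.+1%:R]natr1 in E *.
set u := srw_return j.+1 in E *; set v := srw_return j in E IH *; set t := j%:R in E j0 IH *.
have -> : u = v * (2 * t + 1) / (2 * (t + 1)) by rewrite -E; field; lra.
have -> : (v * (2 * t + 1) / (2 * (t + 1))) ^+ 2 * (2 * (t + 1) + 1) =
  (v ^+ 2 * (2 * t + 1)) * ((2 * t + 1) * (2 * t + 3) / (2 * (t + 1)) ^+ 2).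
  by field; lra.
apply: mulr_ile1 => //.
- by apply: mulr_ge0; [exact: sqr_ge0|lra].
- by apply: divr_ge0; [nra|exact: sqr_ge0].
- by rewrite ler_pdivrMr ?mul1r; nra.
Qed.

Lemma srw_return_lower j : (0 < j)%N -> 1 <= srw_return j ^+ 2 * (4 * j%:R).
Proof.
case: j => // j _; elim: j => [|j IH].
  have := srw_returnS 0; rewrite srw_return0 !mulr1 mulr0 add0r mulr1 => H.
  nra.
have E := srw_returnS j.+1.
have j0 : (0 : R) < j.+1%:R by rewrite ltr0n.
rewrite -[j.+2%:R]natr1 in E *.
set u := srw_return j.+2 in E *; set v := srw_return j.+1 in E IH *; set t := j.+1%:R in E j0 IH *.
have -> : u = v * (2 * t + 1) / (2 * (t + 1)) by rewrite -E; field; lra.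
have -> : (v * (2 * t + 1) / (2 * (t + 1))) ^+ 2 * (4 * (t + 1)) =
  (v ^+ 2 * (4 * t)) * ((2 * t + 1) ^+ 2 / (4 * t * (t + 1))).
  by field; lra.
apply: mulr_ege1 => //.
by rewrite ler_pdivlMr ?mul1r; nra.
Qed.

(** Telescoping: the recursion makes twice the decrement equal to the return probability over
    [j + 1], which dominates its cube by [srw_return_upper]. *)
Lemma srw_return_cube_sum n : \sum_(j < n) srw_return j ^+ 3 <= 2.
Proof.
have H j : srw_return j ^+ 3 <= 2 * (srw_return j - srw_return j.+1).
  have E := srw_returnS j; have U := srw_return_upper j; have u0 := srw_return_ge0 j.
  have j0 : (0 : R) <= j%:R by rewrite ler0n.
  rewrite -[j.+1%:R]natr1 in E.
  set u := srw_return j.+1 in E *; set v := srw_return j in E U u0 *; set t := j%:R in E j0 U *.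
  have -> : u = v * (2 * t + 1) / (2 * (t + 1)) by rewrite -E; field; lra.
  have -> : 2 * (v - v * (2 * t + 1) / (2 * (t + 1))) = v / (t + 1) by field; lra.
  rewrite ler_pdivlMr; last by lra.
  rewrite exprS -mulrA ler_piMr //; apply: le_trans U.
  by rewrite ler_wpM2l ?sqr_ge0 //; lra.
apply: (@le_trans _ _ (\sum_(j < n) 2 * (srw_return j - srw_return j.+1))).
  exact: ler_sum.
rewrite -mulr_sumr; have -> : \sum_(j < n) (srw_return j - srw_return j.+1) = 1 - srw_return n.
  elim: n => [|n IH]; first by rewrite big_ord0 srw_return0 subrr.
  by rewrite big_ord_recr /= IH addrA subrK.
by have := srw_return_ge0 n; lra.
Qed.

Lemma kerw_half_sym n x y : kerw hp n x y = kerw hp n y x.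
Proof.
have := @kerw_rev R (fun=> 1) (fun=> ltr01) n x y; rewrite ec_cst1 /piw.
by move/(mulfI _); apply; rewrite gt_eqF.
Qed.

(** At even times Chapman-Kolmogorov, symmetry and the arithmetic-geometric inequality bound the
    kernel between two sites by the average of the two returns; at odd times one step is averaged
    out. *)
Lemma kerw_half_le n x y : kerw hp n x y <= srw_return n./2.
Proof.
have H m a b : kerw hp (m + m) a b <= srw_return m.
  have c0 : forall k : int, 0 < (fun=> 1 : R) k by [].
  pose lo := Num.min a b - m%:Z - 1.
  pose l := (absz (a - b) + 2 * m + 3)%N.
  have ha1 : lo <= a - m%:Z by rewrite /lo; lia.
  have ha2 : a + m%:Z < lo + l%:Z by rewrite /lo /l; lia.
  have hb1 : lo <= b - m%:Z by rewrite /lo; lia.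
  have hb2 : b + m%:Z < lo + l%:Z by rewrite /lo /l; lia.
  have Ka := ker_return_pi c0 ha1 ha2; have Kb := ker_return_pi c0 hb1 hb2.
  have Kab := kerD (fun=> 1 : R) m b ha1 ha2.
  rewrite ec_cst1 kerw_half_return in Ka; rewrite ec_cst1 kerw_half_return in Kb.
  rewrite ec_cst1 in Kab; rewrite Kab.
  clear c0.
  have E : \sum_(j < l) kerw hp m a (lo + j%:Z) * kerw hp m (lo + j%:Z) b <=
      \sum_(j < l) (piw (fun=> 1 : R) (lo + j%:Z) * kerw hp m (lo + j%:Z) a ^+ 2 / 4 +
      piw (fun=> 1 : R) (lo + j%:Z) * kerw hp m (lo + j%:Z) b ^+ 2 / 4).
    apply: ler_sum => j _; rewrite (kerw_half_sym m a) /piw.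
    set u := kerw _ _ _ a; set v := kerw _ _ _ b; have := sqr_ge0 (u - v); nra.
  apply: (le_trans E); rewrite big_split /= -!mulr_suml -Ka -Kb /piw; lra.
rewrite -[in X in X <= _](odd_double_half n) -addnn; case: (odd n) => /=; rewrite ?add0n //.
rewrite -[leRHS](mop_cst wstep (wwt_sum1 hp) _ x); apply: mop_le => [|mv].
  by apply: wwt_ge0 => k; lra.
exact: H.
Qed.

End SimpleWalk.

(** * From the quenched law to kernels *)

Section RealProbability.
Context d (T : measurableType d) (R : realType) (Q : probability T R).

Definition pr (A : set T) : R := fine (Q A).

Lemma prE A : measurable A -> Q A = (pr A)%:E.
Proof. by move=> mA; rewrite /pr fineK // fin_num_measure. Qed.

Lemma pr_ge0 A : 0 <= pr A. Proof. by rewrite /pr fine_ge0. Qed.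

Lemma pr_le1 A : measurable A -> pr A <= 1.
Proof. by move=> mA; rewrite -lee_fin -prE // probability_le1. Qed.

Lemma pr_le A B : measurable A -> measurable B -> A `<=` B -> pr A <= pr B.
Proof.
by move=> mA mB AB; rewrite -lee_fin -!prE //; apply: le_measure; rewrite ?inE.
Qed.

Lemma pr_set0 : pr set0 = 0. Proof. by rewrite /pr measure0. Qed.

Lemma prC A : measurable A -> pr (~` A) = 1 - pr A.
Proof.
move=> mA; rewrite {1}/pr probability_setC // prE //.
Qed.

Lemma pr_finU (M : finType) (F : M -> set T) :
  (forall i, measurable (F i)) -> (forall i j, F i `&` F j !=set0 -> i = j) ->
  pr (\bigcup_i F i) = \sum_i pr (F i).
Proof.
move=> mF tF; apply: EFin_inj; rewrite -prE; last first.
  by apply: fin_bigcup_measurable => //; exact: finite_finset.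
rewrite -sumEFin (eq_bigr (fun i => Q (F i))); last by move=> i _; rewrite prE.
rewrite measure_fin_bigcup //; try exact: finite_finset; try by move=> i j _ _; apply: tF.
rewrite [RHS]fsbig_seq ?index_enum_uniq //; apply: eq_fsbigl.
by apply/seteqP; split=> i //= _; rewrite mem_index_enum.
Qed.

Lemma prU A B : measurable A -> measurable B -> pr (A `|` B) <= pr A + pr B.
Proof.
move=> mA mB; rewrite -lee_fin EFinD -!prE //; last exact: measurableU.
exact: measureU2.
Qed.

Lemma prD A B : measurable A -> measurable B -> B `<=` A ->
  pr (A `\` B) = pr A - pr B.
Proof.
move=> mA mB BA; apply: EFin_inj; rewrite EFinB -!prE //; last exact: measurableD.
rewrite measureD ?setIidr //.
by rewrite -ge0_fin_numE // fin_num_measure.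
Qed.

End RealProbability.

Lemma mutually_independent_finType d (T : measurableType d) (R : realType)
    (P : probability T R) (K : finType) (G : K -> set_system T) (E : K -> set T) :
  mutually_independent P G -> (forall k, G k (E k)) ->
  P (\bigcap_k E k) = (\prod_k P (E k))%E.
Proof.
move=> ind GE; have := ind [fset x | x in K]%fset E (fun k _ => GE k).
have -> : [set` [fset x | x in K]%fset] = [set: K].
  by apply/seteqP; split=> k //= _; rewrite !inE.
move=> ->; apply: perm_big; apply: uniq_perm; rewrite ?fset_uniq ?index_enum_uniq //.
by move=> k; rewrite mem_index_enum !inE.
Qed.

Section QuenchedMarkov.
Context d (T : measurableType d) (R : realType) (Q : probability T R).
Variables (m r : nat) (S : 'I_m -> nat -> {mfun T >-> int})
  (Z : 'I_r -> nat -> {mfun T >-> int}) (e : env R r) (x : 'rV[int]_(m + r)).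
Hypothesis e01 : forall j y, 0 < e j y < 1.
Hypothesis law : quenched_law Q S Z e x.

Local Notation K := ('I_m + 'I_r)%type.

Definition walker (k : K) : nat -> {mfun T >-> int} :=
  match k with inl i => S i | inr j => Z j end.

Definition walker_env (k : K) : int -> R :=
  match k with inl i => fun=> 1 / 2 | inr j => e j end.

Definition walker_start : {ffun K -> int} :=
  [ffun k => match k with inl i => x ord0 (lshift r i)
                        | inr j => x ord0 (rshift m j) end].

Definition state (n : nat) (t : T) : {ffun K -> int} := [ffun k => walker k n t].

Definition cylinder (n : nat) (y : nat -> {ffun K -> int}) : set T :=
  [set t | forall k, (k <= n)%N -> state k t = y k].

Lemma walker_env01 k z : 0 < walker_env k z < 1.
Proof. by case: k => i /=; [lra|exact: e01]. Qed.

Lemma walker_chain k : markov_chain Q (walker k) (walker_start k) (walker_env k).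
Proof. by case: law => _ HS HZ; rewrite ffunE; case: k. Qed.

Lemma walker_measurable k n (B : set int) : measurable (walker k n @^-1` B).
Proof. by rewrite -[X in measurable X]setTI; apply: measurable_funP. Qed.

Lemma state_measurable n (B : set {ffun K -> int}) : measurable (state n @^-1` B).
Proof.
have -> : state n @^-1` B = \bigcup_(y in B) \bigcap_k (walker k n @^-1` [set y k]).
  apply/seteqP; split=> t /=.
    move=> Bt; exists (state n t) => // k _ /=; by rewrite ffunE.
  case=> y By H; have -> // : state n t = y.
  by apply/ffunP => k; rewrite ffunE (H k).
rewrite bigcup_mkcond; apply: countable_bigcupT_measurable; first exact: countableP.
move=> y; case: ifP => // _; apply: fin_bigcap_measurable; first exact: finite_finset.
by move=> k _; exact: walker_measurable.
Qed.

Lemma cylinderE n y : cylinder n y =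
  \bigcap_k [set t | forall i, (i <= n)%N -> walker k i t = y i k].
Proof.
apply/seteqP; split=> t /=.
  by move=> H k _ i ni; rewrite -(H i ni) ffunE.
by move=> H i ni; apply/ffunP => k; rewrite ffunE (H k).
Qed.

Lemma pr_cylinder_prod n y : Q (cylinder n y) =
  (\prod_k Q [set t | forall i, (i <= n)%N -> walker k i t = y i k])%E.
Proof.
rewrite cylinderE; case: law => ind _ _.
apply: (mutually_independent_finType ind) => k.
set G := (X in process_sigma_algebra X).
have -> : [set t | forall i, (i <= n)%N -> walker k i t = y i k] =
    \bigcap_(i in [set i | (i <= n)%N]) (walker k i @^-1` [set y i k]).
  by apply/seteqP; split.
have H : forall i, process_sigma_algebra G (walker k i @^-1` [set y i k]).
  move=> i; apply: sub_sigma_algebra; exists i => //=.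
  exists [set y i k] => //; rewrite setTI /G; by case: (k).
rewrite /process_sigma_algebra in H *.
set GG := \bigcup_k0 _ in H *.
apply: (@fin_bigcap_measurable _ (g_sigma_algebraType GG)) => [|i _]; last exact: H.
by apply: (sub_finite_set (B := `I_n.+1)); [move=> i /= | exact: finite_II].
Qed.

Definition joint_transition (y z : {ffun K -> int}) : R :=
  \prod_k nn_transition (walker_env k) (y k) (z k).

Lemma pr_cylinderS n y : pr Q (cylinder n.+1 y) =
  pr Q (cylinder n y) * joint_transition (y n) (y n.+1).
Proof.
rewrite /pr !pr_cylinder_prod.
have H k : (Q [set t | forall i, (i <= n.+1)%N -> walker k i t = y i k] =
  Q [set t | forall i, (i <= n)%N -> walker k i t = y i k] *
  (nn_transition (walker_env k) (y n k) (y n.+1 k))%:E)%E.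
  by have [_] := walker_chain k; apply.
rewrite (eq_bigr _ (fun k _ => H k)) big_split /= prodEFin fineM //.
have F k : Q [set t | forall i, (i <= n)%N -> walker k i t = y i k] \is a fin_num.
  apply: fin_num_measure.
  rewrite (_ : [set _ | _] = \bigcap_(i in [set i | (i <= n)%N]) (walker k i @^-1` [set y i k])) //.
  apply: bigcap_measurable => [|i _]; [by exists 0%N|exact: walker_measurable].
by apply: prode_fin_num => k _.
Qed.

Lemma joint_transition_step y s :
  joint_transition y (pstep y s) = pwt walker_env y s.
Proof.
apply: eq_bigr => k _; rewrite ffunE /nn_transition /wstep /wwt.
case: (s k); rewrite ?eqxx //.
by have -> : (y k - 1 == y k + 1) = false by rewrite (inj_eq (addrI _)).
Qed.

Lemma pstep_inj (y : {ffun K -> int}) : injective (pstep y).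
Proof.
move=> s s' /ffunP E; apply/ffunP => k; have := E k; rewrite !ffunE /wstep.
by case: (s k); case: (s' k) => //; lia.
Qed.

Lemma pr_cylinder0 : pr Q (state 0 @^-1` [set~ walker_start]) = 0.
Proof.
have H : pr Q (cylinder 0 (fun=> walker_start)) = 1.
  rewrite /pr pr_cylinder_prod big1 // => k _.
  have [H _] := walker_chain k; rewrite -[RHS]H; congr (Q _).
  apply/seteqP; split=> t /=; first by apply.
  by move=> E i; rewrite leqn0 => /eqP ->.
have -> : state 0 @^-1` [set~ walker_start] = ~` cylinder 0 (fun=> walker_start).
  apply/seteqP; split=> t /=; first by move=> E F; apply: E; exact: F.
  by move=> E F; apply: E => i; rewrite leqn0 => /eqP ->.
rewrite prC ?H ?subrr //.
have -> : cylinder 0 (fun=> walker_start) = state 0 @^-1` [set walker_start].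
  apply/seteqP; split=> t /=; first by apply.
  by move=> E i; rewrite leqn0 => /eqP ->.
exact: state_measurable.
Qed.

Definition path_ok (ok : nat -> pred {ffun K -> int}) (n N : nat) : set T :=
  [set t | forall k, (n <= k <= n + N)%N -> ok k (state k t)].

Lemma cylinder_measurable n y : measurable (cylinder n y).
Proof.
rewrite (_ : cylinder _ _ = \bigcap_(i in [set i | (i <= n)%N]) (state i @^-1` [set y i])) //.
apply: bigcap_measurable => [|i _]; [by exists 0%N|exact: state_measurable].
Qed.

Lemma path_ok_measurable ok n N : measurable (path_ok ok n N).
Proof.
rewrite (_ : path_ok _ _ _ = \bigcap_(i in [set i | (n <= i <= n + N)%N])
   (state i @^-1` [set z | ok i z])) //.
apply: bigcap_measurable => [|i _]; [|exact: state_measurable].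
by exists n => /=; rewrite leqnn leq_addr.
Qed.

(** Induction on [N], splitting the cylinder according to the next joint move of the walks. *)
Lemma pr_cylinder_path_ok ok n N y :
  pr Q (cylinder n y `&` path_ok ok n N) <=
  pr Q (cylinder n y) * surv pstep (pwt walker_env) ok N n (y n).
Proof.
have w0 := pwt_ge0 walker_env01.
have w1 := pwt_sum1 walker_env.
elim: N n y => [|N IH] n y.
  rewrite /=; have [okn|nok] := boolP (ok n (y n)).
    rewrite mulr1; apply: pr_le; [|exact: cylinder_measurable|exact: subIsetl].
    by apply: measurableI; [exact: cylinder_measurable|exact: path_ok_measurable].
  rewrite mulr0 (_ : _ `&` _ = set0) ?pr_set0 //; apply/seteqP; split=> t //= -[H1 H2].
  by move/negP: nok; apply; rewrite -(H1 n) //; apply: H2; rewrite leqnn leq_addr.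
have [okn|nok] := boolP (ok n (y n)); last first.
  rewrite (_ : _ `&` _ = set0) ?pr_set0.
    apply: mulr_ge0; [exact: pr_ge0|exact: surv_ge0].
  apply/seteqP; split=> t //= -[H1 H2].
  by move/negP: nok; apply; rewrite -(H1 n) //; apply: H2; rewrite leqnn leq_addr.
rewrite /= okn mul1r.
pose ys (s : {ffun K -> bool}) (k : nat) := if (k <= n)%N then y k else pstep (y n) s.
have cylS s : cylinder n.+1 (ys s) = cylinder n y `&` state n.+1 @^-1` [set pstep (y n) s].
  apply/seteqP; split=> t /=.
    move=> H; split=> [k kn|]; first by rewrite (H k) ?leqW // /ys kn.
    by rewrite H // /ys ltnn.
  move=> [H1 H2] k; rewrite /ys; case: ltngtP => // kn.
  - by move=> _; have [kn'|kn'] := leqP k n; rewrite ?H1 //; lia.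
  - by move=> _; rewrite kn ltnn.
have mcyl := cylinder_measurable.
have mA : measurable (cylinder n y `&` path_ok ok n N.+1).
  by apply: measurableI => //; exact: path_ok_measurable.
pose B := \bigcup_s cylinder n.+1 (ys s).
have mB : measurable B by apply: fin_bigcup_measurable.
have tr : forall s s', cylinder n.+1 (ys s) `&` cylinder n.+1 (ys s') !=set0 -> s = s'.
  move=> s s' [t []]; rewrite !cylS => -[_ E1] [_ E2].
  by apply: (@pstep_inj (y n)); rewrite -E1 -E2.
have ysn s : ys s n = y n by rewrite /ys leqnn.
have ysn1 s : ys s n.+1 = pstep (y n) s by rewrite /ys ltnn.
have cyls s : pr Q (cylinder n.+1 (ys s)) = pr Q (cylinder n y) * pwt walker_env (y n) s.
  rewrite pr_cylinderS ysn ysn1 joint_transition_step; congr (_ * _); congr pr.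
  apply/seteqP; split=> t /= H k kn; rewrite ?H // /ys ?kn //.
(* Other jumps have probability zero because the nearest-neighbour moves already carry the whole
   mass of the cylinder. *)
have rest : pr Q (cylinder n y `\` B) = 0.
  rewrite prD //; last by move=> t [s _]; rewrite cylS => -[].
  rewrite pr_finU // (eq_bigr _ (fun s _ => cyls s)) -mulr_sumr w1 mulr1 subrr //.
have sub : cylinder n y `&` path_ok ok n N.+1 `<=`
  (\bigcup_s (cylinder n.+1 (ys s) `&` path_ok ok n.+1 N)) `|` (cylinder n y `\` B).
  move=> t [H1 H2]; have [[s _ Bs]|nB] := pselect (B t); last by right; split.
  left; exists s => //; split=> // k /andP[k1 k2]; apply: H2; rewrite ltnW //=.
  by rewrite -addSnnS.
have mC s : measurable (cylinder n.+1 (ys s) `&` path_ok ok n.+1 N).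
  by apply: measurableI => //; exact: path_ok_measurable.
apply: (le_trans (pr_le Q mA _ sub)).
  by apply: measurableU; [apply: fin_bigcup_measurable|apply: measurableD].
apply: (le_trans (prU _ _ _)).
- exact: fin_bigcup_measurable.
- exact: measurableD.
rewrite rest addr0 pr_finU //; last first.
  by move=> s s' [t [[h1 _] [h2 _]]]; apply: tr; exists t.
rewrite /mop mulr_sumr; apply: ler_sum => s _.
by apply: (le_trans (IH _ _)); rewrite cyls ysn1 mulrA.
Qed.

Lemma pr_path_ok ok N :
  pr Q (path_ok ok 0 N) <= surv pstep (pwt walker_env) ok N 0 walker_start.
Proof.
have mA := path_ok_measurable ok 0 N.
have mS := state_measurable 0 [set~ walker_start].
have mC := cylinder_measurable 0 (fun=> walker_start).
have mI := measurableI _ _ mC mA.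
have H : path_ok ok 0 N `<=` (cylinder 0 (fun=> walker_start) `&` path_ok ok 0 N) `|`
   state 0 @^-1` [set~ walker_start].
  move=> t ht; have [E|E] := eqVneq (state 0 t) walker_start; last by right; exact/eqP.
  by left; split=> // k; rewrite leqn0 => /eqP ->.
apply: (le_trans (pr_le Q mA (measurableU _ _ mI mS) H)).
apply: (le_trans (prU _ mI mS)); rewrite pr_cylinder0 addr0.
apply: (le_trans (pr_cylinder_path_ok _ _ _ _)).
rewrite ler_piMl ?pr_le1 // surv_ge0 //; exact: pwt_ge0 walker_env01.
Qed.

Lemma pr_state_le n (B : pred {ffun K -> int}) :
  pr Q (state n @^-1` [set z | B z]) <=
  iter n (mop pstep (pwt walker_env)) (fun z => (B z)%:R) walker_start.
Proof.
rewrite -(surv_lastE _ _ _ _ 0) add0n; apply: le_trans (pr_path_ok _ _).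
apply: pr_le; [exact: state_measurable|exact: path_ok_measurable|].
move=> t /= Bt k; rewrite add0n => /andP[_]; rewrite leq_eqVlt => /orP[/eqP ->|->//].
by rewrite Bt orbT.
Qed.

End QuenchedMarkov.

(** * The potential *)

Section Potential.
Variables (R : realType).
Implicit Types e : int -> R.

Definition lrho e (k : int) : R := ln (rho (e k)).

(** Normalised by [pot e 0 = 0] and characterised by [pot_step]. As [Negz n] is [- (n + 1)], going
    there subtracts the [n + 1] increments at the sites 0 to [- n]. *)
Definition pot e (k : int) : R :=
  match k with
  | Posz n => \sum_(i < n) lrho e i.+1%:Z
  | Negz n => - \sum_(i < n.+1) lrho e (- i%:Z)
  end.

Lemma pot_step e k : pot e k = pot e (k - 1) + lrho e k.
Proof.
case: k => [[|n]|n].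
- have -> : Posz 0 - 1 = Negz 0 by [].
  by rewrite /pot big_ord0 big_ord1 /= addrC oppr0 subrr.
- have -> : Posz n.+1 - 1 = Posz n by lia.
  by rewrite /pot big_ord_recr.
- have -> : Negz n - 1 = Negz n.+1 by lia.
  rewrite /pot [in RHS]big_ord_recr /= opprD -addrA.
  have -> : - (n.+1%:Z) = Negz n by lia.
  by rewrite addNr addr0.
Qed.

Lemma pot_right e y n :
  pot e (y + n%:Z) - pot e y = \sum_(i < n) lrho e (y + i.+1%:Z).
Proof.
elim: n => [|n IH]; first by rewrite addr0 subrr big_ord0.
rewrite big_ord_recr /= -IH (pot_step e (y + n.+1%:Z)).
have -> : y + n.+1%:Z - 1 = y + n%:Z by lia.
by rewrite addrAC.
Qed.

Lemma pot_left e y n :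
  pot e (y - n%:Z) - pot e y = - \sum_(i < n) lrho e (y - i%:Z).
Proof.
elim: n => [|n IH]; first by rewrite subr0 subrr big_ord0 oppr0.
rewrite big_ord_recr /= opprD -IH (pot_step e (y - n%:Z)).
have -> : y - n.+1%:Z = y - n%:Z - 1 by lia.
by ring.
Qed.

Definition cond e (k : int) : R := expR (- pot e k).

Lemma cond_gt0 e k : 0 < cond e k. Proof. exact: expR_gt0. Qed.

(** Every environment is a walk with conductances, since the ratio of the conductances of the two
    edges at [k] is [rho (e k)]. All the reversible estimates thus apply to it. *)
Lemma ec_cond e : (forall k, 0 < e k < 1) -> ec (cond e) = e.
Proof.
move=> e01; apply/funext => k; rewrite /ec.
have E : cond e (k - 1) = cond e k * rho (e k).
  rewrite /cond (pot_step e k) opprD expRD -mulrA /lrho.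
  have r0 : 0 < rho (e k).
    by have /andP[a b] := e01 k; rewrite /rho divr_gt0 // subr_gt0.
  by rewrite [expR (- ln _)]expRN lnK ?posrE // mulVf ?mulr1 // gt_eqF.
have c0 := cond_gt0 e k.
rewrite E /rho; have /andP[a b] := e01 k.
have c1 : cond e k != 0 by rewrite gt_eqF.
have a1 : e k != 0 by rewrite gt_eqF.
have H : (cond e k * ((1 - e k) / e k) + cond e k) = cond e k / e k by field.
by rewrite H invfM invrK mulrA divff // mul1r.
Qed.

End Potential.

Lemma kerw_window_le1 (R : realType) (e : int -> R) n x lo l :
  (forall k, 0 < e k < 1) -> \sum_(j < l) kerw e n x (lo + j%:Z) <= 1.
Proof.
move=> e01; rewrite -(ec_cond e01).
have H := iter_wop_window (@cond_gt0 _ e) n lo l x (f := fun=> 1) (fun=> ler01).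
apply: le_trans (le_trans H _); first by under [leRHS]eq_bigr do rewrite mul1r.
by rewrite (iter_mop_cst _ (wwt_sum1 _)).
Qed.

(** * Meeting events and their probabilities *)

Section Meetings.
Context d (T : measurableType d) (R : realType) (Q : probability T R).
Variables (m r : nat) (S : 'I_m -> nat -> {mfun T >-> int})
  (Z : 'I_r -> nat -> {mfun T >-> int}) (e : env R r).
Hypothesis e01 : forall j y, 0 < e j y < 1.
Hypothesis law : quenched_law Q S Z e 0.

Local Notation K := ('I_m + 'I_r)%type.

Definition selected (a b : nat) : pred K :=
  fun k => match k with inl i => (i < a)%N | inr j => (j < b)%N end.

Lemma meetE a b n : [set t | meet S Z a b n t] =
  state S Z n @^-1` [set z | exists y, forall k, selected a b k -> z k = y].
Proof.
apply/seteqP; split=> t /= [y].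
  by move=> [HS HZ]; exists y => -[i|j] /= h; rewrite ffunE /= ?HS ?HZ.
move=> H; exists y; split=> [i ia|j jb].
  by have := H (inl i) ia; rewrite ffunE.
by have := H (inr j) jb; rewrite ffunE.
Qed.

Lemma meet_measurable a b n : measurable [set t | meet S Z a b n t].
Proof. by rewrite meetE; apply: state_measurable. Qed.

Lemma meet_infinitely_oftenE a b :
  meet_infinitely_often S Z a b = lim_sup_set (fun n => [set t | meet S Z a b n t]).
Proof.
apply/seteqP; split=> t /=.
  move=> inf n _ /=; apply: contrapT => H; apply: inf.
  apply: (sub_finite_set (B := `I_n)); last exact: finite_II.
  move=> k /= mk; rewrite ltnNge; apply/negP => nk; apply: H; by exists k.
move=> H fin; have [n Hn] : exists n, forall k, meet S Z a b k t -> (k < n)%N.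
  have [X E] := finite_fsetP.1 fin; exists (\max_(i <- X) i).+1 => k mk.
  rewrite ltnS; apply: (@leq_bigmax_seq _ _ xpredT id) => //.
  by have : [set` X] k by rewrite -E.
have [k /= nk mk] := H n I; by have := Hn _ mk; rewrite ltnNge nk.
Qed.

Lemma meet_infinitely_often_measurable a b :
  measurable (meet_infinitely_often S Z a b).
Proof.
rewrite meet_infinitely_oftenE; apply: bigcapT_measurable => n.
by apply: bigcup_measurable => k _; apply: meet_measurable.
Qed.

(** The first Borel-Cantelli lemma. *)
Lemma meet_null a b (C : R) :
  (forall N, \sum_(n < N) pr Q [set t | meet S Z a b n t] <= C) ->
  Q (meet_infinitely_often S Z a b) = 0%E.
Proof.
move=> H; rewrite meet_infinitely_oftenE; apply: lim_sup_set_cvg0.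
  by move=> k; apply: meet_measurable.
apply: (@le_lt_trans _ _ C%:E); last exact: ltry.
apply: lime_le; first by apply: is_cvg_nneseries => n _ _.
apply: nearW => N; rewrite big_mkord.
apply: (@le_trans _ _ (\sum_(n < N) pr Q [set t | meet S Z a b n t])%:E); last first.
  by rewrite lee_fin.
rewrite -sumEFin; apply: lee_sum => n _.
by rewrite -[leRHS](prE Q (meet_measurable a b n)).
Qed.

(** Union bound over the common site. The selected walk [k0] confines that site to the interval from
    [- n] to [n]; the complementary event [B0] is null. *)
Lemma pr_meet_le a b n k0 : selected a b k0 ->
  pr Q [set t | meet S Z a b n t] <=
  \sum_(j < n + n + 1) \prod_(k | selected a b k)
     kerw (walker_env e k) n 0 (- n%:Z + j%:Z).
Proof.
move=> sk0.
pose y (j : nat) : int := - n%:Z + j%:Z.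
pose B (j : nat) : set T := state S Z n @^-1` [set z | [forall (k | selected a b k), z k == y j]].
pose B0 : set T := state S Z n @^-1` [set z | (n%:Z < `|z k0|)%R].
have mB j : measurable (B j) by exact: state_measurable.
have mB0 : measurable B0 by exact: state_measurable.
have start0 k : walker_start (0 : 'rV[int]_(m + r)) k = 0.
  by rewrite ffunE; case: k => i; rewrite mxE.
have prB j : pr Q (B j) <= \prod_(k | selected a b k) kerw (walker_env e k) n 0 (y j).
  apply: (le_trans (pr_state_le e01 law n (fun z => [forall (k | selected a b k), z k == y j]))).
  rewrite [leRHS]big_mkcond /=.
  pose f (k : K) (z : int) : R := if selected a b k then (z == y j)%:R else 1.
  rewrite (iter_mop_ext _ _ n (g := fun z : {ffun K -> int} => \prod_k f k (z k))).
    rewrite iter_mop_prod.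
    rewrite le_eqVlt; apply/orP; left; apply/eqP/eq_bigr => k _; rewrite start0 /f.
    by case: ifP => // _; rewrite (iter_mop_cst _ (wwt_sum1 _)).
  move=> z; case: forallP => [H|H].
    rewrite big1 // => k _; rewrite /f; case: ifP => // sk.
    by have := H k; rewrite sk /= => ->.
  have [k /andP[sk zk]] : exists k, selected a b k && (z k != y j).
    apply/existsP; rewrite -[X in is_true X]negbK negb_exists; apply/negP => /forallP G.
    by apply: H => k; have := G k; rewrite negb_and negbK; case: (selected a b k).
  by rewrite (bigD1 k) //= /f sk (negbTE zk) mul0r.
have prB0 : pr Q B0 <= 0.
  apply: (le_trans (pr_state_le e01 law n (fun z => (n%:Z < `|z k0|)%R))).
  pose f (k : K) (z : int) : R := if k == k0 then (n%:Z < `|z|)%R%:R else 1.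
  rewrite (iter_mop_ext _ _ n (g := fun z : {ffun K -> int} => \prod_k f k (z k))).
    rewrite iter_mop_prod (bigD1 k0) //= start0 /f eqxx.
    rewrite (@iter_wop_local _ _ _ _ (fun=> 0)).
      by rewrite (iter_mop_cst _ (wwt_sum1 _)) mul0r.
    by move=> i ni; case: ltP => // h; exfalso; lia.
  move=> z; rewrite (bigD1 k0) //= {1}/f eqxx big1 ?mulr1 // => k kk0.
  by rewrite /f (negbTE kk0).
have sub : [set t | meet S Z a b n t] `<=`
    \big[setU/set0]_(j < n + n + 1) B j `|` B0.
  rewrite meetE => t /= [z Hz].
  have [h|h] := ltP n%:Z `|z|; first by right; rewrite /B0 /= (Hz _ sk0).
  left; rewrite -bigcup_mkord; exists (absz (z + n%:Z)) => /=; first by lia.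
  by apply/forallP => k; apply/implyP => sk; rewrite (Hz _ sk); apply/eqP; rewrite /y; lia.
have prBU N : pr Q (\big[setU/set0]_(j < N) B j) <= \sum_(j < N) pr Q (B j).
  elim: N => [|N IH]; first by rewrite !big_ord0 pr_set0.
  rewrite !big_ord_recr /=; apply: (le_trans (prU _ _ _)) => //.
    exact: bigsetU_measurable.
  by rewrite lerD2r.
have mU : measurable (\big[setU/set0]_(j < n + n + 1) B j).
  exact: bigsetU_measurable.
apply: (le_trans (pr_le Q (meet_measurable a b n) (measurableU _ _ mU mB0) sub)).
apply: (le_trans (prU _ mU mB0)).
apply: (@le_trans _ _ (\sum_(j < n + n + 1) pr Q (B j) + 0)).
  by apply: lerD.
by rewrite addr0; apply: ler_sum => j _; apply: prB.
Qed.

Lemma prod_selected (a b : nat) (am : (a <= m)%N) (br : (b <= r)%N) n z :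
  \prod_(k | selected a b k) kerw (walker_env e k) n 0 z =
  kerw (fun=> 1 / 2 : R) n 0 z ^+ a * \prod_(j < b) kerw (e (widen_ord br j)) n 0 z.
Proof.
rewrite big_sumType /= (big_ord_narrow am) (big_ord_narrow br) prodr_const card_ord //.
Qed.

Lemma three_srw_null (m3 : (3 <= m)%N) (r1 : (1 <= r)%N) :
  Q (meet_infinitely_often S Z 3 1) = 0%E.
Proof.
have H n : pr Q [set t | meet S Z 3 1 n t] <= srw_return R n./2 ^+ 3.
  apply: (le_trans (@pr_meet_le 3 1 n (inl (Ordinal m3)) _)) => //.
  apply: (@le_trans _ _ (\sum_(j < n + n + 1) srw_return R n./2 ^+ 3 *
     kerw (e (Ordinal r1)) n 0 (- n%:Z + j%:Z))).
    apply: ler_sum => j _; rewrite (prod_selected m3 r1) big_ord1.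
    have -> : widen_ord r1 ord0 = Ordinal r1 by apply: val_inj.
    apply: ler_pM => //.
    - apply: exprn_ge0; apply: ker_ge0; apply: wwt_ge0 => k; lra.
    - apply: ker_ge0; exact: wwt_ge0.
    apply: lerXn2r; rewrite ?nnegrE ?srw_return_ge0 ?kerw_half_le //.
    by apply: ker_ge0; apply: wwt_ge0 => k; lra.
  rewrite -mulr_sumr ler_piMr ?exprn_ge0 ?srw_return_ge0 //.
  exact: kerw_window_le1.
apply: (@meet_null _ _ 4) => N.
apply: (@le_trans _ _ (\sum_(n < N) srw_return R n./2 ^+ 3)).
  by apply: ler_sum => n _; exact: H.
(* Doubling the range makes the times come in pairs with the same half. *)
apply: (@le_trans _ _ (\sum_(n < N + N) srw_return R n./2 ^+ 3)).
  rewrite big_split_ord /= lerDl; apply: sumr_ge0 => i _.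
  by rewrite exprn_ge0 ?srw_return_ge0.
have -> : \sum_(n < N + N) srw_return R n./2 ^+ 3 = 2 * \sum_(j < N) srw_return R j ^+ 3.
  elim: N => [|N IH]; first by rewrite !big_ord0 mulr0.
  rewrite addSn addnS !big_ord_recr /= IH addnn uphalf_double doubleK; ring.
by have := srw_return_cube_sum R N; lra.
Qed.

End Meetings.

Lemma wwt_half_ge0 (R : realType) (x : int) b : 0 <= wwt (fun=> 1 / 2 : R) x b.
Proof. by apply: wwt_ge0 => k; lra. Qed.

(** * Joint visits of all the walks to one site *)

Section JointHitting.
Variable R : realType.
Implicit Types (e : int -> R).

(* First-hit decomposition at [(y, y)] for the pair of walks. *)
Lemma kerw_pair_sum e1 e2 B x y :
  (forall k, 0 < e1 k < 1) -> (forall k, 0 < e2 k < 1) ->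
  \sum_(n < B) kerw e1 n x y * kerw e2 n x y <=
  \sum_(j < B) kerw e1 j y y * kerw e2 j y y.
Proof.
move=> h1 h2; pose e (b : bool) := if b then e1 else e2.
have e01 : forall b z, 0 < e b z < 1 by case.
have P n u v : ker (@pstep bool) (pwt e) n [ffun=> u] [ffun=> v] =
    kerw e1 n u v * kerw e2 n u v.
  by rewrite ker_prod big_bool /= !ffunE.
under eq_bigr do rewrite -P; under [leRHS]eq_bigr do rewrite -P.
apply: (le_trans (ker_sum_first_hit (@pstep bool) (pwt_ge0 e01) B _ _)).
rewrite ler_piMl //; last by apply: first_hit_sum_le1; [exact: pwt_ge0|exact: pwt_sum1].
by apply: sumr_ge0 => j _; apply: ker_ge0; exact: pwt_ge0.
Qed.

Lemma first_hit_le_ker e b k x : (forall z, 0 < e z < 1) ->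
  first_hit wstep (wwt e) b k x <= kerw e k x b.
Proof.
move=> e01; have w0 := wwt_ge0 e01.
rewrite ker_first_hit big_ord_recr /= subnn [X in _ * X](_ : _ = 1); last first.
  by rewrite /ker /= eqxx.
rewrite mulr1 lerDr; apply: sumr_ge0 => i _.
by rewrite mulr_ge0 ?first_hit_ge0 ?ker_ge0.
Qed.

(** First hit by time [A], then a return. Given the parity hypothesis, a first hit at time [k] with
    positive probability leaves an even remaining time, to which the bound [a] applies. *)
Lemma walk_lower e b x n A (a : R) : (forall z, 0 < e z < 1) -> 0 <= a ->
  (A <= n)%N -> (exists i : int, b = x + n%:Z + i *+ 2) ->
  (forall j, (j + j <= n)%N -> a <= kerw e (j + j) b b) ->
  a * \sum_(k < A.+1) first_hit wstep (wwt e) b k x <= kerw e n x b.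
Proof.
move=> e01 a0 An [i bE] ha; have w0 := wwt_ge0 e01.
rewrite ker_first_hit mulr_sumr.
have An1 : (A.+1 <= n.+1)%N by [].
rewrite (big_ord_widen _ (fun k => a * first_hit wstep (wwt e) b k x) An1) big_mkcond /=.
apply: ler_sum => k _; case: ifP => _; last by rewrite mulr_ge0 ?first_hit_ge0 ?ker_ge0.
have [->|f0] := eqVneq (first_hit wstep (wwt e) b k x) 0; first by rewrite mulr0 mul0r.
rewrite mulrC; apply: ler_wpM2l; first exact: first_hit_ge0.
have k0 : kerw e k x b != 0.
  apply: contra_neq f0 => k0; apply/eqP; rewrite eq_le first_hit_ge0 // andbT -k0.
  exact: first_hit_le_ker.
have [l lk bE'] := kerw_neq0 k0.
have kn := ltn_ord k.
have [j jE] : exists j, (n - k = j + j)%N by exists (absz (i + k%:Z - l%:Z)%R); lia.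
by rewrite jE; apply: ha; lia.
Qed.

(** A dyadic block has [2 ^ i] terms, each at least [q / 2 ^ i], and so contributes at least [q]. *)
Lemma dyadic_lower (h : nat -> R) (q : R) a k :
  (forall i l, (a <= i)%N -> (2 ^ i <= l < 2 ^ i.+1)%N -> q / 2 ^+ i <= h l) ->
  k%:R * q <= \sum_(2 ^ a <= l < 2 ^ (a + k)) h l.
Proof.
move=> H; elim: k => [|k IH]; first by rewrite mul0r addn0 big_geq.
rewrite (@big_cat_nat _ _ _ (2 ^ (a + k))) /= ?leq_exp2l ?leq_addr ?addnS //.
rewrite -natr1 mulrDl mul1r; apply: lerD => //.
apply: (@le_trans _ _ (\sum_(2 ^ (a + k) <= l < 2 ^ (a + k).+1) q / 2 ^+ (a + k))).
  rewrite sumr_const_nat expnS mul2n -addnn addnK -[X in _ <= X]mulr_natr natrX.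
  by rewrite divfK // expf_neq0 // pnatr_eq0.
by apply: ler_sum_nat => l hl; apply: H; rewrite ?leq_addr.
Qed.

Lemma dyadic_upper (h : nat -> R) (q : R) a k :
  (forall i l, (a <= i)%N -> (2 ^ i <= l < 2 ^ i.+1)%N -> h l <= q / 2 ^+ i) ->
  \sum_(2 ^ a <= l < 2 ^ (a + k)) h l <= k%:R * q.
Proof.
move=> H; have := @dyadic_lower (fun l => - h l) (- q) a k.
rewrite sumrN mulrN lerN2; apply => i l ai hl.
by rewrite mulNr lerN2; apply: H.
Qed.

Lemma pair_sum (f : nat -> R) L :
  \sum_(n < L + L) f n = \sum_(l < L) (f (l + l)%N + f (l + l).+1).
Proof.
elim: L => [|L IH]; first by rewrite !big_ord0.
by rewrite addSn addnS !big_ord_recr /= IH addrA.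
Qed.

(** Each of the [6 * N] dyadic blocks contributes at most 1, and the term at time 0 one more. *)
Lemma srw_sum_upper N : (0 < N)%N ->
  \sum_(j < 2 ^ (6 * N)) srw_return R j./2 ^+ 2 <= 8 * N%:R.
Proof.
move=> N0; rewrite -(big_mkord xpredT (fun j => srw_return R j./2 ^+ 2)).
have p0 : (0 < 2 ^ (6 * N))%N by rewrite expn_gt0.
rewrite big_ltn //= srw_return0 expr1n.
have H : \sum_(2 ^ 0 <= l < 2 ^ (0 + 6 * N)) srw_return R l./2 ^+ 2 <= (6 * N)%:R * 1.
  apply: dyadic_upper => i l _ /andP[h1 h2].
  have l0 : (0 < l)%N by apply: leq_trans h1; rewrite expn_gt0.
  have U := srw_return_upper R l./2.
  rewrite ler_pdivlMr ?exprn_gt0 //; apply: le_trans U.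
  rewrite ler_wpM2l ?sqr_ge0 // -natrX -natrM natr1 ler_nat.
  by apply: (leq_trans h1); rewrite -{1}(odd_double_half l) -mul2n; case: (odd l) => //=; lia.
rewrite expn0 add0n mulr1 natrM in H.
have N1 : (1 : R) <= N%:R by rewrite ler1n.
by lra.
Qed.

End JointHitting.

Lemma int_parity (z : int) : exists q : int, z = q *+ 2 \/ z = q *+ 2 + 1.
Proof. by exists (z %/ 2)%Z; lia. Qed.

Section JointLower.
Variables (R : realType) (m r : nat).
Hypothesis m2 : m = 2%N.
Local Notation K := ('I_m + 'I_r)%type.

(* [a] bounds the return probabilities to [b] from below, up to time
   [2 ^ (6 * N)]. *)
Record good_site (e : int -> R) (M N : nat) (b : int) (a : R) : Prop := GoodSite {
  good_hit : forall x, `|x| <= M%:Z ->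
    1 / 2 <= \sum_(k < (2 ^ (4 * N)).+1) first_hit wstep (wwt e) b k x;
  good_srw : forall x, `|x| <= M%:Z ->
    1 / 2 <= \sum_(k < (2 ^ (4 * N)).+1) first_hit wstep (wwt (fun=> 1 / 2 : R)) b k x;
  good_return : forall j, (j + j <= 2 ^ (6 * N))%N -> a <= kerw e (j + j) b b
}.

(** What is known at time [M] of walks that all started at the origin. *)
Definition same_parity (M : nat) (x : {ffun K -> int}) : Prop :=
  (forall k, `|x k| <= M%:Z) /\ (forall k l, exists i : int, x k = x l + i *+ 2).

(** Second-moment argument: the mean number of joint visits to [b] before time [B] is at least
    [(a / 2) ^+ r * (N / 32)] from [x] and at most [8 * N] from [b]. By [ker_sum_first_hit] their
    ratio bounds the hitting probability from below, whence 256 = 32 * 8. *)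
Lemma joint_hit_lower (e : 'I_r -> int -> R) e0 M N b a x :
  (0 < N)%N -> (forall j z, 0 < e j z < 1) -> (forall j z, e j z = e0 z) ->
  0 < a -> a <= 1 -> good_site e0 M N b a -> same_parity M x ->
  (a / 2) ^+ r / 256 <=
  \sum_(k < 2 ^ (6 * N)) first_hit (@pstep K) (pwt (walker_env e)) [ffun=> b] k x.
Proof.
move=> N0 e01 ee a0 a1 [gh gs gr] [xM xP].
have w01 := walker_env01 (m := m) e01.
have w0 := pwt_ge0 w01; have w1 := pwt_sum1 (walker_env (m := m) e).
set B := (2 ^ (6 * N))%N; set A := (2 ^ (4 * N))%N.
set J := \sum_(k < B) _.
have U : \sum_(j < B) ker (@pstep K) (pwt (walker_env e)) j [ffun=> b] [ffun=> b] <= 8 * N%:R.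
  apply: le_trans (srw_sum_upper R N0); apply: ler_sum => j _.
  rewrite ker_prod big_sumType /= [X in _ * X <= _](eq_bigr (fun i => kerw (e i) j b b)); last first.
    by move=> i _; rewrite !ffunE.
  rewrite [X in X * _](eq_bigr (fun i => kerw (fun=> 1 / 2 : R) j b b)); last first.
    by move=> i _; rewrite !ffunE.
  rewrite prodr_const card_ord m2 -[leRHS]mulr1; apply: ler_pM.
  - by rewrite exprn_ge0 // ker_ge0 //; exact: wwt_half_ge0.
  - by apply: prodr_ge0 => i _; rewrite ker_ge0 //; apply: wwt_ge0.
  - by apply: lerXn2r; rewrite ?nnegrE ?srw_return_ge0 ?kerw_half_le // ker_ge0 //; exact: wwt_half_ge0.
  apply: (@le_trans _ _ (\prod_(i < r) 1)); last by rewrite big1.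
  apply: ler_prod => i _; rewrite ker_ge0 ?ker_le1 //; try exact: wwt_ge0; exact: wwt_sum1.
have L : (a / 2) ^+ r * (N%:R / 32) <=
    \sum_(n < B) ker (@pstep K) (pwt (walker_env e)) n x [ffun=> b].
  pose f n := ker (@pstep K) (pwt (walker_env e)) n x [ffun=> b].
  have f0 n : 0 <= f n by exact: ker_ge0.
  (* At a late time of the right parity each walk [Z] contributes [a / 2] and the two simple walks
     together [1 / (8 * n)]. *)
  have fE n : (A <= n)%N -> (2 <= n)%N -> (n < B)%N -> (forall k, exists i : int, b = x k + n%:Z + i *+ 2) ->
      (a / 2) ^+ r / (8 * n%:R) <= f n.
    move=> An n2 nB par; rewrite /f ker_prod big_sumType mulrC /=.
    have Zb i : a / 2 <= kerw (e i) n (x (inr i)) b.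
      have -> : e i = e0 by apply/funext => z.
      have H := gh _ (xM (inr i)).
      apply: le_trans (walk_lower (A := A) (a := a) _ _ _ _ _) => //.
      - by apply: ler_wpM2l; [exact: ltW|rewrite -[2^-1]mul1r; exact: H].
      - by move=> z; rewrite -(ee i).
      - exact: ltW.
      - by move=> j jn; apply: gr; apply: leq_trans jn (ltnW nB).
    have Sb i : srw_return R n./2 / 2 <= kerw (fun=> 1 / 2 : R) n (x (inl i)) b.
      have H := gs _ (xM (inl i)).
      apply: le_trans (walk_lower (A := A) (a := srw_return R n./2) _ _ _ _ _) => //.
      - by apply: ler_wpM2l; [exact: srw_return_ge0|apply: le_trans H; rewrite mul1r].
      - by move=> ?; lra.
      - exact: srw_return_ge0.
      - move=> j jn; rewrite -(kerw_half_return R n./2 b) -ec_cst1.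
        by apply: ker_return_le => //; lia.
    apply: ler_pM.
    - by rewrite invr_ge0 mulr_ge0.
    - by rewrite exprn_ge0 // divr_ge0 // ltW.
    - have n20 : (0 < n./2)%N by lia.
      have Lw := srw_return_lower R n20.
      apply: (@le_trans _ _ ((srw_return R n./2 / 2) ^+ 2)).
        have nn : (2 * n./2%:R : R) <= n%:R.
          by rewrite -natrM ler_nat; lia.
        have n0 : (0 : R) < n%:R by rewrite ltr0n; lia.
        rewrite -div1r ler_pdivrMr; last by lra.
        have := sqr_ge0 (srw_return R n./2); rewrite exprMn; nra.
      rewrite -[X in _ ^+ X]m2 -[X in _ ^+ X](card_ord m) -prodr_const; apply: ler_prod => i _.
      by rewrite divr_ge0 ?srw_return_ge0 //= ffunE.
    - rewrite -[X in _ ^+ X](card_ord r) -prodr_const; apply: ler_prod => i _.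
      by rewrite divr_ge0 ?(ltW a0) //= ffunE.
  have A2 : (2 <= A)%N by rewrite /A -[X in (X <= _)%N]expn1 leq_exp2l //; lia.
  have -> : B = (2 ^ (6 * N - 1) + 2 ^ (6 * N - 1))%N.
    by rewrite addnn -mul2n -expnS; congr (2 ^ _)%N; lia.
  rewrite (pair_sum f) -(big_mkord xpredT (fun l => f (l + l)%N + f (l + l).+1)).
  have AB : (2 ^ (4 * N) <= 2 ^ (6 * N - 1))%N by rewrite leq_exp2l //; lia.
  rewrite (big_cat_nat _ AB) //=.
  apply: (@le_trans _ _ (0 + \sum_(2 ^ (4 * N) <= l < 2 ^ (6 * N - 1)) (f (l + l)%N + f (l + l).+1))); last first.
    by rewrite lerD2r; apply: sumr_ge0 => l _; rewrite addr_ge0.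
  rewrite add0r; have -> : (6 * N - 1 = 4 * N + (2 * N - 1))%N by lia.
  apply: (@le_trans _ _ ((2 * N - 1)%:R * ((a / 2) ^+ r / 32))).
    rewrite [leRHS]mulrCA; apply: ler_wpM2l.
      by rewrite exprn_ge0 // divr_ge0 // ltW.
    rewrite ler_wpM2r ?invr_ge0 // ler_nat; lia.
  (* [dyadic_lower] asks for its bound in all later blocks; past the range the summand is replaced
     by a value that satisfies it. *)
  rewrite big_nat_cond.
  have -> : \sum_(2 ^ (4 * N) <= i < 2 ^ (4 * N + (2 * N - 1)) |
     (2 ^ (4 * N) <= i < 2 ^ (4 * N + (2 * N - 1)))%N && true) (f (i + i)%N + f (i + i).+1) =
     \sum_(2 ^ (4 * N) <= i < 2 ^ (4 * N + (2 * N - 1)))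
       (if (i < 2 ^ (4 * N + (2 * N - 1)))%N then f (i + i)%N + f (i + i).+1 else
          (a / 2) ^+ r / (16 * i%:R + 8)).
    by rewrite [RHS]big_nat_cond; apply: eq_bigr => i /andP[/andP[_ ->]].
  apply: dyadic_lower => i l iN /andP[l1 l2].
  have l0 : (0 < l)%N by apply: leq_trans l1; rewrite expn_gt0.
  have q0 : 0 <= (a / 2) ^+ r by rewrite exprn_ge0 // divr_ge0 // ltW.
  have lR : (0 : R) < l%:R by rewrite ltr0n.
  have bnd : (a / 2) ^+ r / 32 / 2 ^+ i <= (a / 2) ^+ r / (16 * l%:R + 8).
    rewrite -mulrA; apply: ler_wpM2l => //; rewrite -invfM lef_pV2 ?posrE.
    - have : (16 * l + 8 <= 32 * 2 ^ i)%N by move: l2; rewrite expnS; lia.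
      by rewrite -(ler_nat R) natrD !natrM natrX.
    - by rewrite mulr_gt0 // exprn_gt0.
    - by lra.
  case: ifP => // lB.
  have Al : (A <= l)%N by apply: leq_trans l1; rewrite leq_exp2l.
  have lpos : (0 < l)%N by apply: leq_trans l1; rewrite expn_gt0.
  have ll2 : (2 <= l + l)%N by rewrite addnn (leq_double 1).
  have All : (A <= l + l)%N := leq_trans Al (leq_addr _ _).
  apply: (le_trans bnd).
  have B2 : B = (2 * 2 ^ (4 * N + (2 * N - 1)))%N.
    by rewrite -expnS; congr (2 ^ _)%N; lia.
  pose k0 : K := inl (cast_ord (esym m2) ord0).
  (* One of the times [l + l] and [(l + l).+1] agrees with the parity of [b], and only that term is
     kept. *)
  have [i0 [even|odd]] := int_parity (b - x k0 - (l + l)%:Z); last first.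
  - apply: (@le_trans _ _ (f (l + l).+1)); last by rewrite lerDr.
    have nB : ((l + l).+1 < B)%N by rewrite B2; lia.
    apply: le_trans (fE _ (leqW All) (leqW ll2) nB _); last first.
      move=> k; have [i1 E] := xP k0 k; exists (i0 + i1); move: odd; rewrite E; lia.
    rewrite ler_wpM2l // lef_pV2 ?posrE; first by rewrite -[(l + l).+1%:R]natr1 [(l + l)%:R]natrD; lra.
    + by lra.
    + by rewrite mulr_gt0.
  - apply: (@le_trans _ _ (f (l + l)%N)); last by rewrite lerDl.
    have nB : ((l + l) < B)%N by rewrite B2; lia.
    apply: le_trans (fE _ All ll2 nB _); last first.
      move=> k; have [i1 E] := xP k0 k; exists (i0 + i1); move: even; rewrite E; lia.
    rewrite ler_wpM2l // lef_pV2 ?posrE; first by rewrite [(l + l)%:R]natrD; lra.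
    + by lra.
    + by rewrite mulr_gt0 // [(l + l)%:R]natrD; lra.
have N1 : (0 : R) < N%:R by rewrite ltr0n.
have H := le_trans L (ker_sum_first_hit (@pstep K) w0 B x [ffun=> b]).
have J0 : 0 <= J by apply: sumr_ge0 => k _; exact: first_hit_ge0.
have {}H : (a / 2) ^+ r * (N%:R / 32) <= J * (8 * N%:R).
  by apply: (le_trans H); apply: ler_wpM2l.
by rewrite -(ler_pM2r N1); move: H; lra.
Qed.

End JointLower.

(** * The bottom of a valley is a good site *)

Section Valley.
Variables (R : realType) (e : int -> R) (cc : R).
Hypothesis e01 : forall k, 0 < e k < 1.
Hypothesis ecc : forall k, `|lrho e k| <= cc.

Local Notation V := (pot e).
Local Notation c := (cond e).

Lemma pot_lip y n : `|V (y + n%:Z) - V y| <= n%:R * cc.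
Proof.
rewrite pot_right; apply: (le_trans (ler_norm_sum _ _ _)).
rewrite mulr_natl -[X in _ *+ X]card_ord -sumr_const; exact: ler_sum.
Qed.

Lemma lrho_bound_ge0 : 0 <= cc.
Proof. exact: le_trans (normr_ge0 _) (ecc 0). Qed.

(** Increments of the potential being at most [cc], the reversible measure at [z] lies between
    [expR (- V z)] and this multiple of it. *)
Definition pi_factor : R := 1 + expR cc.

Lemma pi_factor_gt0 : 0 < pi_factor.
Proof. by rewrite /pi_factor addr_gt0 // expR_gt0. Qed.

Lemma piw_cond_le z : piw c z <= pi_factor * expR (- V z).
Proof.
rewrite /piw /cond /pi_factor mulrDl mul1r -expRD addrC lerD2l ler_expR.
by rewrite (pot_step e z); have := ecc z; rewrite ler_norml => /andP[]; lra.
Qed.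

Lemma piw_cond_ge z : expR (- V z) <= piw c z.
Proof. by rewrite /piw /cond lerDr expR_ge0. Qed.

Lemma exit_right_pot (k i : int) n x : x <= i -> i < k ->
  iter n (wop e) (fun z => (k <= z)%R%:R) x <=
  n.+1%:R * (pi_factor * expR (V i - V k)).
Proof.
move=> xi ik; rewrite -{1}(ec_cond e01).
apply: (le_trans (exit_bound (@cond_gt0 _ e) n xi ik)).
rewrite ler_wpM2l // ler_pdivrMr; last by apply: piw_gt0 => ?; exact: cond_gt0.
apply: (le_trans (piw_cond_le k)); rewrite -mulrA ler_wpM2l ?(ltW pi_factor_gt0) //.
apply: (@le_trans _ _ (expR (V i - V k) * expR (- V i))).
  by rewrite -expRD ler_expR; lra.
by rewrite ler_wpM2l ?expR_ge0 // piw_cond_ge.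
Qed.

Lemma exit_left_pot (k i : int) n x : i <= x -> k < i ->
  iter n (wop e) (fun z => (z <= k)%R%:R) x <=
  n.+1%:R * (pi_factor * expR (V i - V k)).
Proof.
move=> ix ki; rewrite -{1}(ec_cond e01).
have c0 := @reflc_gt0 _ _ (@cond_gt0 _ e).
have H := @exit_bound _ _ c0 (- k) (- i) n (- x).
rewrite (iter_wop_reflc (@cond_gt0 _ e)) opprK !lerN2 ltrN2 in H.
have P z : piw (reflc c) (- z) = piw c z.
  rewrite /piw /reflc addrC; have -> : - - z - 1 = z - 1 by lia.
  by have -> : - (- z - 1) - 1 = z by lia.
rewrite !P in H; move: (H ix ki) => {}H.
rewrite (iter_mop_ext _ _ n (g := fun z => (- k <= - z)%R%:R)); last by move=> z; rewrite lerN2.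
apply: (le_trans H).
rewrite ler_wpM2l // ler_pdivrMr; last by apply: piw_gt0 => ?; exact: cond_gt0.
apply: (le_trans (piw_cond_le k)); rewrite -mulrA ler_wpM2l ?(ltW pi_factor_gt0) //.
apply: (@le_trans _ _ (expR (V i - V k) * expR (- V i))).
  by rewrite -expRD ler_expR; lra.
by rewrite ler_wpM2l ?expR_ge0 // piw_cond_ge.
Qed.

(* How large the scale [N] of a valley must be compared with the size [M] of
   the region where the walks start. *)
Record valley_scale (M N : nat) (W := (2 * N ^ 4 + 2 * M + 1)%N)
    (D := M%:R * cc * 2 : R) : Prop := ValleyScale {
  scale_time : W%:R ^+ 2 * (pi_factor * expR (5 / 4 * N%:R + 2 * D)) <= 2 ^+ (4 * N) / 4;
  scale_left : W%:R * expR (2 * D - 6 * N%:R) <= 1 / 4;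
  scale_exit : (2 ^+ (6 * N) + 1) * (pi_factor * expR (- 7 * N%:R)) <= 1 / 4;
  scale_mass : W%:R * expR (2 * D - N%:R / 4) <= 1;
  scale_srw : 32 * W%:R ^+ 2 <= 2 ^+ (4 * N) / 4 :> R;
  scale_region : 8 * D <= N%:R
}.

(** The walks start in the region from [- M] to [M]. To its right the path climbs at most [N] before
    a bottom of depth at least [N / 2], then meets a wall; to its left it meets a wall before
    dipping below [- N / 4]. The difference between [N / 2] and [N / 4] makes the left part of the
    valley negligible beside the bottom. [C] does not depend on [N]. *)
Record valley (M N : nat) (al bb cr : nat) (C : R) : Prop := IsValley {
  valley_size : [/\ (al <= N ^ 4)%N, (bb <= cr)%N & (cr <= N ^ 4)%N];
  valley_climb : forall i k, (i <= k <= bb)%N ->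
    V (M%:Z + k%:Z) - V (M%:Z + i%:Z) <= N%:R;
  valley_depth : V (M%:Z + bb%:Z) - V M <= - (N%:R / 2);
  valley_right : 7 * N%:R <= V (M%:Z + cr%:Z) - V (M%:Z + bb%:Z);
  valley_sharp : \sum_(i < cr) expR (V (M%:Z + bb%:Z) - V (M%:Z + i%:Z)) <= C;
  valley_left_min : forall k, (k <= al)%N -> - (N%:R / 4) <= V (- M%:Z - k%:Z) - V (- M%:Z);
  valley_left : 7 * N%:R <= V (- M%:Z - al%:Z) - V (- M%:Z)
}.

Lemma left_window (M al i : nat) : (i < (al + 2 * M).-1)%N ->
  - M%:Z - al%:Z <= - M%:Z - al%:Z + 1 + i%:Z /\
  - M%:Z - al%:Z + 1 + i%:Z <= M%:Z :> int.
Proof. by lia. Qed.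

Lemma window_shift (M al i : nat) : (0 < al + 2 * M)%N ->
  - M%:Z - al%:Z + 1 + ((al + 2 * M).-1 + i)%N%:Z = M%:Z + i%:Z :> int.
Proof. by lia. Qed.

Lemma window_origin (M al : nat) : (al + 2 * M = 0)%N ->
  - M%:Z - al%:Z + 1 = M%:Z + 1%:Z :> int.
Proof. by lia. Qed.

Lemma window_size0 (M al cr : nat) : (al + 2 * M = 0)%N -> (0 < cr)%N ->
  cr = (al + 2 * M + cr).-1.+1.
Proof. by lia. Qed.

Lemma window_size (M al cr : nat) : (0 < al + 2 * M)%N ->
  (al + 2 * M + cr).-1 = ((al + 2 * M).-1 + cr)%N.
Proof. by lia. Qed.

Lemma window_size_le (M al cr k : nat) : (al + 2 * M + cr < k)%N -> ((al + 2 * M).-1 <= k)%N.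
Proof. by lia. Qed.

Section GoodSite.
Variables (M N al bb cr : nat) (C : R).
Hypothesis N0 : (0 < N)%N.
Hypothesis sc : valley_scale M N.
Hypothesis va : valley M N al bb cr C.

Let W := (2 * N ^ 4 + 2 * M + 1)%N.
Let D := M%:R * cc * 2 : R.

Local Lemma NR : (1 : R) <= N%:R. Proof. by rewrite ler1n. Qed.

Local Lemma D0 : 0 <= D.
Proof. by rewrite /D !mulr_ge0 // lrho_bound_ge0. Qed.

Local Lemma near_origin z : `|z| <= M%:Z -> `|V z - V M| <= D.
Proof.
move=> zM; pose n := absz (M%:Z - z).
have -> : V M = V (z + n%:Z) by congr V; rewrite /n; lia.
rewrite distrC; apply: (le_trans (pot_lip _ _)).
have H : (n <= 2 * M)%N by rewrite /n; lia.
have -> : D = (2 * M)%:R * cc by rewrite /D natrM; ring.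
by rewrite ler_wpM2r ?lrho_bound_ge0 // ler_nat.
Qed.

Local Lemma cr_gt : (bb < cr)%N.
Proof.
have [_ h _] := valley_size va; rewrite ltn_neqAle h andbT.
apply/negP => /eqP E; have := valley_right va; rewrite E subrr.
by have := NR; lra.
Qed.

Local Lemma bb_gt0 : (0 < bb)%N.
Proof.
rewrite lt0n; apply/negP => /eqP E; have := valley_depth va; rewrite E addr0 subrr.
by have := NR; lra.
Qed.

Local Lemma climb0 z : - M%:Z <= z -> z <= M%:Z + bb%:Z -> V z - V M <= N%:R + D.
Proof.
move=> z1 z2; have [zM|zM] := leP z M%:Z.
  have : `|z| <= M%:Z by lia.
  by move/near_origin; rewrite ler_norml => /andP[]; have := NR; lra.
have zE : z = M%:Z + (absz (z - M%:Z))%:Z by lia.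
have := @valley_climb _ _ _ _ _ _ va 0 (absz (z - M%:Z)).
rewrite -zE addr0 => H; have : (0 <= absz (z - M%:Z)%R <= bb)%N by lia.
by move/H; have := D0; lra.
Qed.

Local Lemma left_low z : - M%:Z - al%:Z <= z -> z <= M%:Z ->
  - (N%:R / 4) - D <= V z - V M.
Proof.
move=> z1 z2; have [zM|zM] := leP (- M%:Z) z.
  have : `|z| <= M%:Z by lia.
  by move/near_origin; rewrite ler_norml => /andP[]; have := NR; lra.
have zE : z = - M%:Z - (absz (- M%:Z - z))%:Z by lia.
have H := @valley_left_min _ _ _ _ _ _ va (absz (- M%:Z - z)).
rewrite -zE in H.
have /H {}H : (absz (- M%:Z - z)%R <= al)%N by lia.
have : `|- M%:Z| <= M%:Z by lia.
move/near_origin; rewrite ler_norml => /andP[]; lra.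
Qed.

(** The worst climb starts at a dip of depth [N / 4] on the left and ends at a height [N] on the
    right, hence [5 / 4 * N]; [2 * D] accounts for the starting region. *)
Local Lemma climb_all z z' : - M%:Z <= z -> z <= M%:Z + bb%:Z ->
  - M%:Z - al%:Z <= z' -> z' <= z -> V z - V z' <= 5 / 4 * N%:R + 2 * D.
Proof.
move=> z1 z2 z3 z4; have [zM|zM] := leP z' M%:Z.
  by have := climb0 z1 z2; have := left_low z3 zM; lra.
have zE : z = M%:Z + (absz (z - M%:Z))%:Z by lia.
have zE' : z' = M%:Z + (absz (z' - M%:Z))%:Z by lia.
have := @valley_climb _ _ _ _ _ _ va (absz (z' - M%:Z)) (absz (z - M%:Z)).
rewrite -zE -zE' => H.
have /H : (absz (z' - M%:Z)%R <= absz (z - M%:Z)%R <= bb)%N by lia.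
by have := D0; have := NR; lra.
Qed.

Local Lemma W_ge : (al + 2 * M + bb < W)%N /\ (al + 2 * M + cr < W)%N.
Proof. by have [h1 h2 h3] := valley_size va; rewrite /W; lia. Qed.

Local Lemma A_ge0 : (0 : R) < 2 ^+ (4 * N). Proof. by rewrite exprn_gt0. Qed.

(** [first_hit_lower] on the interval from the left wall to the bottom loses at most 1/4 to
    slowness, as all climbs are below [5 / 4 * N + 2 * D], and at most 1/4 to reaching the wall,
    which is much higher than the barrier on the right. *)
Local Lemma site_hit x : `|x| <= M%:Z ->
  1 / 2 <= \sum_(k < (2 ^ (4 * N)).+1) first_hit wstep (wwt e) (M%:Z + bb%:Z) k x.
Proof.
move=> xM.
pose y := - M%:Z - al%:Z; pose n := (al + 2 * M + bb)%N.
pose j := absz (x - y).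
have xE : x = y + j%:Z by rewrite /j /y; lia.
have bE : M%:Z + bb%:Z = y + n%:Z by rewrite /n /y; lia.
have [nW _] := W_ge.
have [n0|n0] := posnP n.
  have jn : j = 0%N by rewrite /j /y; lia.
  have -> : x = M%:Z + bb%:Z by rewrite xE jn bE n0.
  rewrite big_ord_recl /= eqxx; apply: (@le_trans _ _ (1 + 0)); first by lra.
  by rewrite lerD2l big1.
have jn : (j <= n)%N by rewrite /j /n /y; lia.
have aj : (al <= j)%N by rewrite /j /y; lia.
have P := first_hit_lower (@cond_gt0 _ e) y (2 ^ (4 * N)) n0 jn.
rewrite ec_cond // -xE -bE in P; apply: le_trans P.
have T : hit_time c y n j <= 2 ^+ (4 * N) / 4.
  apply: le_trans (scale_time sc).
  set X := pi_factor * _.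
  have X0 : 0 <= X by rewrite mulr_ge0 ?expR_ge0 // ltW // pi_factor_gt0.
  rewrite /hit_time; apply: (@le_trans _ _ (\sum_(j <= i < n) W%:R * X)).
    apply: ler_sum_nat => i /andP[ij i_n]; rewrite mulr_sumr.
    apply: (@le_trans _ _ (\sum_(l < i) X)); last first.
      by rewrite sumr_const card_ord -[leLHS]mulr_natl ler_wpM2r // ler_nat; lia.
    apply: ler_sum => l _; apply: (@le_trans _ _ ((c (y + i%:Z))^-1 *
      (pi_factor * expR (- V (y + l.+1%:Z))))).
      by rewrite ler_wpM2l ?piw_cond_le // invr_ge0 ltW // cond_gt0.
    rewrite mulrCA /X ler_wpM2l ?(ltW pi_factor_gt0) //.
    rewrite /cond -expRN opprK -expRD ler_expR; have li := ltn_ord l.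
    by apply: climb_all; rewrite /y; move: i_n; rewrite /n; lia.
  rewrite sumr_const_nat -[leLHS]mulr_natl mulrA ler_wpM2r // expr2 ler_wpM2r //.
  by rewrite ler_nat; lia.
have L : hit_left c y n j <= 1 / 4.
  apply: le_trans (scale_left sc).
  have DD := D0.
  pose X := expR (V M + N%:R + D).
  have cy : expR (V y) <= \sum_(0 <= i < n) (c (y + i%:Z))^-1.
    rewrite big_mkord (bigD1 (Ordinal n0)) //= addr0 /cond -expRN opprK lerDl.
    by apply: sumr_ge0 => i _; rewrite invr_ge0 expR_ge0.
  rewrite /hit_left ler_pdivrMr; last by apply: lt_le_trans cy; rewrite expR_gt0.
  apply: (@le_trans _ _ (W%:R * X)).
    apply: (@le_trans _ _ (\sum_(j <= i < n) X)).
      apply: ler_sum_nat => i /andP[ij i_n]; rewrite /cond -expRN opprK ler_expR.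
      have : V (y + i%:Z) - V M <= N%:R + D.
        by apply: climb0; rewrite /y; move: i_n; rewrite /n; lia.
      by lra.
    by rewrite sumr_const_nat -[leLHS]mulr_natl ler_wpM2r ?expR_ge0 // ler_nat; lia.
  rewrite -[leRHS]mulrA ler_wpM2l //.
  apply: (@le_trans _ _ (expR (2 * D - 6 * N%:R) * expR (V y))); last first.
    by rewrite ler_wpM2l ?expR_ge0.
  rewrite -expRD ler_expR.
  have := valley_left va; have : `|- M%:Z| <= M%:Z by lia.
  by move/near_origin; rewrite ler_norml => /andP[]; rewrite -/y -/D; lra.
have T2 : hit_time c y n j / (2 ^ (4 * N)).+1%:R <= 1 / 4.
  rewrite ler_pdivrMr ?ltr0n //; apply: (le_trans T).
  by rewrite -[(2 ^ (4 * N)).+1%:R]natr1 natrX; have := A_ge0; lra.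
by move: T2 L; set u := hit_time _ _ _ _ / _; set v := hit_left _ _ _ _; lra.
Qed.

Local Lemma site_srw x : `|x| <= M%:Z ->
  1 / 2 <= \sum_(k < (2 ^ (4 * N)).+1)
    first_hit wstep (wwt (fun=> 1 / 2 : R)) (M%:Z + bb%:Z) k x.
Proof.
move=> xM.
have [h1 h2 h3] := valley_size va.
(* The auxiliary left end is [4 * W] below the target while [x] is within [W] of it, so the ruin
   probability is at most 1/4. *)
pose n := (4 * W)%N; pose y := M%:Z + bb%:Z - n%:Z.
pose j := absz (x - y).
have bE : M%:Z + bb%:Z = y + n%:Z by rewrite /n /y; lia.
have xE : x = y + j%:Z by rewrite /j /y /n /W; lia.
have n0 : (0 < n)%N by rewrite /n /W; lia.
have jn : (j <= n)%N by rewrite /j /n /y /W; lia.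
have jn4 : (n - j <= W)%N by rewrite /j /n /y /W; lia.
have c1 : forall k : int, 0 < (fun=> 1 : R) k by [].
have P := first_hit_lower c1 y (2 ^ (4 * N)) n0 jn; clear c1.
rewrite ec_cst1 -xE -bE in P; apply: le_trans P.
have T : hit_time (fun=> 1 : R) y n j <= 2 ^+ (4 * N) / 4.
  apply: le_trans (scale_srw sc); rewrite /hit_time /piw.
  apply: (@le_trans _ _ (\sum_(j <= i < n) 2 * n%:R)).
    apply: ler_sum_nat => i /andP[_ i_n]; rewrite invr1 mul1r sumr_const card_ord.
    by rewrite -[leLHS]mulr_natl mulrC; have : (i%:R : R) <= n%:R; [rewrite ler_nat ltnW|lra].
  rewrite sumr_const_nat -[leLHS]mulr_natl.
  have : ((n - j)%:R : R) <= W%:R by rewrite ler_nat.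
  have -> : (n%:R : R) = 4 * W%:R by rewrite /n natrM.
  have W0 : (0 : R) <= W%:R by [].
  by set u := (n - j)%:R; set w := W%:R; move=> uw; nra.
have L : hit_left (fun=> 1 : R) y n j <= 1 / 4.
  rewrite /hit_left invr1 !sumr_const_nat subn0 ler_pdivrMr ?ltr0n //.
  have : ((n - j)%:R : R) <= W%:R by rewrite ler_nat.
  have -> : (n%:R : R) = 4 * W%:R by rewrite /n natrM.
  by lra.
have A0 := A_ge0.
have T2 : hit_time (fun=> 1 : R) y n j / (2 ^ (4 * N)).+1%:R <= 1 / 4.
  rewrite ler_pdivrMr ?ltr0n //; apply: (le_trans T).
  by rewrite -[(2 ^ (4 * N)).+1%:R]natr1 natrX; have := A_ge0; lra.
by move: T2 L; set u := hit_time _ _ _ _ / _; set v := hit_left _ _ _ _; lra.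
Qed.

Local Lemma C_ge0 : 0 <= C.
Proof. by apply: le_trans (valley_sharp va); apply: sumr_ge0 => i _; rewrite expR_ge0. Qed.

(** Crossing either wall by time [2 ^ (6 * N)] has probability at most 1/4, so the walk is between
    the walls with probability at least 1/2, and [return_lower] compares the weight of the bottom
    with that of the valley. In [C + 1], [C] pays for the right part and 1 for everything to the
    left of [M]. *)
Local Lemma site_return j : (j + j <= 2 ^ (6 * N))%N ->
  1 / (4 * (pi_factor * (C + 1))) <= kerw e (j + j) (M%:Z + bb%:Z) (M%:Z + bb%:Z).
Proof.
move=> jB; pose b := M%:Z + bb%:Z; rewrite -/b.
pose y := - M%:Z - al%:Z; pose l := (al + 2 * M + cr).-1.
have bc := cr_gt; have b0 := bb_gt0; have [_ lW] := W_ge.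
have DD := D0.
have lE : y + 1 + l%:Z = M%:Z + cr%:Z by rewrite /y /l; lia.
have J1 : (j.+1%:R : R) <= 2 ^+ (6 * N) + 1.
  by rewrite -natr1 lerD2r -natrX ler_nat; apply: leq_trans jB; rewrite leq_addr.
have F0 := pi_factor_gt0.
have exitb k : V b - V k <= - 7 * N%:R -> j.+1%:R * (pi_factor * expR (V b - V k)) <= 1 / 4.
  move=> hk; apply: le_trans (scale_exit sc); apply: ler_pM => //.
    by rewrite mulr_ge0 ?expR_ge0 // ltW.
  by rewrite ler_wpM2l ?(ltW F0) // ler_expR.
have ER : iter j (wop e) (fun z => (M%:Z + cr%:Z <= z)%R%:R) b <= 1 / 4.
  apply: le_trans (exit_right_pot j (lexx b) _) _; first by rewrite /b; lia.
  by apply: exitb; have := valley_right va; rewrite -/b; lra.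
have EL : iter j (wop e) (fun z => (z <= y)%R%:R) b <= 1 / 4.
  apply: le_trans (exit_left_pot j (lexx b) _) _; first by rewrite /b /y; lia.
  apply: exitb; have := valley_left va; have := valley_depth va; rewrite -/b -/y.
  have := scale_region sc; have : `|- M%:Z| <= M%:Z by lia.
  by move/near_origin; rewrite ler_norml -/D => /andP[]; lra.
have SI : 1 / 2 <= iter j (wop e) (fun z => ((y + 1 <= z) && (z < y + 1 + l%:Z))%:R) b.
  have : iter j (wop e) (fun z => ((y + 1 <= z) && (z < y + 1 + l%:Z))%:R +
     ((M%:Z + cr%:Z <= z)%R%:R + (z <= y)%R%:R)) b = 1.
    rewrite -[RHS](iter_mop_cst wstep (wwt_sum1 e) j 1 b); apply: iter_mop_ext => z.
    rewrite lE; case: (leP (M%:Z + cr%:Z) z) => h1; case: (leP z y) => h2;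
      case: (leP (y + 1) z) => h3 //=; rewrite ?addr0 ?add0r //; exfalso; move: h1 h2 h3; rewrite /y; lia.
  by rewrite !iter_mopD; lra.
have RL := @return_lower _ _ (@cond_gt0 _ e) j b (y + 1) l (1 / 2).
rewrite ec_cond // in RL.
have {}RL := RL _ SI.
have {}RL : (1 / 2) ^+ 2 * piw c b <= kerw e (j + j) b b * \sum_(j0 < l) piw c (y + 1 + j0%:Z).
  by apply: RL; lra.
have w0 := wwt_ge0 e01.
have p0 : 0 <= kerw e (j + j) b b by exact: ker_ge0.
have Mass : \sum_(j0 < l) piw c (y + 1 + j0%:Z) <= pi_factor * (C + 1) * expR (- V b).
  apply: (@le_trans _ _ (\sum_(j0 < l) pi_factor * expR (- V (y + 1 + j0%:Z)))).
    by apply: ler_sum => j0 _; apply: piw_cond_le.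
  rewrite -mulr_sumr -mulrA ler_wpM2l ?(ltW F0) //.
  pose g (z : int) := expR (V b - V z).
  suff H : \sum_(j0 < l) g (y + 1 + j0%:Z) <= C + 1.
    rewrite -ler_pdivrMr ?expR_gt0 // -expRN opprK mulr_suml.
    by under eq_bigr do rewrite -expRD addrC.
  have [a0|a0] := posnP (al + 2 * M)%N.
    have -> : y + 1 = M%:Z + 1%:Z := window_origin a0.
    have := valley_sharp va; have -> : cr = l.+1 := window_size0 a0 (leq_ltn_trans (leq0n _) bc).
    rewrite big_ord_recl => H.
    have g0 := expR_ge0 (V b - V (M%:Z + (ord0 : 'I_l.+1)%:Z)).
    apply: (@le_trans _ _ (C + 0)); last by lra.
    rewrite addr0; apply: le_trans H; rewrite -[leLHS]add0r lerD //.
    apply: ler_sum => i _; rewrite /g -/b lift0.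
    by rewrite -addrA -intS.
  have lE3 : l = ((al + 2 * M).-1 + cr)%N := window_size cr a0.
  rewrite lE3 big_split_ord /= addrC; apply: lerD.
    apply: le_trans (valley_sharp va); apply: ler_sum => i _.
    by rewrite /g -/b /y window_shift.
  apply: le_trans (scale_mass sc).
  apply: (@le_trans _ _ (\sum_(i < (al + 2 * M).-1) expR (2 * D - N%:R / 4))).
    apply: ler_sum => i _; rewrite /g ler_expR; have ii := ltn_ord i.
    have [w1 w2] := left_window ii; have := left_low w1 w2; rewrite -/y => LL.
    by have := valley_depth va; rewrite -/b; lra.
  by rewrite sumr_const card_ord -[leLHS]mulr_natl ler_wpM2r ?expR_ge0 // ler_nat (window_size_le lW).
have F1 : 0 < pi_factor * (C + 1) by rewrite mulr_gt0 // ltr_wpDl // C_ge0.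
have Eb := expR_gt0 (- V b).
have {}RL : (1 / 2) ^+ 2 * expR (- V b) <= kerw e (j + j) b b * (pi_factor * (C + 1) * expR (- V b)).
  apply: le_trans (le_trans RL _).
    by rewrite ler_wpM2l ?sqr_ge0 // piw_cond_ge.
  by rewrite ler_wpM2l.
rewrite mulrA ler_pM2r // in RL.
rewrite ler_pdivrMr; last by lra.
by move: RL; lra.
Qed.

Lemma valley_good_site :
  good_site e M N (M%:Z + bb%:Z) (1 / (4 * (pi_factor * (C + 1)))).
Proof. by split; [exact: site_hit|exact: site_srw|exact: site_return]. Qed.

End GoodSite.
End Valley.

(** * Expectations and sites *)

Section BoundedMeasurable.
Context d (T : measurableType d) (R : realType).
Implicit Types f g : T -> R.

Definition bmf f : Prop :=
  measurable_fun setT f /\ exists C, forall x, `|f x| <= C.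

Lemma bmf_cst (a : R) : bmf (fun=> a).
Proof. by split; [exact: measurable_cst|exists `|a|]. Qed.

Lemma bmfD f g : bmf f -> bmf g -> bmf (fun x => f x + g x).
Proof.
move=> [mf [C fC]] [mg [D gD]]; split; first exact: measurable_funD.
by exists (C + D) => x; apply: le_trans (ler_normD _ _) _; apply: lerD.
Qed.

Lemma bmfM f g : bmf f -> bmf g -> bmf (fun x => f x * g x).
Proof.
move=> [mf [C fC]] [mg [D gD]]; split; first exact: measurable_funM.
by exists (C * D) => x; rewrite normrM; apply: ler_pM.
Qed.

Lemma bmfZ a f : bmf f -> bmf (fun x => a * f x).
Proof. by move=> bf; apply: bmfM => //; exact: bmf_cst. Qed.

Lemma bmfN f : bmf f -> bmf (fun x => - f x).
Proof.
move=> bf; rewrite (_ : (fun x => - f x) = (fun x => (-1) * f x)); first exact: bmfZ.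
by apply/funext => x; rewrite mulN1r.
Qed.

Lemma bmfB f g : bmf f -> bmf g -> bmf (fun x => f x - g x).
Proof. by move=> bf /bmfN bg; apply: bmfD. Qed.

Lemma bmfX f n : bmf f -> bmf (fun x => f x ^+ n).
Proof.
move=> bf; elim: n => [|n IH]; first exact: (bmf_cst 1).
rewrite (_ : (fun x => f x ^+ n.+1) = (fun x => f x * f x ^+ n)); first exact: bmfM.
by apply/funext => x; rewrite exprS.
Qed.

Lemma bmf_sum (I : Type) (s : seq I) (F : I -> T -> R) :
  (forall i, bmf (F i)) -> bmf (fun x => \sum_(i <- s) F i x).
Proof.
move=> bF; elim: s => [|i s IH].
  rewrite (_ : (fun x => _) = (fun=> 0)); first exact: bmf_cst.
  by apply/funext => x; rewrite big_nil.
rewrite (_ : (fun x => _) = (fun x => F i x + \sum_(i <- s) F i x)); first exact: bmfD.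
by apply/funext => x; rewrite big_cons.
Qed.

Lemma measurable_bool_real (b : T -> bool) :
  measurable_fun setT b -> measurable_fun setT (fun x => (b x)%:R : R).
Proof.
move=> mb; rewrite (_ : (fun x => _) = (fun x => if b x then 1 else 0)).
  by apply: measurable_fun_ifT => //; exact: measurable_cst.
by apply/funext => x; case: (b x).
Qed.

Lemma bmf_bool (b : T -> bool) : measurable_fun setT b -> bmf (fun x => (b x)%:R).
Proof.
move=> mb; split; first exact: measurable_bool_real.
by exists 1 => x; case: (b x); rewrite ?normr0 ?normr1.
Qed.

End BoundedMeasurable.

Section Expectation.
Context d (T : measurableType d) (R : realType) (P : probability T R).
Implicit Types f g : T -> R.

Definition Ex f : R := (\int[P]_w f w)%R.

Lemma bmf_integrable f : bmf f -> P.-integrable setT (EFin \o f).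
Proof.
move=> [mf [C fC]]; apply: measurable_bounded_integrable => //.
  by apply: (le_lt_trans (probability_le1 P measurableT)); exact: ltry.
exists C; split; first exact: num_real.
by move=> y Cy x _; apply: le_trans (fC x) (ltW Cy).
Qed.

Lemma ExE f : bmf f -> (\int[P]_w (f w)%:E = (Ex f)%:E)%E.
Proof.
move=> /bmf_integrable fi; rewrite /Ex /Rintegral fineK //.
exact: integrable_fin_num.
Qed.

Lemma eq_Ex f g : f =1 g -> Ex f = Ex g.
Proof. by move=> fg; congr Ex; apply/funext. Qed.

Lemma Ex_cst a : Ex (fun=> a) = a.
Proof.
rewrite /Ex Rintegral_cst // [X in _ * fine X](_ : _ = 1%E) ?mulr1 //.
exact: probability_setT.
Qed.

Lemma ExD f g : bmf f -> bmf g -> Ex (fun x => f x + g x) = Ex f + Ex g.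
Proof. by move=> bf bg; rewrite /Ex RintegralD //; exact: bmf_integrable. Qed.

Lemma ExZ a f : bmf f -> Ex (fun x => a * f x) = a * Ex f.
Proof. by move=> bf; rewrite /Ex RintegralZl //; exact: bmf_integrable. Qed.

Lemma ExN f : bmf f -> Ex (fun x => - f x) = - Ex f.
Proof. by move=> bf; rewrite -mulN1r -ExZ //; apply: eq_Ex => x; rewrite mulN1r. Qed.

Lemma ExB f g : bmf f -> bmf g -> Ex (fun x => f x - g x) = Ex f - Ex g.
Proof. by move=> bf bg; rewrite ExD ?ExN //; exact: bmfN. Qed.

Lemma Ex_subc f a : bmf f -> Ex (fun x => f x - a) = Ex f - a.
Proof. by move=> bf; rewrite ExB ?Ex_cst //; exact: bmf_cst. Qed.

Lemma Ex_sum (I : Type) (s : seq I) (F : I -> T -> R) :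
  (forall i, bmf (F i)) -> Ex (fun x => \sum_(i <- s) F i x) = \sum_(i <- s) Ex (F i).
Proof.
move=> bF; elim: s => [|i s IH].
  by rewrite big_nil -[RHS](Ex_cst 0); apply: eq_Ex => x; rewrite big_nil.
rewrite big_cons -IH -ExD //; last exact: bmf_sum.
by apply: eq_Ex => x; rewrite big_cons.
Qed.

Lemma Ex_le f g : bmf f -> bmf g -> (forall x, f x <= g x) -> Ex f <= Ex g.
Proof. by move=> bf bg fg; apply: le_Rintegral => //; exact: bmf_integrable. Qed.

Lemma Ex_ge0 f : (forall x, 0 <= f x) -> 0 <= Ex f.
Proof. by move=> f0; apply: Rintegral_ge0. Qed.

Lemma Ex_bool (b : T -> bool) : measurable_fun setT b ->
  Ex (fun x => (b x)%:R) = pr P [set x | b x].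
Proof.
move=> mb; have mB : measurable [set x | b x].
  by have := mb measurableT [set true] I; rewrite setTI; apply.
rewrite /Ex /Rintegral /pr; congr fine.
transitivity (\int[P]_(x in setT) (\1_[set x | b x] x)%:E)%E; last first.
  by rewrite integral_indic // setIT.
apply: eq_integral => x _.
rewrite indicE; congr (_%:R%:E); case E : (b x); case: (boolP (x \in _)) => //.
  by rewrite notin_setE /= E.
by rewrite inE /= E.
Qed.

(** The positive integers below [t] count [t] up to an error 1; this discretises functions into
    events in [Ex_indep01]. *)
Lemma step_approx n (t : R) : 0 <= t -> t <= n%:R ->
  t - 1 <= \sum_(k < n) (k.+1%:R <= t)%R%:R <= t.
Proof.
elim: n t => [|n IH] t t0 tn; first by rewrite big_ord0; apply/andP; split; lra.
rewrite big_ord_recr /=; have [tn'|tn'] := leP t n%:R.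
  have -> : (n.+1%:R <= t) = false by apply/negbTE; rewrite -ltNge -natr1; lra.
  by rewrite addr0; apply: IH.
have -> : \sum_(k < n) (k.+1%:R <= t)%R%:R = n%:R :> R.
  rewrite (eq_bigr (fun=> 1)); first by rewrite sumr_const card_ord.
  move=> i _; have -> // : (i.+1%:R <= t)%R.
  by apply: le_trans (ltW tn'); rewrite ler_nat.
rewrite -natr1 in tn *.
by case: (leP (n%:R + 1) t) => /= h; apply/andP; split; lra.
Qed.

(** [ap n f] is within 1 of [n * f] and is a sum of indicators of level sets, for which the
    hypothesis factorises products. The error is of order [n] against the factor [n ^ 2]. *)
Lemma Ex_indep01 f g :
  measurable_fun setT f -> measurable_fun setT g ->
  (forall x, 0 <= f x <= 1) -> (forall x, 0 <= g x <= 1) ->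
  (forall s t, pr P [set x | (s <= f x) && (t <= g x)] =
     pr P [set x | s <= f x] * pr P [set x | t <= g x]) ->
  Ex (fun x => f x * g x) = Ex f * Ex g.
Proof.
move=> mf mg f01 g01 ind.
have mle (h : T -> R) : measurable_fun setT h -> forall s, measurable_fun setT (fun x : T => s <= h x :> R).
  by move=> mh s; apply: measurable_fun_ler => //; exact: measurable_cst.
have b01 (h : T -> R) : measurable_fun setT h -> (forall x, 0 <= h x <= 1) -> bmf h.
  by move=> mh h01; split => //; exists 1 => x; have /andP[h0 h1] := h01 x; rewrite ger0_norm.
have bf := b01 _ mf f01; have bg := b01 _ mg g01.
pose ap n (h : T -> R) x : R := \sum_(k < n) (k.+1%:R <= n%:R * h x)%R%:R.
have mn n (h : T -> R) : measurable_fun setT h -> measurable_fun setT (fun x => n%:R * h x : R).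
  by move=> mh; apply: measurable_funM => //; exact: measurable_cst.
have bap n (h : T -> R) : measurable_fun setT h -> bmf (ap n h).
  by move=> mh; apply: bmf_sum => k; apply: bmf_bool; apply: mle; exact: mn.
have apP n (h : T -> R) x : 0 <= h x <= 1 -> n%:R * h x - 1 <= ap n h x <= n%:R * h x.
  move=> /andP[h0 h1]; apply: step_approx; first by rewrite mulr_ge0.
  by rewrite ler_piMr.
have key n : Ex (fun x => ap n f x * ap n g x) = Ex (ap n f) * Ex (ap n g).
  have mk (h : T -> R) (k : 'I_n) : measurable_fun setT h ->
    bmf (fun x => (k.+1%:R <= n%:R * h x)%R%:R : R).
    by move=> mh; apply: bmf_bool; apply: mle; exact: mn.
  rewrite [in RHS]/Ex -!/(Ex _) !Ex_sum; try by move=> k; exact: mk.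
  rewrite mulr_suml.
  rewrite (eq_Ex (g := fun x => \sum_(k < n) \sum_(l < n) ((k.+1%:R <= n%:R * f x)%R%:R * (l.+1%:R <= n%:R * g x)%R%:R))); last first.
    by move=> x; rewrite /ap mulr_suml; apply: eq_bigr => k _; rewrite mulr_sumr.
  rewrite Ex_sum; last first.
    by move=> k; apply: bmf_sum => l; apply: bmfM; exact: mk.
  apply: eq_bigr => k _; rewrite mulr_sumr Ex_sum; last first.
    by move=> l; apply: bmfM; exact: mk.
  apply: eq_bigr => l _.
  have n0 : (0 : R) < n%:R by rewrite ltr0n; case: n k {l mk bap apP mn} => // -[].
  have E (h : T -> R) (i : 'I_n) x : (i.+1%:R <= n%:R * h x)%R = (i.+1%:R / n%:R <= h x :> R).
    by rewrite ler_pdivrMr // mulrC.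
  rewrite (eq_Ex (g := fun x => ((k.+1%:R / n%:R <= f x) && (l.+1%:R / n%:R <= g x))%:R)); last first.
    by move=> x; rewrite !E -natrM mulnb.
  rewrite Ex_bool; last by apply: measurable_and; exact: mle.
  rewrite (ind _ _) -!Ex_bool; try exact: mle.
  by congr (_ * _); apply: eq_Ex => x; rewrite E.
have E1 (h : T -> R) n : measurable_fun setT h -> (forall x, 0 <= h x <= 1) ->
    n%:R * Ex h - 1 <= Ex (ap n h) <= n%:R * Ex h.
  move=> mh h01; have bh := b01 _ mh h01; have bZ := bmfZ n%:R bh.
  have bp := bap n h mh; rewrite -ExZ // -(Ex_subc 1) //; apply/andP; split; apply: Ex_le => //.
  - by apply: bmfB => //; exact: bmf_cst.
  - by move=> x; have /andP[] := apP n h x (h01 x).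
  - by move=> x; have /andP[] := apP n h x (h01 x).
have E2 n : n%:R ^+ 2 * Ex (fun x => f x * g x) - 2 * n%:R <= Ex (fun x => ap n f x * ap n g x)
    <= n%:R ^+ 2 * Ex (fun x => f x * g x).
  have bpf := bap n f mf; have bpg := bap n g mg.
  have bfg := bmfM bf bg; have bapp := bmfM (bap n _ mf) (bap n _ mg).
  have n0 : (0 : R) <= n%:R by [].
  have ap0 (h : T -> R) x : 0 <= ap n h x by apply: sumr_ge0.
  have bZ := bmfZ (n%:R ^+ 2) bfg; rewrite -ExZ // -(Ex_subc (2 * n%:R)) //.
  apply/andP; split; apply: Ex_le => //.
  - by apply: bmfB => //; exact: bmf_cst.
  - move=> x; have /andP[a1 a2] := apP n f x (f01 x); have /andP[b1 b2] := apP n g x (g01 x).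
    have /andP[f0 f1] := f01 x; have /andP[g0 g1] := g01 x.
    have A0 := ap0 f x; have B0 := ap0 g x.
    set u := ap n f x in a1 a2 A0 *; set v := ap n g x in b1 b2 B0 *.
    have : n%:R * f x <= n%:R by rewrite ler_piMr.
    have : n%:R * g x <= n%:R by rewrite ler_piMr.
    move: a1 a2 b1 b2 A0 B0; rewrite expr2 mulrACA.
    set p := n%:R * f x; set q := n%:R * g x; set N := n%:R : R; move=> *.
    have : 0 <= (p - u) * (N - q) + (p - u) * q - (p - u) * q by nra.
    by nra.
  - move=> x; have /andP[a1 a2] := apP n f x (f01 x); have /andP[b1 b2] := apP n g x (g01 x).
    by rewrite expr2 mulrACA; apply: ler_pM.
(* A difference whose product with every [n] is bounded by 2 must vanish. *)
have ub n : `|n%:R * (Ex (fun x => f x * g x) - Ex f * Ex g)| <= 2.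
  have [->|n0] := posnP n; first by rewrite mul0r normr0.
  have nR : (0 : R) < n%:R by rewrite ltr0n.
  rewrite -(ler_pM2l nR) -{1}(ger0_norm (ltW nR)) -normrM mulrA -expr2 mulrBr ler_norml.
  have := E2 n; rewrite key; have := E1 _ n mf f01; have := E1 _ n mg g01.
  have Ef1 : 0 <= Ex f <= 1.
    rewrite Ex_ge0 => [|x]; last by case/andP: (f01 x).
    by rewrite -(Ex_cst 1); apply: Ex_le => //; [exact: bmf_cst|move=> x; case/andP: (f01 x)].
  have Eg1 : 0 <= Ex g <= 1.
    rewrite Ex_ge0 => [|x]; last by case/andP: (g01 x).
    by rewrite -(Ex_cst 1); apply: Ex_le => //; [exact: bmf_cst|move=> x; case/andP: (g01 x)].
  have Eu0 : 0 <= Ex (ap n f) by apply: Ex_ge0 => x; apply: sumr_ge0.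
  have Ev0 : 0 <= Ex (ap n g) by apply: Ex_ge0 => x; apply: sumr_ge0.
  move: Ef1 Eg1 Eu0 Ev0; set a := Ex f; set b := Ex g; set u := Ex (ap n f); set v := Ex (ap n g).
  set c := Ex _; set N := n%:R in nR *; move=> /andP[a0 a1] /andP[b0 b1] u0 v0 /andP[v1 v2] /andP[u1 u2] /andP[c1 c2].
  have h1 : u * v <= N * a * (N * b) by apply: ler_pM.
  have h2 : N * a * (N * b) - 2 * N <= u * v.
    have Na : N * a <= N by rewrite ler_piMr // ltW.
    have Nb : N * b <= N by rewrite ler_piMr // ltW.
    move: v1 v2 u1 u2 Na Nb; set p := N * a; set q := N * b; move=> *; nra.
  by apply/andP; split; nra.
apply/eqP; rewrite -subr_eq0; apply/eqP; set D := _ - _ in ub *.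
apply/eqP; case: eqP => // /eqP D0; exfalso.
have Dn : 0 < `|D| by rewrite normr_gt0.
have [k hk] : exists k : nat, 2 / `|D| < k%:R.
  exists (Num.truncn (2 / `|D|)).+1; exact: truncnS_gt.
have := ub k; rewrite normrM ger0_norm // leNgt => /negP; apply.
by rewrite -ltr_pdivrMr.
Qed.

(** Affine rescaling to values between 0 and 1, which preserves level sets. *)
Lemma Ex_indep f g : bmf f -> bmf g ->
  (forall s t, pr P [set x | (s <= f x) && (t <= g x)] =
     pr P [set x | s <= f x] * pr P [set x | t <= g x]) ->
  Ex (fun x => f x * g x) = Ex f * Ex g.
Proof.
move=> bf bg ind.
have [mf [C fC]] := bf; have [mg [D gD]] := bg.
have C0 : 0 <= C by apply: le_trans (fC point).
have D0 : 0 <= D by apply: le_trans (gD point).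
pose a := (2 * C + 1)^-1; pose b := (2 * D + 1)^-1.
have a0 : 0 < a by rewrite invr_gt0; lra.
have b0 : 0 < b by rewrite invr_gt0; lra.
pose f' x := a * (f x + C); pose g' x := b * (g x + D).
have mf' : measurable_fun setT f'.
  by apply: measurable_funM; [exact: measurable_cst|apply: measurable_funD => //; exact: measurable_cst].
have mg' : measurable_fun setT g'.
  by apply: measurable_funM; [exact: measurable_cst|apply: measurable_funD => //; exact: measurable_cst].
have f01 x : 0 <= f' x <= 1.
  have := fC x; rewrite ler_norml => /andP[h1 h2]; apply/andP; split.
    by apply: mulr_ge0; [exact: ltW|lra].
  by rewrite /f' /a mulrC ler_pdivrMr; lra.
have g01 x : 0 <= g' x <= 1.
  have := gD x; rewrite ler_norml => /andP[h1 h2]; apply/andP; split.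
    by apply: mulr_ge0; [exact: ltW|lra].
  by rewrite /g' /b mulrC ler_pdivrMr; lra.
have Ef s x : (s <= f' x) = (s / a - C <= f x).
  by rewrite lerBlDr ler_pdivrMr // mulrC.
have Eg s x : (s <= g' x) = (s / b - D <= g x).
  by rewrite lerBlDr ler_pdivrMr // mulrC.
have H : Ex (fun x => f' x * g' x) = Ex f' * Ex g'.
  apply: Ex_indep01 => // s t.
  have -> : [set x | (s <= f' x) && (t <= g' x)] = [set x | (s / a - C <= f x) && (t / b - D <= g x)].
    by apply/seteqP; split=> x /=; rewrite Ef Eg.
  have -> : [set x | (s <= f' x)] = [set x | (s / a - C <= f x)].
    by apply/seteqP; split=> x /=; rewrite Ef.
  have -> : [set x | (t <= g' x)] = [set x | (t / b - D <= g x)].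
    by apply/seteqP; split=> x /=; rewrite Eg.
  exact: ind.
have cC := bmf_cst T C; have cD := bmf_cst T D.
have bfg := bmfM bf bg.
have E1 : Ex f' = a * (Ex f + C) by rewrite ExZ ?ExD ?Ex_cst //; exact: bmfD.
have E2 : Ex g' = b * (Ex g + D) by rewrite ExZ ?ExD ?Ex_cst //; exact: bmfD.
have E3 : Ex (fun x => f' x * g' x) = a * b * (Ex (fun x => f x * g x) + (D * Ex f + (C * Ex g + C * D))).
  rewrite -[C * D in RHS]Ex_cst -!ExZ // -!ExD -?ExZ //; try by repeat first [exact: bmf_cst|exact: bmfZ|exact: bmfD|apply: bmfD].
    by apply: eq_Ex => x; rewrite /f' /g'; ring.
move: H; rewrite E1 E2 E3.
have ab0 : a * b != 0 by rewrite mulf_neq0 // gt_eqF.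
have -> : a * (Ex f + C) * (b * (Ex g + D)) = a * b * ((Ex f + C) * (Ex g + D)) by ring.
by move/(mulfI ab0) => H; lra.
Qed.

End Expectation.

(** * Sigma-algebras generated by sets of sites *)

Section Environment.
Context d (Om : measurableType d) (R : realType) (P : probability Om R).
Variable om : int -> Om -> R.
Hypothesis mom : forall x, measurable_fun setT (om x).

Definition env_gen (J : set int) : set_system Om :=
  \bigcup_(x in J) preimage_set_system setT (om x) measurable.

(** The same sample space with the sigma-algebra of the sites in [J]: measurability there expresses
    that only these sites are used. *)
Definition env_space (J : set int) := g_sigma_algebraType (env_gen J).
HB.instance Definition _ J := Measurable.on (env_space J).

Lemma env_space_sub J (A : set (env_space J)) :
  measurable A -> measurable (A : set Om).
Proof.
move=> mA; apply: mA; split; last by move=> _ [x _ [B mB <-]]; exact: mom.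
by split; [exact: measurable0|move=> B mB; rewrite setTD; exact: measurableC|exact: bigcupT_measurable].
Qed.

Lemma env_space_mono J J' (A : set Om) : J `<=` J' ->
  measurable (A : set (env_space J)) -> measurable (A : set (env_space J')).
Proof.
move=> JJ; apply: sub_smallest2r; first exact: smallest_sigma_algebra.
move=> B [x Jx [C mC <-]].
by exists x; [exact: JJ|exists C].
Qed.

Lemma env_space_site (J : set int) x : J x ->
  measurable_fun (setT : set (env_space J)) (om x).
Proof. by move=> Jx _ B mB; apply: sub_sigma_algebra; exists x => //; exists B. Qed.

Lemma env_fun_mono d' (T' : measurableType d') J J' (f : Om -> T') : J `<=` J' ->
  measurable_fun (setT : set (env_space J)) f ->
  measurable_fun (setT : set (env_space J')) f.
Proof.
move=> JJ mf _ B mB; rewrite setTI; apply: (env_space_mono JJ).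
by have := mf measurableT B mB; rewrite setTI.
Qed.

Lemma env_fun_sub d' (T' : measurableType d') J (f : Om -> T') :
  measurable_fun (setT : set (env_space J)) f -> measurable_fun (setT : set Om) f.
Proof.
move=> mf _ B mB; rewrite setTI; apply: (@env_space_sub J).
by have := mf measurableT B mB; rewrite setTI.
Qed.

Lemma bmf_env_sub J (f : Om -> R) : @bmf _ (env_space J) R f -> bmf f.
Proof. by move=> [mf bf]; split => //; exact: env_fun_sub mf. Qed.

Lemma bmf_env_mono J J' (f : Om -> R) : J `<=` J' ->
  @bmf _ (env_space J) R f -> @bmf _ (env_space J') R f.
Proof. by move=> JJ [mf bf]; split => //; exact: env_fun_mono mf. Qed.

Hypothesis ind : mutually_independent P
  (fun x : int => process_sigma_algebra (fun _ : unit => om x)).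

Definition env_cyl (J : set int) : set_system Om :=
  [set A | exists (F : {fset int}) (B : int -> set R),
    [/\ forall x, x \in F -> J x, forall x, measurable (B x) &
      A = \bigcap_(x in [set` F]) (om x @^-1` B x)]].

Lemma env_cyl_setI J : setI_closed (env_cyl J).
Proof.
move=> _ _ [F [B [FJ mB ->]]] [F' [B' [FJ' mB' ->]]].
exists (F `|` F')%fset, (fun x => (if x \in F then B x else setT) `&`
  (if x \in F' then B' x else setT)); split.
- by move=> x; rewrite inE => /orP[/FJ|/FJ'].
- by move=> x; apply: measurableI; case: ifP.
apply/seteqP; split=> w /=.
  move=> [H H'] x /= _; split; case: ifP => // xF; [exact: H|exact: H'].
move=> H; split=> x /= xF.
  have [] := H x; first by rewrite /= inE xF.
  by rewrite xF.
have [] := H x; first by rewrite /= inE xF orbT.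
by rewrite xF.
Qed.

Lemma env_cyl_gen J : <<s env_cyl J >> = <<s env_gen J >>.
Proof.
apply/seteqP; split.
  apply: smallest_sub; first exact: smallest_sigma_algebra.
  move=> _ [F [B [FJ mB ->]]].
  apply: (@fin_bigcap_measurable _ (env_space J)) => [|x xF]; first exact: finite_fset.
  have := env_space_site (FJ _ xF) measurableT (mB x); by rewrite setTI.
apply: sub_smallest2r; first exact: smallest_sigma_algebra.
move=> _ [x Jx [B mB <-]].
exists [fset x]%fset, (fun=> B); split => //.
  by move=> y; rewrite inE => /eqP ->.
rewrite setTI; apply/seteqP; split=> w /=.
  by move=> Bw y /=; rewrite inE => /eqP ->.
by move=> /(_ x) /=; rewrite inE; apply.
Qed.

Lemma pr_site_cyl (F : {fset int}) (B : int -> set R) : (forall x, measurable (B x)) ->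
  P (\bigcap_(x in [set` F]) (om x @^-1` B x)) = (\prod_(x <- F) P (om x @^-1` B x))%E.
Proof.
move=> mB; apply: ind => x _; apply: sub_sigma_algebra; exists tt => //.
by exists (B x) => //; rewrite setTI.
Qed.

Lemma env_cyl_indep J1 J2 A B : (forall x, J1 x -> J2 x -> False) ->
  env_cyl J1 A -> env_cyl J2 B -> P (A `&` B) = (P A * P B)%E.
Proof.
move=> dis [F1 [B1 [FJ1 m1 ->]]] [F2 [B2 [FJ2 m2 ->]]].
pose C x := if x \in F1 then B1 x else B2 x.
have mC x : measurable (C x) by rewrite /C; case: ifP.
have nF x : x \in F2 -> (x \in F1) = false.
  by move=> x2; apply/negP => x1; apply: (dis x); [exact: FJ1|exact: FJ2].
have -> : \bigcap_(x in [set` F1]) (om x @^-1` B1 x) `&` \bigcap_(x in [set` F2]) (om x @^-1` B2 x)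
    = \bigcap_(x in [set` (F1 `|` F2)%fset]) (om x @^-1` C x).
  apply/seteqP; split=> w /=.
    move=> [H1 H2] x /=; rewrite inE => /orP[xF|xF]; rewrite /C.
      by rewrite xF; apply: H1.
    by rewrite nF //; apply: H2.
  move=> H; split=> x /= xF; have := H x; rewrite /= inE xF ?orbT /C.
    by rewrite xF; apply.
  by rewrite nF //; apply.
rewrite !pr_site_cyl // -[RHS](_ : (\prod_(x <- (F1 : seq int) ++ (F2 : seq int)) P (om x @^-1` C x) = _)%E).
  apply: perm_big; apply: uniq_perm; first exact: fset_uniq.
    rewrite cat_uniq !fset_uniq /= andbT; apply/hasPn => x xF /=.
    by rewrite nF.
  by move=> x; rewrite mem_cat inE.
rewrite big_cat /=; congr (_ * _)%E; apply: eq_big_seq => x xF; rewrite /C.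
  by rewrite xF.
by rewrite nF.
Qed.

(** The pi-lambda argument for one factor; [env_indep] applies it to each factor in turn, starting
    from cylinders. *)
Lemma indep_dynkin (G1 : set_system Om) (B : set Om) : setI_closed G1 ->
  (forall A, G1 A -> measurable A) -> measurable B ->
  (forall A, G1 A -> P (A `&` B) = (P A * P B)%E) ->
  forall A, <<s G1 >> A -> P (A `&` B) = (P A * P B)%E.
Proof.
move=> GI mG mB H A sA.
have sub S : measurable (S : set (g_sigma_algebraType G1)) -> measurable (S : set Om).
  move=> mS; apply: mS; split => //.
  by split; [exact: measurable0|move=> C mC; rewrite setTD; exact: measurableC|exact: bigcupT_measurable].
apply: (@dynkin_induction _ (g_sigma_algebraType G1) G1 (fun A => P (A `&` B) = (P A * P B)%E)) => //.
- rewrite setTI [X in (X * _)%E](_ : _ = 1%E) ?mul1e //; exact: probability_setT.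
- move=> S mS; have {}mS := sub _ mS; rewrite !prE //; try exact: measurableI; try exact: measurableC.
    rewrite -!EFinM => -[E]; congr (_%:E).
    have -> : ~` S `&` B = B `\` (S `&` B).
      by apply/seteqP; split=> w /= [h1 h2]; split => //; [case|move=> Sw; apply: h2].
    rewrite prD //; try exact: measurableI; try exact: subIsetr.
    by rewrite E prC //; ring.
  by apply: measurableI => //; exact: measurableC.
- move=> F mF tF HF.
  have {}mF n := sub _ (mF n).
  rewrite setI_bigcupl measure_bigcup //; first last.
  - by apply: trivIset_setIr.
  - by move=> i _; apply: measurableI.
  rewrite measure_bigcup // (eq_eseriesr (fun i _ => HF i)).
  rewrite (eq_eseriesr (g := fun i => ((pr P B)%:E * P (F i))%E)); last first.
    by move=> i _; rewrite muleC; congr (_ * _)%E; exact: prE.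
  by rewrite nneseriesZl // muleC; congr (_ * _)%E; rewrite -prE.
Qed.

Lemma env_indep J1 J2 (A B : set Om) : (forall x, J1 x -> J2 x -> False) ->
  measurable (A : set (env_space J1)) -> measurable (B : set (env_space J2)) ->
  pr P (A `&` B) = pr P A * pr P B.
Proof.
move=> dis mA mB.
have mcyl J C : env_cyl J C -> measurable C.
  move=> h; apply: (@env_space_sub J).
  have : <<s env_cyl J >> C by exact: sub_sigma_algebra.
  by rewrite env_cyl_gen.
have mA' := env_space_sub mA; have mB' := env_space_sub mB.
suff H : P (A `&` B) = (P A * P B)%E.
  by apply: EFin_inj; rewrite EFinM -!prE //; exact: measurableI.
have sA : <<s env_cyl J1 >> A by rewrite env_cyl_gen.
have sB : <<s env_cyl J2 >> B by rewrite env_cyl_gen.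
apply: (indep_dynkin (@env_cyl_setI J1)) sA => //; first exact: mcyl.
move=> C hC; rewrite setIC muleC.
apply: (indep_dynkin (@env_cyl_setI J2)) sB => //; first exact: mcyl.
  exact: mcyl hC.
by move=> D hD; rewrite setIC muleC; exact: env_cyl_indep hC hD.
Qed.

Lemma env_indep_Ex J1 J2 (f g : Om -> R) : (forall x, J1 x -> J2 x -> False) ->
  @bmf _ (env_space J1) R f -> @bmf _ (env_space J2) R g ->
  Ex P (fun w => f w * g w) = Ex P f * Ex P g.
Proof.
move=> dis bf bg; apply: Ex_indep.
- exact: bmf_env_sub bf.
- exact: bmf_env_sub bg.
move=> s t; rewrite -(env_indep dis).
- by congr pr; apply/seteqP; split=> w /= => [/andP[]|[h1 h2]]; [split|apply/andP].
- have [mf _] := bf; have := mf measurableT [set` `[s, +oo[] (measurable_itv _); rewrite setTI.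
  rewrite (_ : [set w | s <= f w] = f @^-1` [set` `[s, +oo[]) //.
  by apply/seteqP; split=> w /=; rewrite in_itv /= andbT.
- have [mf _] := bg; have := mf measurableT [set` `[t, +oo[] (measurable_itv _); rewrite setTI.
  rewrite (_ : [set w | t <= g w] = g @^-1` [set` `[t, +oo[]) //.
  by apply/seteqP; split=> w /=; rewrite in_itv /= andbT.
Qed.

End Environment.

(** * Paths of the potential *)

Section Paths.
Variable R : realType.
Implicit Types (x Phi : nat -> R) (g : nat -> bool) (H : R).

Definition psum x (k : nat) : R := \sum_(i < k) x i.

Fixpoint rmin x (k : nat) : R :=
  match k with 0 => 0 | k'.+1 => Num.min (rmin x k') (psum x k'.+1) end.

Definition draw x (k : nat) : R := psum x k - rmin x k.

(** The weight of the path measured from its running minimum. At the end of a climb it is the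
    sharpness of the valley bottom. *)
Definition mass x (k : nat) : R := \sum_(i < k.+1) expR (rmin x k - psum x i).

Fixpoint alive g (k : nat) : bool :=
  match k with 0 => g 0%N | k'.+1 => alive g k' && g k'.+1 end.

(** [Phi] stopped at the first failure of [g] (see [stopP]), written as a sum of increments so that
    its mean can be computed term by term. *)
Definition stop g Phi (k : nat) : R :=
  Phi 0%N + \sum_(i < k) (alive g i)%:R * (Phi i.+1 - Phi i).

Lemma psum0 x : psum x 0 = 0. Proof. by rewrite /psum big_ord0. Qed.

Lemma psumS x k : psum x k.+1 = psum x k + x k.
Proof. by rewrite /psum big_ord_recr. Qed.

Lemma aliveP g k : reflect (forall i, (i <= k)%N -> g i) (alive g k).
Proof.
elim: k => [|k IH] /=.
  by apply: (iffP idP) => [g0 i|]; [rewrite leqn0 => /eqP ->|apply].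
apply: (iffP andP) => [[/IH h gk] i|h].
  by rewrite leq_eqVlt => /orP[/eqP ->//|]; apply: h.
by split; [apply/IH => i ik; apply: h; apply: leqW|apply: h].
Qed.

Lemma stopS g Phi k :
  stop g Phi k.+1 = stop g Phi k + (alive g k)%:R * (Phi k.+1 - Phi k).
Proof. by rewrite /stop big_ord_recr /= addrA. Qed.

Lemma stopP g Phi k : exists j, [/\ (j <= k)%N, stop g Phi k = Phi j,
  forall i, (i < j)%N -> g i, alive g k || ~~ g j & alive g k -> j = k].
Proof.
elim: k => [|k [j [jk E gj d a]]].
  exists 0%N; split => //; first by rewrite /stop big_ord0 addr0.
  by rewrite /= orbN.
have [ak|nak] := boolP (alive g k); last first.
  exists j; split => //.
  - exact: leqW.
  - by rewrite stopS E (negbTE nak) mul0r addr0.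
  - by move: d; rewrite /= (negbTE nak).
  - by rewrite /= (negbTE nak).
exists k.+1; split => //.
- by rewrite stopS E (a ak) ak mul1r addrC subrK.
- by move=> i ik; move/aliveP: ak; apply.
- by rewrite /= ak orbN.
Qed.

Lemma stop_sqr g Phi k : Phi 0%N = 0 ->
  stop g Phi k ^+ 2 = stop g (fun i => Phi i ^+ 2) k.
Proof.
move=> P0; elim: k => [|k IH]; first by rewrite /stop !big_ord0 P0 !addr0.
have [j [jk E gj d a]] := stopP g Phi k.
rewrite !stopS -IH; have [ak|nak] := boolP (alive g k); last by rewrite !mul0r !addr0.
by rewrite E (a ak) !mul1r; ring.
Qed.

Arguments alive : simpl never.

Definition inside (h H : R) x (i : nat) : bool := (- h < psum x i) && (psum x i < H).

Lemma stop_psum_bounds h H c x k : 0 < h -> 0 < H -> 0 <= c -> (forall i, `|x i| <= c) ->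
  - (h + c) <= stop (inside h H x) (psum x) k <= H + c.
Proof.
move=> h0 H0 c0 xc; have [j [jk -> gj _ _]] := stopP (inside h H x) (psum x) k.
case: j jk gj => [|j] jk gj; first by rewrite psum0; apply/andP; split; lra.
have := gj j (ltnSn _); rewrite /inside psumS => /andP[h1 h2].
by have := xc j; rewrite ler_norml => /andP[h3 h4]; apply/andP; split; lra.
Qed.

Lemma exit_down h H x k : 0 < h -> 0 < H ->
  ~~ alive (inside h H x) k -> stop (inside h H x) (psum x) k < H ->
  exists z, [/\ (z <= k)%N, psum x z <= - h,
    forall i, (i < z)%N -> inside h H x i & forall i, (i <= z)%N -> psum x i <= H].
Proof.
move=> h0 H0 nal; have [j [jk -> gj d _]] := stopP (inside h H x) (psum x) k.
move: d; rewrite (negbTE nal) /= /inside negb_and -!leNgt => /orP[d|d] hH; last first.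
  by exfalso; move: d; rewrite leNgt hH.
exists j; split => // i; rewrite leq_eqVlt => /orP[/eqP ->|/gj /andP[_ /ltW //]].
by apply: (le_trans d); lra.
Qed.

Lemma rmin_le x k i : (i <= k)%N -> rmin x k <= psum x i.
Proof.
elim: k i => [|k IH] i; first by rewrite leqn0 => /eqP ->; rewrite psum0.
rewrite leq_eqVlt => /orP[/eqP ->|ik] /=; first by rewrite ge_min lexx orbT.
by rewrite ge_min IH.
Qed.

Lemma rmin_arg x k : exists2 b, (b <= k)%N & rmin x k = psum x b.
Proof.
elim: k => [|k [b bk E]]; first by exists 0%N => //; rewrite psum0.
rewrite /= /Num.min; case: ifP => _; first by exists b; [exact: leqW|].
by exists k.+1.
Qed.

Lemma draw_ge0 x k : 0 <= draw x k.
Proof. by rewrite /draw subr_ge0 rmin_le. Qed.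

Lemma draw0 x : draw x 0 = 0. Proof. by rewrite /draw psum0 subrr. Qed.

(** The fall of the running minimum at step [k], which is the push that keeps [draw] nonnegative. *)
Definition drop x k : R := Num.max 0 (- (draw x k + x k)).

Lemma drop_ge0 x k : 0 <= drop x k. Proof. by rewrite /drop le_max lexx. Qed.

Lemma rminS x k : rmin x k.+1 = rmin x k - drop x k.
Proof.
rewrite /= /drop /draw psumS.
have [h|h] := leP (rmin x k) (psum x k + x k); have [h'|h'] := leP 0 (- (psum x k - rmin x k + x k)); lra.
Qed.

Arguments rmin : simpl never.

Lemma drawS x k : draw x k.+1 = draw x k + x k + drop x k.
Proof. by rewrite /draw rminS psumS; ring. Qed.

Lemma drop_cases x k : (drop x k = 0 /\ draw x k.+1 = draw x k + x k) \/
  (draw x k.+1 = 0 /\ drop x k = - (draw x k + x k)).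
Proof.
rewrite drawS /drop; have [h|h] := leP 0 (- (draw x k + x k)); [right|left]; split; lra.
Qed.

Lemma drop_le c x k : 0 <= c -> (forall i, `|x i| <= c) -> drop x k <= c.
Proof.
move=> c0 xc; have := xc k; rewrite ler_norml => /andP[h1 h2]; have := draw_ge0 x k.
by rewrite /drop ge_max c0 /=; lra.
Qed.

(** With centred steps this makes the square of [draw] grow in mean by the second moment of the
    positive part. A downward step may be cut off by the reflection at zero, so its square is not
    claimed. *)
Lemma draw_sqr x k :
  draw x k ^+ 2 + 2 * draw x k * x k + Num.max (x k) 0 ^+ 2 <= draw x k.+1 ^+ 2.
Proof.
have D0 := draw_ge0 x k; have D1 := draw_ge0 x k.+1; have := drop_ge0 x k.
by have [[-> ->]|[-> ->]] := drop_cases x k; have [h|h] := leP (x k) 0; nra.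
Qed.

Definition below H x (i : nat) : bool := draw x i < H.

Lemma stop_draw_le H c x k : 0 < H -> 0 <= c -> (forall i, `|x i| <= c) ->
  stop (below H x) (draw x) k <= H + c.
Proof.
move=> H0 c0 xc; have [j [jk -> gj _ _]] := stopP (below H x) (draw x) k.
case: j jk gj => [|j] jk gj; first by rewrite draw0; lra.
have := gj j (ltnSn _); rewrite /below drawS => h1.
have := xc j; rewrite ler_norml => /andP[h3 h4].
by have [[-> h]|[h ->]] := drop_cases x j; lra.
Qed.

Lemma massS x k : mass x k.+1 = mass x k * expR (- drop x k) + expR (- draw x k.+1).
Proof.
rewrite /mass big_ord_recr /=; congr (_ + _); last first.
  by congr expR; rewrite /draw opprB.
rewrite mulr_suml; apply: eq_bigr => i _; rewrite -expRD; congr expR.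
by rewrite rminS; ring.
Qed.

Lemma mass_ge0 x k : 0 <= mass x k.
Proof. by apply: sumr_ge0 => i _; exact: expR_ge0. Qed.

Lemma mass0 x : mass x 0 = 1.
Proof. by rewrite /mass big_ord1 /= psum0 subrr expR0. Qed.

(* Each step raises the conditional mean of [ly] by a multiple of
   [expR (- lam * draw)], so the sum of these terms over a stretch where [draw]
   stays bounded is controlled; by [lym_step] so is the mean of [lym], hence of
   [mass] at the end of a high climb. *)
Section Lyapunov.
Variables (c lam : R).
Hypotheses (c0 : 0 < c) (lam0 : 0 < lam) (lam1 : lam <= 1 / 2) (lamc : lam * c <= 1).

(** Chosen so that [kap * (expR (lam * u) - 1) <= u] whenever [lam * u <= 1]: what the exponential
    loses at a reflection by [u] is repaid by the push [u]. *)
Definition kap : R := expR (- 1) / lam.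
Definition ly x k : R := draw x k + kap * expR (- (lam * draw x k)).
(** Large enough that [u <= lya * (1 - expR (- u))] for [0 <= u <= c]: when the minimum falls by [u]
    the factor [expR (- u)] on the mass outweighs the push on [draw]. *)
Definition lya : R := expR c.
Definition lym x k : R := (draw x k + lya) * mass x k.
Definition lyC : R := (2 + lya) * expR 1.

Lemma kap_gt0 : 0 < kap. Proof. by rewrite /kap divr_gt0 // expR_gt0. Qed.

Lemma expR_sub1_le (t : R) : expR t - 1 <= t * expR t.
Proof.
have := expR_ge1Dx (- t); rewrite expRN => h.
have e0 := expR_gt0 t.
have : (1 - t) * expR t <= (expR t)^-1 * expR t by rewrite ler_wpM2r // ltW.
by rewrite mulVf ?gt_eqF // mulrBl mul1r; lra.
Qed.

Lemma expR_quad (y : R) : - 2 <= y -> 1 + y + y ^+ 2 / 4 <= expR y.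
Proof.
move=> y2; have -> : 1 + y + y ^+ 2 / 4 = (1 + y / 2) ^+ 2 by field.
have -> : expR y = expR (y / 2) ^+ 2 by rewrite -expRM_natl; congr expR; field.
apply: lerXn2r; rewrite ?nnegrE ?expR_ge0 //; first by lra.
exact: expR_ge1Dx.
Qed.

Lemma ly_step x k : (forall i, `|x i| <= c) ->
  ly x k + x k * (1 - kap * lam * expR (- (lam * draw x k))) +
    kap * lam ^+ 2 / 4 * (expR (- (lam * draw x k)) * x k ^+ 2) <= ly x k.+1.
Proof.
move=> xc; rewrite /ly; set D := draw x k; set X := x k; set u := drop x k.
have u0 : 0 <= u by exact: drop_ge0.
have uc : u <= c by apply: drop_le => //; exact: ltW.
have k0 := kap_gt0.
have XC : `|X| <= c := xc k.
have E0 := expR_gt0 (- (lam * D)).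
have Q : expR (- (lam * D)) * (1 - lam * X + (lam * X) ^+ 2 / 4) <= expR (- (lam * (D + X))).
  have -> : - (lam * (D + X)) = - (lam * D) + - (lam * X) by ring.
  rewrite expRD ler_wpM2l ?(ltW E0) //.
  have -> : 1 - lam * X + (lam * X) ^+ 2 / 4 = 1 + - (lam * X) + (- (lam * X)) ^+ 2 / 4 by ring.
  apply: expR_quad; move: XC; rewrite ler_norml => /andP[h1 h2].
  have lX : lam * X <= lam * c by rewrite ler_pM2l.
  apply: (@le_trans _ _ (- 1)); first by lra.
  by rewrite lerN2; exact: le_trans lX lamc.
have G : D + X + kap * expR (- (lam * (D + X))) <= draw x k.+1 + kap * expR (- (lam * draw x k.+1)).
  have [[E1 E2]|[E1 E2]] := drop_cases x k; first by rewrite E2.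
  rewrite E1 mulr0 oppr0 expR0 mulr1 add0r.
  have uE : u = - (D + X) by exact: E2.
  have -> : - (lam * (D + X)) = lam * u by rewrite uE; ring.
  have h := expR_sub1_le (lam * u).
  have lu : lam * u <= 1 by apply: le_trans lamc; rewrite ler_pM2l.
  have h2 : expR (lam * u) <= expR 1 by rewrite ler_expR.
  have h3 : kap * (expR (lam * u) - 1) <= u.
    apply: (@le_trans _ _ (kap * (lam * u * expR 1))).
      rewrite ler_pM2l //; apply: (le_trans h); rewrite ler_wpM2l // mulr_ge0 //; exact: ltW.
    rewrite /kap expRN; have e1 := expR_gt0 (1 : R).
    by rewrite le_eqVlt; apply/orP; left; apply/eqP; field; rewrite !gt_eqF.
  by lra.
apply: le_trans G.
have h := ler_wpM2l (ltW k0) Q.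
have -> : D + kap * expR (- (lam * D)) + X * (1 - kap * lam * expR (- (lam * D))) +
  kap * lam ^+ 2 / 4 * (expR (- (lam * D)) * X ^+ 2) =
  D + X + kap * (expR (- (lam * D)) * (1 - lam * X + (lam * X) ^+ 2 / 4)) by field.
by rewrite lerD2l.
Qed.

Lemma lym_step x k : (forall i, `|x i| <= c) ->
  lym x k.+1 <= lym x k + mass x k * x k + lyC * expR (- (lam * draw x k)).
Proof.
move=> xc; rewrite /lym massS mulrDr; set D := draw x k; set X := x k; set u := drop x k.
have u0 : 0 <= u by exact: drop_ge0.
have uc : u <= c by apply: drop_le => //; exact: ltW.
have D1 := draw_ge0 x k.+1; have L0 := mass_ge0 x k.
have a0 : 0 < lya := expR_gt0 c.
apply: lerD.
  rewrite mulrCA [leRHS](_ : _ = mass x k * (D + X + lya)); last by ring.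
  rewrite ler_wpM2l //.
  have [[E1 E2]|[E1 E2]] := drop_cases x k.
    by rewrite /u E1 oppr0 expR0 mulr1 E2.
  rewrite E1 add0r.
  have uE : D + X = - u by rewrite /u E2 opprK.
  rewrite uE.
  have h := expR_sub1_le u; have e0 := expR_gt0 u.
  have h2 : expR u <= lya by rewrite ler_expR.
  rewrite expRN.
  have h3 : u * lya^-1 <= u * (expR u)^-1 by rewrite ler_wpM2l // lef_pV2 ?posrE.
  have h4 : u / expR u <= 1 - (expR u)^-1.
    have := expR_ge1Dx u => h5.
    rewrite -(ler_pM2r e0) mulrBl !mulfVK ?gt_eqF // mul1r mulVf ?gt_eqF //; lra.
  have h5 : u <= lya * (1 - (expR u)^-1).
    rewrite -ler_pdivrMl // mulrC; exact: le_trans h3 h4.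
  by lra.
have h1 : (draw x k.+1 + lya) * expR (- draw x k.+1) <= (2 + lya) * expR (- (draw x k.+1 / 2)).
  set d := draw x k.+1 in D1 *.
  have -> : - d = - (d / 2) + - (d / 2) by field.
  rewrite expRD mulrA ler_wpM2r ?expR_ge0 // mulrDl; apply: lerD.
    have := expR_ge1Dx (d / 2); rewrite expRN => h.
    rewrite ler_pdivrMr ?expR_gt0 //; lra.
  rewrite ler_piMr ?(ltW a0) // -[leRHS]expR0 ler_expR; lra.
apply: (le_trans h1); rewrite /lyC -mulrA.
apply: ler_wpM2l; first by apply: addr_ge0 => //; exact: ltW.
rewrite -expRD ler_expR.
have h2 : D - c <= draw x k.+1.
  have := xc k; rewrite ler_norml drawS -/D -/u => /andP[h3 h4]; lra.
set d := draw x k.+1 in D1 h2 *.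
have h3 : lam * D <= lam * (d + c) by rewrite ler_pM2l //; lra.
have h4 : lam * d <= 1 / 2 * d by apply: ler_wpM2r.
have h5 : lam * D <= 1 / 2 * d + 1.
  by apply: (le_trans h3); rewrite mulrDr; apply: lerD.
by lra.
Qed.

End Lyapunov.

(* [z] is on while the path, having climbed by [N] above its running minimum
   (which was low enough), has neither gone below that minimum nor climbed by
   [7 * N]. *)
Section Stage.
Variables (N c : R) (x : nat -> R).
Hypotheses (c0 : 0 <= c) (cN : c < N) (xc : forall i, `|x i| <= c).

Fixpoint stage (k : nat) : bool :=
  match k with
  | 0 => false
  | k'.+1 => if alive (below N x) k'
             then [&& N <= draw x k'.+1, rmin x k'.+1 <= - (N / 2) & draw x k'.+1 < 7 * N]
             else [&& stage k', rmin x k' <= psum x k'.+1 & draw x k'.+1 < 7 * N]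
  end.

Fixpoint entered (k : nat) : bool :=
  match k with 0 => false | k'.+1 => entered k' || stage k'.+1 end.

Arguments stage : simpl never.
Arguments entered : simpl never.

Definition gain (k : nat) : R := \sum_(i < k) (stage i)%:R * x i.

Definition low_climb (b k : nat) : Prop :=
  [/\ (b <= k)%N, rmin x k = psum x b,
     forall i p, (i <= p <= b)%N -> psum x p - psum x i <= N,
     psum x b <= - (N / 2) & forall i, (i < k)%N -> draw x i < 7 * N].

Definition valley_path (k : nat) : Prop :=
  exists b l, [/\ (l <= k)%N, low_climb b l & 7 * N <= draw x l].

Lemma gainS k : gain k.+1 = gain k + (stage k)%:R * x k.
Proof. by rewrite /gain big_ord_recr. Qed.

(** While the stage is on, [gain] is the climb made since the entry, up to the overshoot [c]. A loss
    brings the path from height at least [N] to below the minimum, hence a gain of at most [- N].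
    The void case is a climb of [N] above a minimum that was not low enough. *)
Inductive stage_cases (k : nat) : Prop :=
| StageBefore of [/\ alive (below N x) k, stage k = false, entered k = false & gain k = 0]
| StageOn of [/\ ~~ alive (below N x) k, stage k, entered k,
    draw x k - N - c <= gain k <= draw x k - N &
    (exists b, low_climb b k) /\ draw x k < 7 * N]
| StageWon of [/\ ~~ alive (below N x) k, stage k = false, entered k,
    0 < gain k <= 6 * N + c & valley_path k]
| StageLost of [/\ ~~ alive (below N x) k, stage k = false, entered k & gain k <= - N]
| StageVoid of [/\ ~~ alive (below N x) k, stage k = false, entered k = false & gain k = 0].

Lemma stage_casesP k : stage_cases k.
Proof.
have c0' := c0; have cN' := cN; have N0 : 0 < N by lra.
elim: k => [|k IH].
  apply: StageBefore; split => //; last by rewrite /gain big_ord0.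
  by rewrite -[alive _ _]/(below N x 0) /below draw0.
have aS : alive (below N x) k.+1 = alive (below N x) k && (draw x k.+1 < N) by [].
have sS : stage k.+1 = if alive (below N x) k
             then [&& N <= draw x k.+1, rmin x k.+1 <= - (N / 2) & draw x k.+1 < 7 * N]
             else [&& stage k, rmin x k <= psum x k.+1 & draw x k.+1 < 7 * N] by [].
have eS : entered k.+1 = entered k || stage k.+1 by [].
have := xc k; rewrite ler_norml => /andP[xk1 xk2].
have dS := drawS x k.
have dr := drop_cases x k.
have rS := rminS x k.
case: IH.
- move=> [a s e g]; rewrite a /= in aS sS.
  have gE : gain k.+1 = 0 by rewrite gainS g s mul0r addr0.
  have dk : draw x k < N by move/aliveP: (a) => /(_ k (leqnn _)).
  have dk1 : draw x k.+1 <= N + c.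
    by case: dr => [[_ ->]|[-> _]]; lra.
  have [h|h] := ltP (draw x k.+1) N.
    apply: StageBefore; split; rewrite ?aS ?eS ?sS ?e //=.
      by rewrite leNgt h.
    by rewrite leNgt h.
  have h7 : draw x k.+1 < 7 * N by lra.
  rewrite h7 h /= andbT in sS.
  have na : ~~ alive (below N x) k.+1 by rewrite aS -leNgt.
  have [h2|h2] := boolP (rmin x k.+1 <= - (N / 2)); last first.
    by apply: StageVoid; split; rewrite ?eS ?sS ?e //= (negbTE h2).
  apply: StageOn; split; rewrite ?eS ?sS ?e ?h2 //=; first by apply/andP; split; lra.
  split => //; have [b bk bE] := rmin_arg x k.+1.
  have bk' : (b <= k)%N.
    rewrite leqNgt; apply/negP => kb; have E : b = k.+1 by apply/eqP; rewrite eqn_leq bk kb.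
    by move: h; rewrite /draw bE E subrr; lra.
  exists b; split => //.
  + move=> i p /andP[ip pb].
    have dp : draw x p < N by move/aliveP: (a); apply; exact: leq_trans pb bk'.
    by move: dp; rewrite /draw; have := rmin_le x ip; lra.
  + by rewrite -bE.
  + move=> i ik; have : draw x i < N by move/aliveP: (a); apply; rewrite -ltnS.
    by lra.
- move=> [a s e /andP[g1 g2] [[b [bk bE bc bl ba]] d7]].
  rewrite (negbTE a) s /= in sS; rewrite (negbTE a) /= in aS; rewrite e /= in eS.
  have gE : gain k.+1 = gain k + x k by rewrite gainS s mul1r.
  have na : ~~ alive (below N x) k.+1 by rewrite aS.
  have [h|h] := leP (rmin x k) (psum x k.+1); last first.
    apply: StageLost; split => //; first by rewrite sS leNgt h.
    rewrite gE; move: h; rewrite psumS; move: g2; rewrite /draw; lra.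
  have rk : rmin x k.+1 = rmin x k by rewrite -[LHS]/(Num.min _ _) min_l.
  have dk : draw x k.+1 = draw x k + x k by rewrite /draw rk psumS; ring.
  have lc : low_climb b k.+1.
    split => //; [exact: leqW|by rewrite rk|move=> i].
    by rewrite ltnS leq_eqVlt => /orP[/eqP ->//|]; exact: ba.
  rewrite h /= in sS.
  have [h7|h7] := ltP (draw x k.+1) (7 * N).
    apply: StageOn; split; rewrite ?sS ?h7 //; first by apply/andP; split; lra.
    by split; [exists b|].
  apply: StageWon; split => //.
  + by rewrite sS ltNge h7.
  + by apply/andP; split; lra.
  + by exists b, k.+1; split.
- move=> [a s e g [b [l [lk lc dl]]]]; rewrite (negbTE a) s /= in sS; rewrite (negbTE a) /= in aS.
  apply: StageWon; split; rewrite ?aS ?eS ?e //.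
    by rewrite gainS s mul0r addr0.
  by exists b, l; split => //; exact: leqW.
- move=> [a s e g]; rewrite (negbTE a) s /= in sS; rewrite (negbTE a) /= in aS.
  by apply: StageLost; split; rewrite ?aS ?eS ?e // gainS s mul0r addr0.
- move=> [a s e g]; rewrite (negbTE a) s /= in sS; rewrite (negbTE a) /= in aS.
  by apply: StageVoid; split; rewrite ?aS ?eS ?e ?sS // gainS s mul0r addr0.
Qed.

(** Until the path leaves the interval it spans less than [N], so [draw] has not reached [N]; when
    it later does, the minimum is at most [- (N / 2)]. *)
Lemma entered_from_exit k : ~~ alive (below N x) k ->
  (exists z, [/\ (z <= k)%N, psum x z <= - (N / 2) &
    forall i, (i < z)%N -> inside (N / 2) (N / 2) x i]) ->
  entered k.
Proof.
move=> na [z [zk hz hi]].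
have c0' := c0; have cN' := cN; have N0 : 0 < N by lra.
have min_low i : (i < z)%N -> - (N / 2) < rmin x i.
  move=> iz; have [b bi ->] := rmin_arg x i.
  by have /andP[] := hi b (leq_ltn_trans bi iz).
have az : alive (below N x) z.
  apply/aliveP => i; rewrite leq_eqVlt => /orP[/eqP ->|iz]; rewrite /below /draw.
    have [b bz ->] := rmin_arg x z.
    move: bz; rewrite leq_eqVlt => /orP[/eqP ->|bz]; first by rewrite subrr.
    by have /andP[h1 h2] := hi b bz; lra.
  by have /andP[h1 h2] := hi i iz; have := min_low i iz; lra.
elim: k na zk => [|k IH] na zk.
  by move: zk; rewrite leqn0 => /eqP zE; rewrite zE in az; rewrite az in na.
have aS : alive (below N x) k.+1 = alive (below N x) k && (draw x k.+1 < N) by [].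
have sS : stage k.+1 = if alive (below N x) k
           then [&& N <= draw x k.+1, rmin x k.+1 <= - (N / 2) & draw x k.+1 < 7 * N]
           else [&& stage k, rmin x k <= psum x k.+1 & draw x k.+1 < 7 * N] by [].
have -> : entered k.+1 = entered k || stage k.+1 by [].
have [ak|nak] := boolP (alive (below N x) k); last first.
  rewrite IH //; move: zk; rewrite leq_eqVlt => /orP[/eqP E|//].
  exfalso; move/negP: nak; apply; apply/aliveP => i ik; move/aliveP: az; apply; rewrite E; exact: leqW.
rewrite ak in sS; move: na; rewrite aS ak /= -leNgt => h; rewrite sS h /=.
have zk' : (z <= k)%N.
  move: zk; rewrite leq_eqVlt => /orP[/eqP E|//]; exfalso.
  by move/aliveP: az => /(_ k.+1); rewrite E => /(_ (leqnn _)); rewrite /below ltNge h.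
have dk : draw x k < N by move/aliveP: ak => /(_ k (leqnn _)).
have := xc k; rewrite ler_norml => /andP[xk1 xk2].
have h7 : draw x k.+1 < 7 * N by case: (drop_cases x k) => [[_ ->]|[-> _]]; lra.
rewrite h7 andbT.
have -> : rmin x k.+1 <= - (N / 2).
  by apply: le_trans hz; apply: rmin_le; exact: leqW.
by rewrite orbT.
Qed.

End Stage.
End Paths.

Lemma bmf_min d (T : measurableType d) (R : realType) (f g : T -> R) :
  bmf f -> bmf g -> bmf (fun x => Num.min (f x) (g x)).
Proof.
move=> [mf [C fC]] [mg [D gD]]; split; first exact: measurable_minr.
exists (C + D) => x; have := fC x; have := gD x; have := normr_ge0 (f x); have := normr_ge0 (g x).
by have [h|h] := leP (f x) (g x); lra.
Qed.

Lemma bmf_max d (T : measurableType d) (R : realType) (f g : T -> R) :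
  bmf f -> bmf g -> bmf (fun x => Num.max (f x) (g x)).
Proof.
move=> [mf [C fC]] [mg [D gD]]; split; first exact: measurable_maxr.
exists (C + D) => x; have := fC x; have := gD x; have := normr_ge0 (f x); have := normr_ge0 (g x).
by have [h|h] := leP (f x) (g x); lra.
Qed.

Lemma bmf_expR d (T : measurableType d) (R : realType) (f : T -> R) :
  bmf f -> bmf (fun x => expR (f x)).
Proof.
move=> [mf [C fC]]; split; first exact: measurableT_comp.
exists (expR C) => x; rewrite ger0_norm ?expR_ge0 // ler_expR.
exact: le_trans (ler_norm _) (fC x).
Qed.

(** * Martingale estimates along an exploration of the sites *)

Section RandomWalk.
Context d (Om : measurableType d) (R : realType) (P : probability Om R).
Variable om : int -> Om -> R.
Hypothesis mom : forall x, measurable_fun setT (om x).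
Hypothesis ind : mutually_independent P
  (fun x : int => process_sigma_algebra (fun _ : unit => om x)).

(* [J k] is the set of sites explored before step [k] and [S k] the set of
   those explored at that step. *)
Variables (J S : nat -> set int) (X : nat -> Om -> R) (cc s2 : R).
Hypotheses (JS : forall k, J k `<=` J k.+1) (SJ : forall k, S k `<=` J k.+1)
  (JSd : forall k x, J k x -> S k x -> False)
  (mX : forall k, @bmf _ (env_space om (S k)) R (X k))
  (Xcc : forall k w, `|X k w| <= cc)
  (EX : forall k, Ex P (X k) = 0) (EX2 : forall k, Ex P (fun w => X k w ^+ 2) = s2)
  (cc0 : 0 < cc) (s20 : 0 < s2).

Local Notation adp k f := (@bmf _ (env_space om (J k)) R f).
Local Notation madp k b := (measurable_fun (setT : set (env_space om (J k))) b).
Local Notation path w := (fun k : nat => X k w).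

Lemma J_mono k k' : (k <= k')%N -> J k `<=` J k'.
Proof. by move=> /subnK <-; elim: (k' - k)%N => // n IH x /IH /JS. Qed.

Lemma adp_mono k k' (f : Om -> R) : (k <= k')%N -> adp k f -> adp k' f.
Proof. by move=> kk; apply: bmf_env_mono; exact: J_mono. Qed.

Lemma madp_mono k k' (b : Om -> bool) : (k <= k')%N -> madp k b -> madp k' b.
Proof. by move=> kk; apply: env_fun_mono; exact: J_mono. Qed.

Lemma adp_bmf k (f : Om -> R) : adp k f -> @bmf _ Om R f.
Proof. exact: bmf_env_sub. Qed.

Lemma bmf_step k : @bmf _ Om R (X k).
Proof. exact: bmf_env_sub (mX k). Qed.

Lemma adp_bool k (b : Om -> bool) : madp k b -> adp k (fun w => (b w)%:R).
Proof. exact: bmf_bool. Qed.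

Lemma adp_step k : adp k.+1 (X k).
Proof. exact: bmf_env_mono (@SJ k) (mX k). Qed.

Lemma adp_psum k : adp k (fun w => psum (path w) k).
Proof.
elim: k => [|k IH].
  rewrite (_ : (fun w => _) = (fun=> 0)); first exact: bmf_cst.
  by apply/funext => w; rewrite psum0.
rewrite (_ : (fun w => _) = (fun w => psum (path w) k + X k w)).
  by apply: bmfD; [exact: adp_mono IH|exact: adp_step].
by apply/funext => w; rewrite psumS.
Qed.

Lemma adp_rmin k : adp k (fun w => rmin (path w) k).
Proof.
elim: k => [|k IH]; first exact: (bmf_cst _ 0).
by apply: bmf_min; [exact: adp_mono IH|exact: adp_psum].
Qed.

Lemma adp_draw k : adp k (fun w => draw (path w) k).
Proof. by apply: bmfB; [exact: adp_psum|exact: adp_rmin]. Qed.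

Lemma adp_mass k : adp k (fun w => mass (path w) k).
Proof.
apply: bmf_sum => i; apply: bmf_expR; apply: bmfB; first exact: adp_rmin.
by apply: (@adp_mono i); [rewrite -ltnS|exact: adp_psum].
Qed.

Lemma madp_alive (g : (nat -> R) -> nat -> bool) :
  (forall i, madp i (fun w => g (path w) i)) ->
  forall k, madp k (fun w => alive (g (path w)) k).
Proof.
move=> mg; elim=> [|k IH]; first exact: mg.
by apply: measurable_and; [exact: madp_mono IH|exact: mg].
Qed.

Lemma madp_inside h H i : madp i (fun w => inside h H (path w) i).
Proof.
have [mp _] := adp_psum i; apply: measurable_and; apply: measurable_fun_ltr => //;
  exact: measurable_cst.
Qed.

Lemma madp_below H i : madp i (fun w => below H (path w) i).
Proof.
have [mp _] := adp_draw i; apply: measurable_fun_ltr => //; exact: measurable_cst.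
Qed.

Lemma adp_stop (g : (nat -> R) -> nat -> bool) (Phi : (nat -> R) -> nat -> R) :
  (forall i, madp i (fun w => g (path w) i)) ->
  (forall i, adp i (fun w => Phi (path w) i)) ->
  forall k, adp k (fun w => stop (g (path w)) (Phi (path w)) k).
Proof.
move=> mg mP; elim=> [|k IH].
  rewrite (_ : (fun w => _) = (fun w => Phi (path w) 0%N)); first exact: mP.
  by apply/funext => w; rewrite /stop big_ord0 addr0.
rewrite (_ : (fun w => _) = (fun w => stop (g (path w)) (Phi (path w)) k +
  (alive (g (path w)) k)%:R * (Phi (path w) k.+1 - Phi (path w) k))).
  apply: bmfD; first exact: adp_mono IH.
  apply: bmfM; first by apply: (@adp_mono k) => //; apply: adp_bool; exact: madp_alive.
  by apply: bmfB; [exact: mP|exact: (@adp_mono k _ _ (leqnSn k) (mP k))].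
by apply/funext => w; rewrite stopS.
Qed.

Lemma Ex_step k A (phi : R -> R) : adp k A ->
  @bmf _ (env_space om (S k)) R (fun w => phi (X k w)) ->
  Ex P (fun w => A w * phi (X k w)) = Ex P A * Ex P (fun w => phi (X k w)).
Proof. by move=> mA mp; apply: (env_indep_Ex mom ind (@JSd k)). Qed.

Lemma Ex_mg k A : adp k A -> Ex P (fun w => A w * X k w) = 0.
Proof. by move=> mA; rewrite (@Ex_step k A id) // EX mulr0. Qed.

Lemma Ex_mg2 k A : adp k A -> Ex P (fun w => A w * X k w ^+ 2) = s2 * Ex P A.
Proof.
by move=> mA; rewrite (@Ex_step k A (fun y => y ^+ 2)) ?EX2 1?mulrC //; exact: bmfX.
Qed.

(** Lower bound for the second moment of the positive part of a step: zero mean and [|X| <= cc] give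
    the positive part a mean of at least [s2 / (2 * cc)], and the square is convex. *)
Definition s2p : R := (s2 / (2 * cc)) ^+ 2.

Lemma s2p_gt0 : 0 < s2p.
Proof. by rewrite /s2p exprn_gt0 // divr_gt0 // mulr_gt0. Qed.

Lemma bmf_posX k : @bmf _ (env_space om (S k)) R (fun w => Num.max (X k w) 0).
Proof. by apply: bmf_max => //; exact: bmf_cst. Qed.

Lemma Ex_pos_part k : s2p <= Ex P (fun w => Num.max (X k w) 0 ^+ 2).
Proof.
have bX := bmf_step k.
have bp : @bmf _ Om R (fun w => Num.max (X k w) 0) := bmf_env_sub mom (bmf_posX k).
set t := s2 / (2 * cc).
have t0 : 0 < t by rewrite divr_gt0 // mulr_gt0.
have h1 : t <= Ex P (fun w => Num.max (X k w) 0).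
  have -> : t = Ex P (fun w => (2 * cc)^-1 * X k w ^+ 2 + (1 / 2) * X k w).
    rewrite ExD ?ExZ ?EX ?EX2 ?mulr0 ?addr0 1?mulrC //; try exact: bmfX; apply: bmfZ => //; exact: bmfX.
  apply: Ex_le => //; first by apply: bmfD; apply: bmfZ => //; exact: bmfX.
  move=> w; have := Xcc k w; rewrite ler_norml => /andP[a1 a2].
  have c2 : 0 < 2 * cc by rewrite mulr_gt0.
  have h : (2 * cc)^-1 * X k w ^+ 2 <= 1 / 2 * `|X k w|.
    rewrite ler_pdivrMl // -real_normK ?num_real // expr2.
    have := normr_ge0 (X k w); have := Xcc k w; set u := `|_|; move=> *; nra.
  apply: le_trans (lerD h (lexx _)) _.
  by have [h'|h'] := leP (X k w) 0; [rewrite ler0_norm|rewrite gtr0_norm]; lra.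
have h2 : 2 * t * Ex P (fun w => Num.max (X k w) 0) - t ^+ 2 <= Ex P (fun w => Num.max (X k w) 0 ^+ 2).
  rewrite -ExZ // -Ex_subc; last exact: bmfZ.
  apply: Ex_le; [|exact: bmfX|].
    by apply: bmfB; [exact: bmfZ|exact: bmf_cst].
  by move=> w; have := sqr_ge0 (Num.max (X k w) 0 - t); nra.
by apply: le_trans h2; rewrite /s2p -/t; nra.
Qed.

Lemma Ex_mgp k A : adp k A -> (forall w, 0 <= A w) ->
  s2p * Ex P A <= Ex P (fun w => A w * Num.max (X k w) 0 ^+ 2).
Proof.
move=> mA A0; rewrite (@Ex_step k A (fun y => Num.max y 0 ^+ 2)) //; last first.
  by apply: bmfX; exact: bmf_posX.
by rewrite mulrC ler_wpM2l ?Ex_ge0 // Ex_pos_part.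
Qed.

Lemma Ex_stop (g : (nat -> R) -> nat -> bool) (Phi : (nat -> R) -> nat -> R) k a :
  (forall i, madp i (fun w => g (path w) i)) ->
  (forall i, adp i (fun w => Phi (path w) i)) ->
  (forall w, Phi (path w) 0%N = a) ->
  Ex P (fun w => stop (g (path w)) (Phi (path w)) k) =
  a + \sum_(i < k) Ex P (fun w => (alive (g (path w)) i)%:R *
     (Phi (path w) i.+1 - Phi (path w) i)).
Proof.
move=> mg mP P0.
have b (i : 'I_k) : @bmf _ Om R (fun w => (alive (g (path w)) i)%:R *
     (Phi (path w) i.+1 - Phi (path w) i)).
  apply: (@adp_bmf i.+1); apply: bmfM.
    by apply: (@adp_mono i) => //; apply: adp_bool; exact: madp_alive.
  by apply: bmfB; [exact: mP|exact: (@adp_mono i _ _ (leqnSn i) (mP i))].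
rewrite -Ex_sum // -[X in X + _](Ex_cst P) -ExD //.
- by apply: eq_Ex => w; rewrite /stop P0.
- exact: bmf_cst.
- exact: bmf_sum.
Qed.

Lemma alive_antitone (g : (nat -> R) -> nat -> bool) i k :
  (forall i, madp i (fun w => g (path w) i)) -> (i <= k)%N ->
  Ex P (fun w => (alive (g (path w)) k)%:R) <= Ex P (fun w => (alive (g (path w)) i)%:R).
Proof.
move=> mg ik; apply: Ex_le.
- by apply: (@adp_bmf k); apply: adp_bool; exact: madp_alive.
- by apply: (@adp_bmf i); apply: adp_bool; exact: madp_alive.
move=> w; case: (boolP (alive _ k)) => // ak.
have -> // : alive (g (path w)) i.
by apply/aliveP => j ji; move/aliveP: ak; apply; exact: leq_trans ji ik.
Qed.

Lemma alive_sum_ge (g : (nat -> R) -> nat -> bool) k :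
  (forall i, madp i (fun w => g (path w) i)) ->
  k%:R * Ex P (fun w => (alive (g (path w)) k)%:R) <=
  \sum_(i < k) Ex P (fun w => (alive (g (path w)) i)%:R).
Proof.
move=> mg; rewrite mulr_natl -[X in _ *+ X]card_ord -sumr_const.
by apply: ler_sum => i _; apply: alive_antitone => //; exact: ltnW.
Qed.

Section Exit.
Variables (h H : R) (k : nat).
Hypotheses (h0 : 0 < h) (H0 : 0 < H) (k0 : (0 < k)%N).

Local Notation al w i := (alive (inside h H (path w)) i).
Local Notation st w := (stop (inside h H (path w)) (psum (path w)) k).

Lemma exit_mean : Ex P (fun w => st w) = 0.
Proof.
rewrite (@Ex_stop _ _ _ 0).
- rewrite add0r big1 // => i _.
  rewrite -[RHS](Ex_mg (A := fun w => (al w i)%:R) (k := i)).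
    by apply: eq_Ex => w; rewrite psumS [psum _ _ + _]addrC addrK.
  by apply: adp_bool; apply: madp_alive => j; exact: madp_inside.
- by move=> i; exact: madp_inside.
- by move=> i; exact: adp_psum.
- by move=> w; rewrite psum0.
Qed.

(** The stopped square gains [s2] in mean per step before the exit and stays bounded; the
    probability of being still inside decreases in time. *)
Lemma exit_time : s2 * k%:R * Ex P (fun w => (al w k)%:R) <= (H + h + cc) ^+ 2.
Proof.
have bst := adp_bmf (@adp_stop (inside h H) (@psum R) (madp_inside h H) adp_psum k).
apply: (@le_trans _ _ (Ex P (fun w => st w ^+ 2))); last first.
  rewrite -[leRHS](Ex_cst P); apply: Ex_le; [exact: bmfX|exact: bmf_cst|move=> w].
  have := @stop_psum_bounds R h H cc (path w) k h0 H0 (ltW cc0) (fun i => Xcc i w).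
  by move: h0 H0 cc0 => h0' H0' c0' /andP[a1 a2]; nra.
have -> : Ex P (fun w => st w ^+ 2) =
    Ex P (fun w => stop (inside h H (path w)) (fun i => psum (path w) i ^+ 2) k).
  by apply: eq_Ex => w; rewrite stop_sqr // psum0.
rewrite (@Ex_stop (inside h H) (fun x i => psum x i ^+ 2) k 0).
- rewrite add0r -mulrA.
  apply: le_trans (ler_wpM2l (ltW s20) (@alive_sum_ge (inside h H) k (madp_inside h H))) _.
  rewrite mulr_sumr; apply: ler_sum => i _.
  have ma : adp i (fun w => (al w i)%:R).
    by apply: adp_bool; apply: madp_alive => j; exact: madp_inside.
  have mb : adp i (fun w => (al w i)%:R * (2 * psum (path w) i)).
    by apply: bmfM => //; apply: bmfZ; exact: adp_psum.
  rewrite -(Ex_mg2 ma) -[leLHS]add0r -(Ex_mg mb) -ExD.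
  - rewrite le_eqVlt; apply/orP; left; apply/eqP/eq_Ex => w; rewrite psumS; ring.
  - by apply: bmfM; [exact: adp_bmf mb|exact: bmf_step].
  - by apply: bmfM; [exact: adp_bmf ma|apply: bmfX; exact: bmf_step].
- by move=> i; exact: madp_inside.
- by move=> i; apply: bmfX; exact: adp_psum.
- by move=> w; rewrite psum0 expr0n.
Qed.

Definition exit_fail w : bool := al w k || (H <= st w).

Lemma madp_exit_fail : madp k exit_fail.
Proof.
apply: measurable_or; first by apply: madp_alive => i; exact: madp_inside.
have [ms _] := @adp_stop (inside h H) (@psum R) (madp_inside h H) adp_psum k.
by apply: measurable_fun_ler => //; exact: measurable_cst.
Qed.

Lemma exit_failP w : ~~ exit_fail w ->
  exists z, [/\ (z <= k)%N, psum (path w) z <= - h,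
    forall i, (i < z)%N -> inside h H (path w) i &
    forall i, (i <= z)%N -> psum (path w) i <= H].
Proof. by rewrite /exit_fail negb_or -ltNge => /andP[a b]; exact: exit_down. Qed.

(** The stopped sum has mean zero and overshoots by at most [cc], which gives the gambler's ruin
    term; [exit_time] bounds the chance of not having left by step [k]. *)
Lemma exit_fail_prob :
  Ex P (fun w => (exit_fail w)%:R) <=
  (h + cc) / (H + h + cc) + (H + h + cc) ^+ 2 / (s2 * k%:R).
Proof.
have bst := adp_bmf (@adp_stop (inside h H) (@psum R) (madp_inside h H) adp_psum k).
have mal : madp k (fun w => al w k) by apply: madp_alive => i; exact: madp_inside.
have mtop : madp k (fun w => H <= st w).
  have [ms _] := @adp_stop (inside h H) (@psum R) (madp_inside h H) adp_psum k.
  by apply: measurable_fun_ler => //; exact: measurable_cst.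
have bal := adp_bmf (adp_bool mal); have btop := adp_bmf (adp_bool mtop).
have Hc : 0 < H + h + cc by rewrite !addr_gt0.
have kR : (0 : R) < k%:R by rewrite ltr0n.
apply: (@le_trans _ _ (Ex P (fun w => (H <= st w)%R%:R) + Ex P (fun w => (al w k)%:R))).
  rewrite -ExD //; apply: Ex_le.
  - exact: adp_bmf (adp_bool madp_exit_fail).
  - exact: bmfD.
  - by move=> w; rewrite /exit_fail; case: (al w k); case: (H <= st w) => /=; lra.
apply: lerD.
  rewrite ler_pdivlMr // mulrC.
  have : Ex P (fun w => (H + h + cc) * (H <= st w)%R%:R - (h + cc)) <= Ex P (fun w => st w).
    apply: Ex_le => //; first by apply: bmfB; [exact: bmfZ|exact: bmf_cst].
    move=> w; have /andP[a1 a2] := @stop_psum_bounds R h H cc (path w) k h0 H0 (ltW cc0) (fun i => Xcc i w).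
    by case: (leP H (st w)) => a3 /=; lra.
  by rewrite exit_mean Ex_subc ?ExZ; [lra| |exact: bmfZ].
rewrite ler_pdivlMr ?mulr_gt0 // mulrC; exact: exit_time.
Qed.

End Exit.

(** Same argument as [exit_time] with the square of [draw], whose mean gain per step is at least
    [s2p] by [draw_sqr]. *)
Lemma below_time H k : 0 < H ->
  s2p * k%:R * Ex P (fun w => (alive (below H (path w)) k)%:R) <= (H + cc) ^+ 2.
Proof.
move=> H0.
have bst := adp_bmf (@adp_stop (below H) (@draw R) (madp_below H) adp_draw k).
apply: (@le_trans _ _ (Ex P (fun w => stop (below H (path w)) (draw (path w)) k ^+ 2))); last first.
  rewrite -[leRHS](Ex_cst P); apply: Ex_le; [exact: bmfX|exact: bmf_cst|move=> w].
  have h1 := @stop_draw_le R H cc (path w) k H0 (ltW cc0) (fun i => Xcc i w).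
  have h2 : 0 <= stop (below H (path w)) (draw (path w)) k.
    by have [j [_ -> _ _ _]] := stopP (below H (path w)) (draw (path w)) k; exact: draw_ge0.
  by apply: lerXn2r => //; rewrite nnegrE // addr_ge0 // ltW.
have -> : Ex P (fun w => stop (below H (path w)) (draw (path w)) k ^+ 2) =
    Ex P (fun w => stop (below H (path w)) (fun i => draw (path w) i ^+ 2) k).
  by apply: eq_Ex => w; rewrite stop_sqr // draw0.
rewrite (@Ex_stop (below H) (fun x i => draw x i ^+ 2) k 0).
- rewrite add0r -mulrA.
  apply: le_trans (ler_wpM2l (ltW s2p_gt0) (@alive_sum_ge (below H) k (madp_below H))) _.
  rewrite mulr_sumr; apply: ler_sum => i _.
  have ma : adp i (fun w => (alive (below H (path w)) i)%:R).
    by apply: adp_bool; apply: madp_alive => j; exact: madp_below.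
  have mb : adp i (fun w => (alive (below H (path w)) i)%:R * (2 * draw (path w) i)).
    by apply: bmfM => //; apply: bmfZ; exact: adp_draw.
  have mp : @bmf _ Om R (fun w => Num.max (X i w) 0) := bmf_env_sub mom (bmf_posX i).
  have ma' := adp_bmf ma; have mb' := adp_bmf mb; have bX := bmf_step i.
  apply: (le_trans (Ex_mgp ma _)) => [w|]; first by rewrite ler0n.
  rewrite -[leLHS]add0r -[X in X + Ex _ _](Ex_mg mb) -ExD; first last.
  + by apply: bmfM => //; exact: bmfX.
  + exact: bmfM.
  apply: Ex_le.
  + by apply: bmfD; apply: bmfM => //; exact: bmfX.
  + apply: bmfM => //; apply: bmfB; apply: bmfX; [exact: adp_bmf (adp_draw i.+1)|exact: adp_bmf (adp_draw i)].
  + move=> w; rewrite -mulrA -mulrDr; apply: ler_wpM2l; first exact: ler0n.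
    by have := draw_sqr (path w) i; lra.
- by move=> i; exact: madp_below.
- by move=> i; apply: bmfX; exact: adp_draw.
- by move=> w; rewrite draw0 expr0n.
Qed.

Section Mass.
Variables (lam H : R).
Hypotheses (lam0 : 0 < lam) (lam1 : lam <= 1 / 2) (lamc : lam * cc <= 1) (H0 : 0 < H).

Local Notation al w i := (alive (below H (path w)) i).

Lemma adp_damp i : adp i (fun w => expR (- (lam * draw (path w) i))).
Proof. by apply: bmf_expR; apply: bmfN; apply: bmfZ; exact: adp_draw. Qed.

Lemma adp_ly i : adp i (fun w => ly lam (path w) i).
Proof. by apply: bmfD; [exact: adp_draw|apply: bmfZ; exact: adp_damp]. Qed.

Lemma adp_lym i : adp i (fun w => lym cc (path w) i).
Proof.
by apply: bmfM; [apply: bmfD; [exact: adp_draw|exact: bmf_cst]|exact: adp_mass].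
Qed.

Lemma damp_sum k :
  kap lam * lam ^+ 2 / 4 * s2 *
    \sum_(i < k) Ex P (fun w => (al w i)%:R * expR (- (lam * draw (path w) i))) <= H + cc.
Proof.
have kp := @kap_gt0 R lam lam0.
have mg := @madp_below H; have mP := adp_ly.
have E := @Ex_stop (below H) (ly lam) k (kap lam) mg mP.
have /E {}E w : ly lam (path w) 0 = kap lam.
  by rewrite /ly draw0 mulr0 oppr0 expR0 mulr1 add0r.
have U : Ex P (fun w => stop (below H (path w)) (ly lam (path w)) k) <= H + cc + kap lam.
  rewrite -[leRHS](Ex_cst P); apply: Ex_le.
  - exact: adp_bmf (adp_stop mg mP k).
  - exact: bmf_cst.
  move=> w; have h1 := @stop_draw_le R H cc (path w) k H0 (ltW cc0) (fun i => Xcc i w).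
  have [j [_ E1 gj dj a]] := stopP (below H (path w)) (draw (path w)) k.
  have [j' [_ -> gj' dj' a']] := stopP (below H (path w)) (ly lam (path w)) k.
  (* Both stopped processes stop at the same index, the first failure of [below H]. *)
  have jj : j' = j.
    have [ak|nak] := boolP (alive (below H (path w)) k); first by rewrite a // a'.
    move: dj dj'; rewrite (negbTE nak) /= => dj dj'.
    have [h|h|//] := ltngtP j' j; first by rewrite (gj _ h) in dj'.
    by rewrite (gj' _ h) in dj.
  rewrite jj /ly; apply: lerD; first by rewrite -E1.
  rewrite ler_piMr ?(ltW kp) // -[leRHS]expR0 ler_expR oppr_le0 mulr_ge0 ?draw_ge0 //; exact: ltW.
rewrite E in U.
suff : kap lam * lam ^+ 2 / 4 * s2 *
    \sum_(i < k) Ex P (fun w => (al w i)%:R * expR (- (lam * draw (path w) i))) <=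
    \sum_(i < k) Ex P (fun w => (al w i)%:R * (ly lam (path w) i.+1 - ly lam (path w) i)) by lra.
rewrite mulr_sumr; apply: ler_sum => i _.
have ma : adp i (fun w => (al w i)%:R).
  by apply: adp_bool; apply: madp_alive => j; exact: madp_below.
have md := adp_damp i.
have me : adp i (fun w => (al w i)%:R * expR (- (lam * draw (path w) i))) by exact: bmfM.
have mb : adp i (fun w => (al w i)%:R * (1 - kap lam * lam * expR (- (lam * draw (path w) i)))).
  by apply: bmfM => //; apply: bmfB; [exact: bmf_cst|exact: bmfZ].
have bX := bmf_step i.
have me' := adp_bmf me; have mb' := adp_bmf mb; have ma' := adp_bmf ma.
have bX2 : @bmf _ Om R (fun w => X i w ^+ 2) by exact: bmfX.
rewrite -mulrA -(Ex_mg2 me) -ExZ; last exact: bmfM.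
rewrite -[leLHS]add0r -(Ex_mg mb) -ExD; [|exact: bmfM|by apply: bmfZ; exact: bmfM].
apply: Ex_le.
- by apply: bmfD; [exact: bmfM|apply: bmfZ; exact: bmfM].
- by apply: bmfM => //; apply: bmfB; [exact: adp_bmf (adp_ly i.+1)|exact: adp_bmf (adp_ly i)].
move=> w; have h := @ly_step R cc lam cc0 lam0 lamc (path w) i (fun i => Xcc i w).
case: (al w i); rewrite ?mul0r ?mulr0 ?addr0 // !mul1r.
have {}h : ly lam (path w) i + (X i w * (1 - kap lam * lam * expR (- (lam * draw (path w) i)))) +
  kap lam * lam ^+ 2 / 4 * (expR (- (lam * draw (path w) i)) * X i w ^+ 2) <= ly lam (path w) i.+1 by [].
by move: h; set u := X i w * _; set v := kap lam * _ / 4 * _; rewrite [_ * X i w]mulrC -/u; lra.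
Qed.

(** Affine in [H]. Since [lym] is at least [H * mass] once [draw] has reached [H], Markov's
    inequality bounds the mass at the end of the climb uniformly in [H]. *)
Definition lym_bound : R := lya cc + lyC cc * ((H + cc) / (kap lam * lam ^+ 2 / 4 * s2)).

Lemma Ex_lym k : Ex P (fun w => stop (below H (path w)) (lym cc (path w)) k) <= lym_bound.
Proof.
have kp := @kap_gt0 R lam lam0.
have mg := @madp_below H; have mP := adp_lym.
rewrite (@Ex_stop (below H) (lym cc) k (lya cc) mg mP); last first.
  by move=> w; rewrite /lym draw0 add0r mass0 mulr1.
rewrite /lym_bound lerD2l.
have q0 : 0 < kap lam * lam ^+ 2 / 4 * s2 by rewrite mulr_gt0 // divr_gt0 // mulr_gt0 // exprn_gt0.
have C0 : 0 <= lyC cc by rewrite /lyC mulr_ge0 ?expR_ge0 // addr_ge0 // expR_ge0.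
apply: (@le_trans _ _ (lyC cc * \sum_(i < k) Ex P (fun w => (al w i)%:R * expR (- (lam * draw (path w) i))))); last first.
  by rewrite ler_wpM2l // ler_pdivlMr // mulrC damp_sum.
rewrite mulr_sumr; apply: ler_sum => i _.
have ma : adp i (fun w => (al w i)%:R).
  by apply: adp_bool; apply: madp_alive => j; exact: madp_below.
have md := adp_damp i.
have me : adp i (fun w => (al w i)%:R * expR (- (lam * draw (path w) i))) by exact: bmfM.
have mb : adp i (fun w => (al w i)%:R * mass (path w) i) by apply: bmfM => //; exact: adp_mass.
have bX := bmf_step i.
have me' := adp_bmf me; have mb' := adp_bmf mb; have ma' := adp_bmf ma.
rewrite -ExZ // -[leRHS]add0r -(Ex_mg mb) -ExD; [|exact: bmfM|exact: bmfZ].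
apply: Ex_le.
- by apply: bmfM => //; apply: bmfB; [exact: adp_bmf (adp_lym i.+1)|exact: adp_bmf (adp_lym i)].
- by apply: bmfD; [exact: bmfM|exact: bmfZ].
move=> w; have h := @lym_step R cc lam cc0 lam0 lam1 lamc (path w) i (fun i => Xcc i w).
case: (al w i); rewrite ?mul0r ?mulr0 ?addr0 // !mul1r.
have {}h : lym cc (path w) i.+1 <= lym cc (path w) i + mass (path w) i * X i w +
  lyC cc * expR (- (lam * draw (path w) i)) by exact: h.
by move: h; set u := mass _ _ * _; set v := lyC cc * _; lra.
Qed.

End Mass.

Section RightValley.
Variables (N lam C : R) (K : nat).
Hypotheses (cN : cc < N) (lam0 : 0 < lam) (lam1 : lam <= 1 / 2) (lamc : lam * cc <= 1)
  (K0 : (0 < K)%N).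

Lemma madp_stage k : madp k (fun w => stage N (path w) k).
Proof.
elim: k => [|k IH]; first exact: measurable_cst.
have [mr _] := adp_rmin k.+1; have [mr' _] := adp_mono (leqnSn k) (adp_rmin k).
have [md _] := adp_draw k.+1; have [mp _] := adp_psum k.+1.
rewrite (_ : (fun w => _) = (fun w => if alive (below N (path w)) k
   then [&& N <= draw (path w) k.+1, rmin (path w) k.+1 <= - (N / 2) & draw (path w) k.+1 < 7 * N]
   else [&& stage N (path w) k, rmin (path w) k <= psum (path w) k.+1 & draw (path w) k.+1 < 7 * N])) //.
apply: measurable_fun_ifT.
- by apply: (@madp_mono k) => //; apply: madp_alive => j; exact: madp_below.
- apply: measurable_and; first by apply: measurable_fun_ler => //; exact: measurable_cst.
  apply: measurable_and; first by apply: measurable_fun_ler => //; exact: measurable_cst.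
  by apply: measurable_fun_ltr => //; exact: measurable_cst.
- apply: measurable_and; first exact: madp_mono IH.
  apply: measurable_and; first exact: measurable_fun_ler.
  by apply: measurable_fun_ltr => //; exact: measurable_cst.
Qed.

Lemma madp_entered k : madp k (fun w => entered N (path w) k).
Proof.
elim: k => [|k IH]; first exact: measurable_cst.
by apply: measurable_or; [exact: madp_mono IH|exact: madp_stage].
Qed.

Lemma adp_gain k : adp k (fun w => gain N (path w) k).
Proof.
elim: k => [|k IH].
  rewrite (_ : (fun w => _) = (fun=> 0)); first exact: bmf_cst.
  by apply/funext => w; rewrite /gain big_ord0.
rewrite (_ : (fun w => _) = (fun w => gain N (path w) k + (stage N (path w) k)%:R * X k w)).
  apply: bmfD; first exact: adp_mono IH.
  apply: bmfM; last exact: adp_step.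
  by apply: (@adp_mono k) => //; apply: adp_bool; exact: madp_stage.
by apply/funext => w; rewrite gainS.
Qed.

Lemma Ex_gain k : Ex P (fun w => gain N (path w) k) = 0.
Proof.
elim: k => [|k IH].
  by rewrite -[RHS](Ex_cst P); apply: eq_Ex => w; rewrite /gain big_ord0.
have ma : adp k (fun w => (stage N (path w) k)%:R) by apply: adp_bool; exact: madp_stage.
have -> : Ex P (fun w => gain N (path w) k.+1) =
    Ex P (fun w => gain N (path w) k + (stage N (path w) k)%:R * X k w).
  by apply: eq_Ex => w; rewrite gainS.
rewrite ExD; first by rewrite IH Ex_mg // addr0.
- exact: adp_bmf (adp_gain k).
- by apply: bmfM; [exact: adp_bmf ma|exact: bmf_step].
Qed.

Definition won w : bool :=
  [&& ~~ stage N (path w) K, entered N (path w) K & 0 < gain N (path w) K].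

Lemma madp_won : madp K won.
Proof.
apply: measurable_and; first by apply: measurable_neg; exact: madp_stage.
apply: measurable_and; first exact: madp_entered.
by have [mg _] := adp_gain K; apply: measurable_fun_ltr => //; exact: measurable_cst.
Qed.

(* [gain] is a martingale transform, so its mean is zero: a stage that is often
   entered must be won with positive probability. *)
Lemma gain_le w : gain N (path w) K <= (7 * N + cc) * (won w)%:R +
  (7 * N) * (stage N (path w) K)%:R - N * (entered N (path w) K)%:R.
Proof.
have c0 := ltW cc0; have cN' := cN.
rewrite /won; case: (stage_casesP c0 cN' (fun i => Xcc i w) K).
- by move=> [_ -> -> ->]; rewrite /= ?ltxx; lra.
- by move=> [_ -> -> /andP[_ h] [_ h']]; rewrite /=; lra.
- by move=> [_ -> -> /andP[-> h] _]; rewrite /=; lra.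
- move=> [_ -> -> h]; rewrite /=; have -> : (0 < gain N (path w) K) = false by apply/negbTE; rewrite -leNgt; lra.
  by rewrite /=; lra.
- by move=> [_ -> -> ->]; rewrite /= ?ltxx; lra.
Qed.

Lemma stage_alive w : stage N (path w) K -> alive (below (7 * N) (path w)) K.
Proof.
have c0 := ltW cc0; have cN' := cN; move=> st.
case: (stage_casesP c0 cN' (fun i => Xcc i w) K).
- by move=> [_ h]; rewrite st in h.
- move=> [_ _ _ _ [[b [_ _ _ _ ba]] d7]]; apply/aliveP => i.
  by rewrite leq_eqVlt => /orP[/eqP ->//|]; exact: ba.
- by move=> [_ h]; rewrite st in h.
- by move=> [_ h]; rewrite st in h.
- by move=> [_ h]; rewrite st in h.
Qed.

(** The terms bound the probabilities of leaving the interval between [- N / 2] and [N / 2] through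
    the top, of not leaving it by step [K], and of [draw] staying below [N] up to step [K]. *)
Definition entry_fail : R := (N / 2 + cc) / (N + cc) + (N + cc) ^+ 2 / (s2 * K%:R) +
  (N + cc) ^+ 2 / (s2p * K%:R).

Lemma entered_prob : 1 - entry_fail <= Ex P (fun w => (entered N (path w) K)%:R).
Proof.
have c0 := cc0; have cN' := cN; have N0 : 0 < N by lra.
have N2 : 0 < N / 2 by lra.
have h1 := @exit_fail_prob _ _ K N2 N2 K0; have h2 := @below_time N K N0.
rewrite (_ : N / 2 + N / 2 = N) in h1; last by field.
have KR : (0 : R) < K%:R by rewrite ltr0n.
rewrite mulrC -ler_pdivlMr in h2; last by rewrite mulr_gt0 // s2p_gt0.
have b1 := adp_bmf (adp_bool (@madp_exit_fail (N / 2) (N / 2) K)).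
have ma : madp K (fun w => alive (below N (path w)) K) by apply: madp_alive => j; exact: madp_below.
have b2 := adp_bmf (adp_bool ma).
have b3 := adp_bmf (adp_bool (@madp_entered K)).
have : Ex P (fun=> 1) <= Ex P (fun w => (entered N (path w) K)%:R +
   ((exit_fail (N / 2) (N / 2) K w)%:R + (alive (below N (path w)) K)%:R)).
  apply: Ex_le; [exact: bmf_cst|by apply: bmfD => //; exact: bmfD|move=> w].
  case: (boolP (exit_fail _ _ _ _)) => ef; first by have := ler0n R (entered N (path w) K); have := ler0n R (alive (below N (path w)) K); rewrite /=; lra.
  case: (boolP (alive _ _)) => al; first by have := ler0n R (entered N (path w) K); rewrite /=; lra.
  rewrite (entered_from_exit (ltW cc0) cN' (fun i => Xcc i w)) //=; first by lra.
  by have [z [z1 z2 z3 _]] := exit_failP N2 N2 ef; exists z; split.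
by rewrite Ex_cst ExD ?ExD ?/entry_fail //; [lra|exact: bmfD].
Qed.

Definition right_valley x : Prop := exists b l,
  [/\ (l <= K)%N, low_climb N x b l, 7 * N <= draw x l & mass x l <= C].

Definition right_good w : bool :=
  won w && (stop (below (7 * N) (path w)) (lym cc (path w)) K < 7 * N * C).

Lemma madp_right_good : madp K right_good.
Proof.
apply: measurable_and; first exact: madp_won.
have [ms _] := adp_stop (@madp_below (7 * N)) adp_lym K.
by apply: measurable_fun_ltr => //; exact: measurable_cst.
Qed.

Lemma right_goodP w : right_good w -> right_valley (path w).
Proof.
have c0 := cc0; have cN' := cN; have N0 : 0 < N by lra.
move=> /andP[/and3P[ns en g0] sl].
case: (stage_casesP (ltW c0) cN' (fun i => Xcc i w) K).
- by move=> [_ _ _ E]; rewrite E ltxx in g0.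
- by move=> [_ h]; rewrite h in ns.
- move=> [_ _ _ _ [b [l [lK lc dl]]]]; exists b, l; split => //.
  have [j [jK E gj dj a]] := stopP (below (7 * N) (path w)) (lym cc (path w)) K.
  have [_ _ _ _ ba] := lc.
  have jl : j = l.
    have nal : ~~ alive (below (7 * N) (path w)) K.
      by apply/negP => /aliveP /(_ l lK); rewrite /below ltNge dl.
    move: dj; rewrite (negbTE nal) /= => dj.
    have [h|h|//] := ltngtP j l; first by rewrite /below (ba _ h) in dj.
    by have := gj _ h; rewrite /below ltNge dl.
  rewrite E jl /lym in sl.
  have N7 : 0 < 7 * N by lra.
  rewrite -(ler_pM2l N7); apply: le_trans (ltW sl); apply: ler_wpM2r; first exact: mass_ge0.
  by rewrite /lya; have := expR_ge0 cc; lra.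
- by move=> [_ _ _ h]; exfalso; lra.
- by move=> [_ _ _ E]; rewrite E ltxx in g0.
Qed.

(** Taking means in [gain_le] bounds the probability of [won] from below; the paths with a large
    [lym] at the end of the climb are then removed by Markov's inequality. *)
Lemma right_good_prob : 0 < C ->
  (N * (1 - entry_fail) - 7 * N * ((7 * N + cc) ^+ 2 / (s2p * K%:R))) / (7 * N + cc) -
    lym_bound lam (7 * N) / (7 * N * C) <= Ex P (fun w => (right_good w)%:R).
Proof.
move=> C0; have c0 := cc0; have cN' := cN; have N0 : 0 < N by lra.
have KR : (0 : R) < K%:R by rewrite ltr0n.
have N7 : 0 < 7 * N by lra.
have bw := adp_bmf (adp_bool madp_won).
have bs := adp_bmf (adp_bool (@madp_stage K)).
have be := adp_bmf (adp_bool (@madp_entered K)).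
have bg := adp_bmf (adp_bool madp_right_good).
have bl := adp_bmf (adp_stop (@madp_below (7 * N)) adp_lym K).
have ma : madp K (fun w => alive (below (7 * N) (path w)) K) by apply: madp_alive => j; exact: madp_below.
have h1 : Ex P (fun w => (stage N (path w) K)%:R) <= (7 * N + cc) ^+ 2 / (s2p * K%:R).
  apply: (@le_trans _ _ (Ex P (fun w => (alive (below (7 * N) (path w)) K)%:R))).
    apply: Ex_le => //; first exact: adp_bmf (adp_bool ma).
    by move=> w; case: (boolP (stage _ _ _)) => // /stage_alive ->.
  have sK : 0 < s2p * K%:R by rewrite mulr_gt0 // s2p_gt0.
  by rewrite ler_pdivlMr // [leLHS]mulrC; exact: below_time.
have h2 := entered_prob.
have h3 : 0 <= (7 * N + cc) * Ex P (fun w => (won w)%:R) +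
   7 * N * Ex P (fun w => (stage N (path w) K)%:R) - N * Ex P (fun w => (entered N (path w) K)%:R).
  have bw' : @bmf _ Om R (fun w => (7 * N + cc) * (won w)%:R) by exact: bmfZ.
  have bs' : @bmf _ Om R (fun w => 7 * N * (stage N (path w) K)%:R) by exact: bmfZ.
  have be' : @bmf _ Om R (fun w => N * (entered N (path w) K)%:R) by exact: bmfZ.
  have := Ex_le P (adp_bmf (adp_gain K)) (bmfB (bmfD bw' bs') be') gain_le.
  by rewrite Ex_gain ExB ?ExD ?ExZ //; exact: bmfD.
have h4 : (N * (1 - entry_fail) - 7 * N * ((7 * N + cc) ^+ 2 / (s2p * K%:R))) / (7 * N + cc) <=
    Ex P (fun w => (won w)%:R).
  have c7 : 0 < 7 * N + cc by lra.
  rewrite ler_pdivrMr // mulrC.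
  have h5 := ler_wpM2l (ltW N0) h2; have h6 := ler_wpM2l (ltW N7) h1.
  by move: h3 h5 h6; set u := Ex P _; set v := Ex P _; set t := Ex P _; lra.
have h5 := @Ex_lym lam (7 * N) lam0 lam1 lamc N7 K.
have h6 : Ex P (fun w => (won w)%:R) <= Ex P (fun w => (right_good w)%:R) +
    Ex P (fun w => (7 * N * C)^-1 * stop (below (7 * N) (path w)) (lym cc (path w)) K).
  rewrite -ExD //; last exact: bmfZ.
  apply: Ex_le => //; first by apply: bmfD => //; exact: bmfZ.
  have C7 : 0 < 7 * N * C by rewrite mulr_gt0.
  move=> w; set st := stop _ _ _.
  have st0 : 0 <= (7 * N * C)^-1 * st.
    apply: mulr_ge0; first by rewrite invr_ge0 ltW.
    have [j [_ E _ _ _]] := stopP (below (7 * N) (path w)) (lym cc (path w)) K.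
    by rewrite /st E /lym mulr_ge0 ?mass_ge0 // addr_ge0 ?draw_ge0 // expR_ge0.
  rewrite /right_good -/st; case: (won w) => /=; last by rewrite add0r.
  have [h|h] := ltP st (7 * N * C); first by rewrite /= lerDl.
  by rewrite add0r mulrC ler_pdivlMr // mul1r.
rewrite ExZ // in h6.
have h7 : (7 * N * C)^-1 * Ex P (fun w => stop (below (7 * N) (path w)) (lym cc (path w)) K) <=
    lym_bound lam (7 * N) / (7 * N * C).
  by rewrite mulrC ler_wpM2r // invr_ge0 !mulr_ge0 // ltW.
by apply: (@le_trans _ _ _ _ _ (lerB h4 (lexx _))); lra.
Qed.

End RightValley.

End RandomWalk.

(** * Mean return probabilities *)

Section ReturnBounds.
Variables (R : realType) (e : int -> R) (cc : R).
Hypothesis e01 : forall k, 0 < e k < 1.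
Hypothesis ecc : forall k, `|lrho e k| <= cc.

Lemma return_bound_right y m z h H K : (z <= K)%N ->
  (forall i, (i <= z)%N -> pot e (y + i%:Z) - pot e y <= H) ->
  pot e (y + z%:Z) - pot e y <= - h ->
  kerw e (m + m) y y <= pi_factor cc * (K%:R * expR H / m.+1%:R + 2 * expR (- h)).
Proof.
move=> zK hH hh; have F0 := pi_factor_gt0 cc.
have P := return_bound (@cond_gt0 _ e) y z m; rewrite ec_cond // in P.
apply: (le_trans P); rewrite mulrDr; apply: lerD.
  rewrite mulrA; apply: ler_wpM2r; first by rewrite invr_ge0 ler0n.
  apply: (@le_trans _ _ (pi_factor cc * expR (- pot e y) * (K%:R * expR (H + pot e y)))).
    apply: ler_pM.
    - by apply: ltW; apply: piw_gt0; exact: cond_gt0.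
    - by apply: sumr_ge0 => i _; rewrite invr_ge0 ltW // cond_gt0.
    - exact: piw_cond_le.
    - apply: (@le_trans _ _ (\sum_(i < z) expR (H + pot e y))).
        apply: ler_sum => i _; rewrite /cond -expRN opprK ler_expR.
        by have := hH i (ltnW (ltn_ord i)); lra.
      by rewrite sumr_const card_ord -[leLHS]mulr_natl ler_wpM2r ?expR_ge0 // ler_nat.
  rewrite le_eqVlt; apply/orP; left; apply/eqP.
  by rewrite addrC expRD expRN; field; rewrite gt_eqF // expR_gt0.
rewrite [leRHS]mulrCA ler_pM2l // ler_pdivrMr; last by apply: piw_gt0; exact: cond_gt0.
apply: (le_trans (piw_cond_le ecc y)); rewrite -mulrA ler_pM2l //.
apply: (@le_trans _ _ (expR (- h) * expR (- pot e (y + z%:Z)))).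
  by rewrite -expRD ler_expR; lra.
by rewrite ler_pM2l ?expR_gt0 // piw_cond_ge.
Qed.

Lemma return_bound_left y m z h H K : (z <= K)%N ->
  (forall i, (i <= z)%N -> pot e (y - i%:Z) - pot e y <= H) ->
  pot e (y - z%:Z) - pot e y <= - h ->
  kerw e (m + m) y y <= pi_factor cc * (K%:R * expR H / m.+1%:R + 2 * expR (- h)).
Proof.
move=> zK hH hh; have F0 := pi_factor_gt0 cc.
have P := return_bound (@reflc_gt0 _ _ (@cond_gt0 _ e)) (- y) z m.
rewrite (kerw_reflc (@cond_gt0 _ e)) opprK ec_cond // in P.
have Pw x : piw (reflc (cond e)) (- x) = piw (cond e) x.
  rewrite /piw /reflc addrC; have -> : - - x - 1 = x - 1 by lia.
  by have -> : - (- x - 1) - 1 = x by lia.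
have -> : y = - - y by rewrite opprK.
have E : - y + z%:Z = - (y - z%:Z) by lia.
rewrite opprK E !Pw in P *.
apply: (le_trans P); rewrite mulrDr; apply: lerD.
  rewrite mulrA; apply: ler_wpM2r; first by rewrite invr_ge0 ler0n.
  apply: (@le_trans _ _ (pi_factor cc * expR (- pot e y) * (K%:R * expR (H + pot e y)))).
    apply: ler_pM.
    - by apply: ltW; apply: piw_gt0; exact: cond_gt0.
    - by apply: sumr_ge0 => i _; rewrite invr_ge0 ltW // reflc_gt0 // => ?; exact: cond_gt0.
    - exact: piw_cond_le.
    - apply: (@le_trans _ _ (\sum_(i < z) expR (H + pot e y))).
        apply: ler_sum => i _; rewrite /reflc /cond -expRN opprK ler_expR.
        have := hH i.+1 (ltn_ord i).
        have -> : - (- y + (i : nat)%:Z) - 1 = y - i.+1%:Z by lia.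
        by lra.
      by rewrite sumr_const card_ord -[leLHS]mulr_natl ler_wpM2r ?expR_ge0 // ler_nat.
  rewrite le_eqVlt; apply/orP; left; apply/eqP.
  by rewrite addrC expRD expRN; field; rewrite gt_eqF // expR_gt0.
rewrite [leRHS]mulrCA ler_pM2l // ler_pdivrMr; last by apply: piw_gt0; exact: cond_gt0.
apply: (le_trans (piw_cond_le ecc y)); rewrite -mulrA ler_pM2l //.
apply: (@le_trans _ _ (expR (- h) * expR (- pot e (y - z%:Z)))).
  by rewrite -expRD ler_expR; lra.
by rewrite ler_pM2l ?expR_gt0 // piw_cond_ge.
Qed.

Lemma far_cases (z : int) (k k' L : nat) : (k <= L)%N -> (k' <= L)%N ->
  L%:Z <= `|z| -> (k%:Z <= z) || (z <= - k'%:Z).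
Proof. by lia. Qed.

Lemma draw_climb x L H : ~~ alive (below H x) L ->
  exists i j : nat, [/\ (i <= j <= L)%N & H <= psum x j - psum x i :> R].
Proof.
move=> na; have [j jL hj] : exists2 j, (j <= L)%N & ~~ below H x j.
  apply: contrapT => h; move/negP: na; apply; apply/aliveP => i iL.
  by apply: contrapT => /negP b; apply: h; exists i.
have [b bj E] := rmin_arg x j.
by exists b, j; split; [rewrite bj|move: hj; rewrite /below -leNgt /draw E].
Qed.

Definition right_path : nat -> R := fun k => lrho e k.+1%:Z.
Definition left_path : nat -> R := fun k => - lrho e (- k%:Z).

Lemma psum_right_path k : psum right_path k = pot e k - pot e 0.
Proof.
have := pot_right e 0 k; rewrite add0r => ->.
by apply: eq_bigr => i _; rewrite /right_path add0r.
Qed.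

Lemma psum_left_path k : psum left_path k = pot e (- k%:Z) - pot e 0.
Proof.
have := pot_left e 0 k; rewrite sub0r => ->; rewrite -sumrN.
by apply: eq_bigr => i _; rewrite /left_path sub0r.
Qed.

(** If each side has a climb of height [B] within distance [L], the walk must cross one of them to
    get beyond [L]; otherwise one indicator is 1 and the bound is trivial. *)
Lemma tail_bound n L B : 0 < B ->
  iter n (wop e) (fun z => (L%:Z <= `|z|)%R%:R) 0 <=
  (alive (below B right_path) L)%:R + (alive (below B left_path) L)%:R +
  2 * (n.+1%:R * (pi_factor cc * expR (- B))).
Proof.
move=> B0; have F0 := pi_factor_gt0 cc.
have w0 := wwt_ge0 e01.
have b0 : 0 <= 2 * (n.+1%:R * (pi_factor cc * expR (- B))).
  by rewrite !mulr_ge0 ?expR_ge0 // ltW.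
have le1 : iter n (wop e) (fun z => (L%:Z <= `|z|)%R%:R) 0 <= 1.
  apply: (@le_trans _ _ (iter n (wop e) (fun=> 1) 0)); last by rewrite iter_mop_cst //; exact: wwt_sum1.
  by apply: iter_mop_le => // z; case: (leP L%:Z `|z|).
have [ar|nar] := boolP (alive (below B right_path) L).
  by have := ler0n R (alive (below B left_path) L); rewrite /=; lra.
have [al|nal] := boolP (alive (below B left_path) L); first by rewrite /=; lra.
rewrite /= !add0r.
have [i [k [/andP[ik kL] hik]]] := draw_climb nar.
have [i' [k' [/andP[ik' kL'] hik']]] := draw_climb nal.
rewrite !psum_right_path in hik; rewrite !psum_left_path in hik'.
have ik1 : (i < k)%N.
  by rewrite ltn_neqAle ik andbT; apply/negP => /eqP E; move: hik; rewrite E; lra.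
have ik1' : (i' < k')%N.
  by rewrite ltn_neqAle ik' andbT; apply/negP => /eqP E; move: hik'; rewrite E; lra.
have i0 : (0 : int) <= i%:Z by [].
have i0' : - i'%:Z <= (0 : int) by rewrite oppr_le0.
have ikz : i%:Z < k%:Z by rewrite ltz_nat.
have ikz' : - k'%:Z < - i'%:Z by rewrite ltrN2 ltz_nat.
have h1 := exit_right_pot e01 ecc n i0 ikz.
have h2 := exit_left_pot e01 ecc n i0' ikz'.
apply: (@le_trans _ _ (iter n (wop e) (fun z => (k%:Z <= z)%R%:R + (z <= - k'%:Z)%R%:R) 0)).
  apply: iter_mop_le => // z; case: (leP L%:Z `|z|) => //= h; last first.
    by rewrite addr_ge0.
  have := far_cases kL kL' h.
  by case: (_ <= _) => /=; [|move=> ->]; rewrite ?lerDl ?lerDr.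
rewrite iter_mopD mulr_natl mulr2n.
have E (v : R) : v <= - B -> n.+1%:R * (pi_factor cc * expR v) <= n.+1%:R * (pi_factor cc * expR (- B)).
  by move=> vB; rewrite ler_pM2l ?ltr0n // ler_pM2l // ler_expR.
apply: lerD; first by apply: (le_trans h1); apply: E; lra.
by apply: (le_trans h2); apply: E; lra.
Qed.

End ReturnBounds.

Section SiteWalk.
Context d (Om : measurableType d) (R : realType) (P : probability Om R).
Variables (om : int -> Om -> R) (cc s2 : R).
Hypothesis mom : forall x, measurable_fun setT (om x).
Hypothesis ind : mutually_independent P
  (fun x : int => process_sigma_algebra (fun _ : unit => om x)).
Hypothesis om01 : forall x w, 0 < om x w < 1.

Definition env_at w : int -> R := fun x => om x w.

Hypothesis omcc : forall x w, `|lrho (env_at w) x| <= cc.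
Hypothesis cc0 : 0 < cc.
Hypothesis s20 : 0 < s2.
Hypothesis mean0 : forall x, Ex P (fun w => lrho (env_at w) x) = 0.
Hypothesis mean2 : forall x, Ex P (fun w => lrho (env_at w) x ^+ 2) = s2.

Section Path.
Variables (site : nat -> int) (sg : R).
Hypotheses (site_inj : injective site) (sg1 : sg ^+ 2 = 1).

Definition seen (k : nat) : set int := [set x | exists2 i, (i < k)%N & x = site i].
Definition new (k : nat) : set int := [set site k].
(** [sg] is the sign with which the potential is read: 1 on sites going right and -1 on sites going
    left give its rises from the start, whereas 1 on sites going left gives its falls
    ([bad_left]). *)
Definition incr (k : nat) (w : Om) : R := sg * lrho (env_at w) (site k).

Lemma seenS k : seen k `<=` seen k.+1.
Proof. by move=> x [i ik ->]; exists i => //; exact: leqW. Qed.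

Lemma new_seen k : new k `<=` seen k.+1.
Proof. by move=> x ->; exists k. Qed.

Lemma seen_new k x : seen k x -> new k x -> False.
Proof. by move=> [i ik ->] /site_inj E; rewrite E ltnn in ik. Qed.

Lemma bmf_incr k : @bmf _ (env_space om (new k)) R (incr k).
Proof.
apply: bmfZ; split; last by exists cc => w; exact: omcc.
have m1 : measurable_fun (setT : set (env_space om (new k))) (om (site k)).
  by apply: env_space_site.
rewrite (_ : (fun w => _) = (fun w => ln (1 - om (site k) w) - ln (om (site k) w))).
  apply: measurable_funB; apply: measurableT_comp => //.
  by apply: measurable_funB => //; exact: measurable_cst.
apply/funext => w; rewrite /lrho /rho /env_at; have /andP[a b] := om01 (site k) w.
by rewrite ln_div ?posrE ?subr_gt0.
Qed.

Lemma sg_norm : `|sg| = 1.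
Proof.
have h : (sg - 1) * (sg + 1) = 0.
  by rewrite (_ : (sg - 1) * (sg + 1) = sg ^+ 2 - 1); [rewrite sg1 subrr|ring].
move/eqP: h; rewrite mulf_eq0 subr_eq0 addr_eq0 => /orP[/eqP ->|/eqP ->].
  by rewrite normr1.
by rewrite normrN normr1.
Qed.

Lemma incr_le k w : `|incr k w| <= cc.
Proof. by rewrite /incr normrM sg_norm mul1r; exact: omcc. Qed.

Let bl x : @bmf _ Om R (fun w => lrho (env_at w) x).
Proof.
split; last by exists cc => w; exact: omcc.
rewrite (_ : (fun w => _) = (fun w => ln (1 - om x w) - ln (om x w))).
  apply: measurable_funB; apply: measurableT_comp => //.
  by apply: measurable_funB => //; exact: measurable_cst.
apply/funext => w; rewrite /lrho /rho /env_at; have /andP[a b] := om01 x w.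
by rewrite ln_div ?posrE ?subr_gt0.
Qed.

Lemma Ex_incr k : Ex P (incr k) = 0.
Proof. by rewrite ExZ // mean0 mulr0. Qed.

Lemma Ex_incr2 k : Ex P (fun w => incr k w ^+ 2) = s2.
Proof. by rewrite -(mean2 (site k)); apply: eq_Ex => w; rewrite /incr exprMn sg1 mul1r. Qed.

Definition site_exit_prob := exit_fail_prob mom ind seenS new_seen seen_new
  bmf_incr incr_le Ex_incr Ex_incr2 cc0 s20.
Definition site_below_time := below_time mom ind seenS new_seen seen_new
  bmf_incr incr_le Ex_incr Ex_incr2 cc0 s20.
Definition site_right_good_prob := right_good_prob mom ind seenS new_seen seen_new
  bmf_incr incr_le Ex_incr Ex_incr2 cc0 s20.
Definition site_right_goodP := right_goodP incr_le cc0.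

Lemma site_exit_meas h H k :
  measurable_fun (setT : set (env_space om (seen k))) (exit_fail incr h H k).
Proof. exact: madp_exit_fail seenS new_seen bmf_incr _ _ _. Qed.

Lemma site_right_good_meas N C k :
  measurable_fun (setT : set (env_space om (seen k))) (right_good incr cc N C k).
Proof. exact: madp_right_good seenS new_seen bmf_incr _ _ _. Qed.

Lemma site_below_meas H k :
  measurable_fun (setT : set (env_space om (seen k))) (fun w => alive (below H (incr^~ w)) k).
Proof. by apply: (madp_alive seenS) => i; exact: madp_below seenS new_seen bmf_incr _ _. Qed.

End Path.

Lemma bmf_iter_wop n (f : int -> R) x :
  @bmf _ (env_space om setT) R (fun w => iter n (wop (env_at w)) f x).
Proof.
elim: n x => [|n IH] x; first exact: bmf_cst.
rewrite (_ : (fun w => _) = (fun w => om x w * iter n (wop (env_at w)) f (x + 1) +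
  (1 - om x w) * iter n (wop (env_at w)) f (x - 1))).
  have m1 : @bmf _ (env_space om setT) R (om x).
    split; first exact: env_space_site.
    by exists 1 => w; have /andP[a b] := om01 x w; rewrite gtr0_norm // ltW.
  by apply: bmfD; apply: bmfM => //; apply: bmfB => //; exact: bmf_cst.
by apply/funext => w; rewrite iterS wopE.
Qed.

Lemma right_left_disjoint (y : int) (i j : nat) : y + i.+1%:Z = y - j%:Z -> False.
Proof. by lia. Qed.

Lemma right_site_inj y : injective (fun k : nat => y + k.+1%:Z).
Proof. by move=> i j; lia. Qed.

Lemma left_site_inj y : injective (fun k : nat => y - k%:Z).
Proof. by move=> i j; lia. Qed.

Lemma sqrN1 : (-1) ^+ 2 = 1 :> R. Proof. by rewrite sqrrN expr1n. Qed.

Definition fail_bound (h H : R) (K : nat) : R :=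
  (h + cc) / (H + h + cc) + (H + h + cc) ^+ 2 / (s2 * K%:R).

(* The return probability is small as soon as the potential falls by [h] before
   rising by [H] on one side of [y]; failures on the two sides are independent,
   hence the square. *)
Lemma return_mean y m h H K : 0 < h -> 0 < H -> (0 < K)%N ->
  Ex P (fun w => kerw (env_at w) (m + m) y y) <=
  pi_factor cc * (K%:R * expR H / m.+1%:R + 2 * expR (- h)) + fail_bound h H K ^+ 2.
Proof.
move=> h0 H0 K0; have F0 := pi_factor_gt0 cc.
pose fr := exit_fail (incr (fun k : nat => y + k.+1%:Z) 1) h H K.
pose fl := exit_fail (incr (fun k : nat => y - k%:Z) (-1)) h H K.
have pr := site_exit_prob (@right_site_inj y) (expr1n _ 2) h0 H0 K0.
have pl := site_exit_prob (@left_site_inj y) sqrN1 h0 H0 K0.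
rewrite -/fr in pr; rewrite -/fl in pl.
have mr := @site_exit_meas (fun k : nat => y + k.+1%:Z) 1 h H K.
have ml := @site_exit_meas (fun k : nat => y - k%:Z) (-1) h H K.
rewrite -/fr in mr; rewrite -/fl in ml.
have br := bmf_bool R mr; have bl := bmf_bool R ml.
have br' := bmf_env_sub mom br; have bl' := bmf_env_sub mom bl.
have bk := bmf_env_sub mom (bmf_iter_wop (m + m) (fun z => (z == y)%:R) y).
set Q := pi_factor cc * _.
have Q0 : 0 <= Q.
  rewrite mulr_ge0 ?(ltW F0) // addr_ge0 // ?mulr_ge0 ?expR_ge0 // ?divr_ge0 ?mulr_ge0 ?expR_ge0 //.
apply: (@le_trans _ _ (Ex P (fun w => Q + (fr w)%:R * (fl w)%:R))).
  apply: Ex_le => //; first by apply: bmfD; [exact: bmf_cst|exact: bmfM].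
  move=> w; have e01 : forall k, 0 < env_at w k < 1 by move=> k; exact: om01.
  have ew := omcc^~ w.
  have [f1|nf1] := boolP (fr w); last first.
    rewrite mul0r addr0.
    have [z [zK z1 _ z3]] := exit_failP h0 H0 nf1.
    have E k : psum (fun i => incr (fun k : nat => y + k.+1%:Z) 1 i w) k =
        pot (env_at w) (y + k%:Z) - pot (env_at w) y.
      by rewrite pot_right; apply: eq_bigr => i _; rewrite /incr mul1r.
    apply: (@return_bound_right _ _ cc e01 ew y m z h H K zK).
      by move=> i /z3; rewrite E.
    by rewrite -E.
  have [f2|nf2] := boolP (fl w); last first.
    rewrite mulr0 addr0.
    have [z [zK z1 _ z3]] := exit_failP h0 H0 nf2.
    have E k : psum (fun i => incr (fun k : nat => y - k%:Z) (-1) i w) k =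
        pot (env_at w) (y - k%:Z) - pot (env_at w) y.
      by rewrite pot_left -sumrN; apply: eq_bigr => i _; rewrite /incr mulN1r.
    apply: (@return_bound_left _ _ cc e01 ew y m z h H K zK).
      by move=> i /z3; rewrite E.
    by rewrite -E.
  rewrite mulr1; apply: (@le_trans _ _ 1); last by rewrite lerDr.
  exact: ker_le1 (wwt_ge0 e01) (wwt_sum1 _) _ _ _.
rewrite ExD; [|exact: bmf_cst|exact: bmfM].
rewrite Ex_cst lerD2l expr2.
have -> : Ex P (fun w => (fr w)%:R * (fl w)%:R) = Ex P (fun w => (fr w)%:R) * Ex P (fun w => (fl w)%:R).
  apply: (env_indep_Ex mom ind _ br bl) => x [i iK ->] [j jK].
  exact: right_left_disjoint.
by apply: ler_pM pr pl; apply: Ex_ge0 => w; exact: ler0n.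
Qed.

Lemma tail_mean n L B : 0 < B -> (0 < L)%N ->
  Ex P (fun w => iter n (wop (env_at w)) (fun z => (L%:Z <= `|z|)%R%:R) 0) <=
  2 * ((B + cc) ^+ 2 / (s2p cc s2 * L%:R)) + 2 * (n.+1%:R * (pi_factor cc * expR (- B))).
Proof.
move=> B0 L0.
pose X1 := incr (fun k : nat => 0 + k.+1%:Z) 1.
pose X2 := incr (fun k : nat => 0 - k%:Z) (-1).
have p1 := site_below_time (@right_site_inj 0) (expr1n _ 2) L B0.
have p2 := site_below_time (@left_site_inj 0) sqrN1 L B0.
rewrite -/X1 in p1; rewrite -/X2 in p2.
have m1 := @site_below_meas (fun k : nat => 0 + k.+1%:Z) 1 B L.
have m2 := @site_below_meas (fun k : nat => 0 - k%:Z) (-1) B L.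
rewrite -/X1 in m1; rewrite -/X2 in m2.
have b1 := bmf_env_sub mom (bmf_bool R m1); have b2 := bmf_env_sub mom (bmf_bool R m2).
have sL : 0 < s2p cc s2 * L%:R by rewrite mulr_gt0 ?ltr0n // s2p_gt0.
rewrite mulrC -ler_pdivlMr // in p1; rewrite mulrC -ler_pdivlMr // in p2.
set Q := 2 * (n.+1%:R * _).
apply: (@le_trans _ _ (Ex P (fun w => (alive (below B (X1^~ w)) L)%:R +
   (alive (below B (X2^~ w)) L)%:R + Q))).
  have bt := bmf_env_sub mom (bmf_iter_wop n (fun z => (L%:Z <= `|z|)%R%:R) 0).
  apply: Ex_le => //; first by apply: bmfD; [exact: bmfD|exact: bmf_cst].
  move=> w; have e01 : forall k, 0 < env_at w k < 1 by move=> k; exact: om01.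
  have := tail_bound e01 (omcc^~ w) n L B0; rewrite -/Q.
  have -> : right_path (env_at w) = X1^~ w.
    by apply/funext => k; rewrite /right_path /X1 /incr mul1r add0r.
  have -> // : left_path (env_at w) = X2^~ w.
  by apply/funext => k; rewrite /left_path /X2 /incr mulN1r sub0r.
rewrite ExD; [|exact: bmfD|exact: bmf_cst].
by rewrite ExD // Ex_cst lerD2r [leRHS]mulr_natl mulr2n; exact: lerD.
Qed.

End SiteWalk.

(** * Two independent environments *)

Section Growth.
Variable R : realType.

Lemma leq_double_half n : (n <= n./2 * 2 + 1)%N. Proof. by lia. Qed.

Lemma pow_expRN n : exists2 C : R, 0 < C & forall x, 0 <= x -> x ^+ n * expR (- x) <= C.
Proof.
exists n`!%:R => [|x x0]; first by rewrite ltr0n fact_gt0.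
rewrite expRN ler_pdivrMr ?expR_gt0 //.
case: n => [|n]; first by rewrite expr0 mul1r -[leLHS]expR0 ler_expR.
rewrite mulrC -ler_pdivrMr ?ltr0n ?fact_gt0 //.
by have := expR_ge1Dxn n x0; lra.
Qed.

Lemma expR_half_le2 : expR (1 / 2) <= 2 :> R.
Proof.
have := expR_ge1Dx (- (1 / 2) : R); rewrite expRN => h.
have e0 := expR_gt0 (1 / 2 : R).
have : (1 - 1 / 2) * expR (1 / 2) <= (expR (1 / 2))^-1 * expR (1 / 2) :> R.
  by rewrite ler_pM2r //; lra.
by rewrite mulVf ?gt_eqF //; lra.
Qed.

Lemma expR_half_le (m : nat) : expR (m%:R / 2) <= 2 ^+ m :> R.
Proof.
have -> : m%:R / 2 = m%:R * (1 / 2) :> R by field.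
by rewrite expRM_natl lerXn2r ?nnegrE ?expR_ge0 // expR_half_le2.
Qed.

Lemma two_le_expR (m : nat) : 2 ^+ m <= expR m%:R :> R.
Proof.
rewrite -[m%:R]mulr1 expRM_natl lerXn2r ?nnegrE ?expR_ge0 //.
by have := expR_ge1Dx (1 : R); lra.
Qed.

End Growth.

Section Collision.
Variables (R : realType) (e1 e2 : int -> R).
Hypotheses (h1 : forall k, 0 < e1 k < 1) (h2 : forall k, 0 < e2 k < 1).

Definition window (F : int -> R) (lo : int) (l : nat) : R := \sum_(j < l) F (lo + j%:Z).

Lemma window_cat F lo a b : window F lo (a + b) = window F lo a + window F (lo + a%:Z) b.
Proof.
rewrite /window big_split_ord /=; congr (_ + _); apply: eq_bigr => i _.
by congr F; lia.
Qed.

Lemma window_ge0 F lo l : (forall z, 0 <= F z) -> 0 <= window F lo l.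
Proof. by move=> F0; apply: sumr_ge0. Qed.

Lemma window_le F n n' : (forall z, 0 <= F z) -> (n <= n')%N ->
  window F (- n%:Z) (n + n + 1) <= window F (- n'%:Z) (n' + n' + 1).
Proof.
move=> F0 nn; have -> : (n' + n' + 1 = (n' - n) + ((n + n + 1) + (n' - n)))%N by lia.
rewrite !window_cat; have -> : - n'%:Z + (n' - n)%N%:Z = - n%:Z by lia.
by have := window_ge0 (- n'%:Z) (n' - n) F0;
  have := window_ge0 (- n%:Z + (n + n + 1)%N%:Z) (n' - n) F0; lra.
Qed.

Lemma window_center F n n' : (n <= n')%N -> (forall z, (n%:Z < `|z|)%R -> F z = 0) ->
  window F (- n'%:Z) (n' + n' + 1) = window F (- n%:Z) (n + n + 1).
Proof.
move=> nn F0; have -> : (n' + n' + 1 = (n' - n) + ((n + n + 1) + (n' - n)))%N by lia.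
rewrite !window_cat; have -> : - n'%:Z + (n' - n)%N%:Z = - n%:Z by lia.
rewrite [X in X + _]big1 ?[X in _ + (_ + X)]big1 ?addr0 ?add0r // => i _; apply: F0;
  have := ltn_ord i; lia.
Qed.

Definition collide (n : nat) : R :=
  window (fun z => kerw e1 n 0 z * kerw e2 n 0 z) (- n%:Z) (n + n + 1).

Definition far (e : int -> R) (n L : nat) : R :=
  iter n (wop e) (fun z => (L%:Z <= `|z|)%R%:R) 0.

Let k1 n z : 0 <= kerw e1 n 0 z. Proof. by apply: ker_ge0; exact: wwt_ge0. Qed.
Let k2 n z : 0 <= kerw e2 n 0 z. Proof. by apply: ker_ge0; exact: wwt_ge0. Qed.

Lemma kerw_far_le n L z : (L%:Z <= `|z|)%R -> kerw e2 n 0 z <= far e2 n L.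
Proof.
move=> Lz; apply: iter_mop_le; first exact: wwt_ge0.
by move=> u; case: eqP => [->|_]; rewrite ?Lz // ler0n.
Qed.

Lemma collide_split n L :
  collide n <= window (fun z => kerw e1 n 0 z * kerw e2 n 0 z) (- L%:Z) (L + L + 1) +
    far e1 n L * far e2 n L.
Proof.
set F := fun z => _; pose V := (n + L)%N.
have F0 z : 0 <= F z by apply: mulr_ge0.
apply: (@le_trans _ _ (window F (- V%:Z) (V + V + 1))); first by apply: window_le => //; exact: leq_addr.
pose G (z : int) : R := F z * (`|z| <= L%:Z)%R%:R.
pose g (z : int) : R := (L%:Z <= `|z|)%R%:R.
have far0 : 0 <= far e2 n L.
  by apply: iter_mop_ge0; [exact: wwt_ge0|move=> u; exact: ler0n].
apply: (@le_trans _ R (window G (- V%:Z) (V + V + 1) +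
   far e2 n L * window (fun z => g z * kerw e1 n 0 z) (- V%:Z) (V + V + 1))).
  rewrite /window mulr_sumr -big_split /=; apply: ler_sum => j _.
  set z := - V%:Z + _; rewrite /G /g.
  have [h|h] := leP `|z| L%:Z.
    by rewrite mulr1 lerDl !mulr_ge0.
  rewrite /= mulr0 add0r (ltW h) mul1r mulrC.
  by rewrite /F ler_wpM2l // kerw_far_le // ltW.
apply: lerD.
  rewrite (@window_center _ L) ?leq_addl //; last first.
    by move=> z h; rewrite /G leNgt h mulr0.
  apply: ler_sum => j _; rewrite /G ler_piMr //.
  by rewrite lern1 leq_b1.
rewrite mulrC; apply: ler_wpM2r.
  by apply: iter_mop_ge0; [exact: wwt_ge0|move=> u; exact: ler0n].
rewrite /far -(ec_cond h1).
by apply: iter_wop_window => [k|z]; [exact: cond_gt0|exact: ler0n].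
Qed.

Lemma kerw_odd_return e (l : nat) y : kerw e (l + l).+1 y y = 0 :> R.
Proof.
apply: contrapT => /eqP /kerw_neq0 [i _ E].
by lia.
Qed.

(** At each near site the block is bounded by the return products of [kerw_pair_sum], in which odd
    times vanish. *)
Lemma collide_block N L :
  \sum_(2 ^ N <= n < 2 ^ N.+1) collide n <=
  window (fun y => \sum_(l < 2 ^ N) kerw e1 (l + l) y y * kerw e2 (l + l) y y)
    (- L%:Z) (L + L + 1) + \sum_(2 ^ N <= n < 2 ^ N.+1) far e1 n L * far e2 n L.
Proof.
apply: (le_trans (ler_sum_nat (fun n _ => collide_split n L))).
rewrite big_split /= lerD2r /window exchange_big /=; apply: ler_sum => j _.
set y := - L%:Z + _.
apply: (@le_trans _ _ (\sum_(n < 2 ^ N.+1) kerw e1 n 0 y * kerw e2 n 0 y)).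
  rewrite -(big_mkord xpredT (fun n => kerw e1 n 0 y * kerw e2 n 0 y)).
  rewrite [leRHS](@big_cat_nat _ _ _ (2 ^ N)) //=; last by rewrite leq_exp2l.
  by rewrite lerDr; apply: sumr_ge0 => i _; exact: mulr_ge0.
apply: (le_trans (kerw_pair_sum _ _ _ h1 h2)).
have -> : (2 ^ N.+1 = 2 ^ N + 2 ^ N)%N by rewrite expnS mul2n -addnn.
rewrite (pair_sum (fun j => kerw e1 j y y * kerw e2 j y y)) le_eqVlt; apply/orP; left; apply/eqP.
by apply: eq_bigr => l _; rewrite kerw_odd_return mul0r addr0.
Qed.

End Collision.

(** The standing assumptions with bounds valid for every sample point; [clipped_sinai] provides
    them. *)
Record sinai_env d (Om : measurableType d) (R : realType) (P : probability Om R)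
    (om : int -> Om -> R) (cc s2 : R) : Prop := SinaiEnv {
  sinai_meas : forall x, measurable_fun setT (om x);
  sinai_ind : mutually_independent P
    (fun x : int => process_sigma_algebra (fun _ : unit => om x));
  sinai01 : forall x w, 0 < om x w < 1;
  sinai_lrho : forall x w, `|lrho (env_at om w) x| <= cc;
  sinai_cc : 0 < cc;
  sinai_s2 : 0 < s2;
  sinai_mean : forall x, Ex P (fun w => lrho (env_at om w) x) = 0;
  sinai_mean2 : forall x, Ex P (fun w => lrho (env_at om w) x ^+ 2) = s2
}.

Section Scales.
Context d (Om : measurableType d) (R : realType) (P : probability Om R).
Variables (om : int -> Om -> R) (cc s2 : R).
Hypothesis se : sinai_env P om cc s2.

(** In [return_mean] with [h = w], [H = w ^ 16 / 8] and [K = w ^ 64], the ruin terms are O(w ^ -15)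
    and O(w ^ -32), hence a square O(w ^ -30). The divisor 8 keeps [expR H] well below [m], which is
    at least of order [expR (w ^ 16 / 4)]. *)
Lemma return_scale : exists2 C, 0 < C &
  forall w N m y, (0 < w)%N -> (w ^ 16 <= N)%N -> (2 ^ N./2 <= m)%N ->
  Ex P (fun t => kerw (env_at om t) (m + m) y y) <= C * w%:R^-1 ^+ 30.
Proof.
have F0 := pi_factor_gt0 cc; have [mom ind o1 oc c0 s0 m0 m2] := se.
have [C6 C60 E6] := pow_expRN R 6; have [C30 C300 E30] := pow_expRN R 30.
pose A1 := 2 * (C6 * 8 ^+ 6) : R; pose A2 := 2 * C30 : R.
pose A3 := 8 * (1 + cc) + (2 + cc) ^+ 2 / s2.
exists (pi_factor cc * (A1 + A2) + A3 ^+ 2).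
  by rewrite ltr_wpDr ?sqr_ge0 // mulr_gt0 // addr_gt0 // /A1 /A2 !mulr_gt0 // exprn_gt0.
move=> w N m y w0 wN Jm.
have wR : 1 <= w%:R :> R by rewrite ler1n.
set x : R := w%:R; rewrite -/x in wR.
have w16 : 1 <= x ^+ 16 by exact: exprn_ege1.
have wx : x <= x ^+ 16 by rewrite -[leLHS]expr1; exact: ler_weXn2l.
have h0 : 0 < x by lra.
set v := x^-1.
have wv : x * v = 1 by rewrite mulfV // gt_eqF.
have v0 : 0 < v by rewrite invr_gt0.
have v1 : v <= 1 by rewrite invf_le1.
have wvX k : x ^+ k * v ^+ k = 1 by rewrite -exprMn wv expr1n.
have H0 : 0 < x ^+ 16 / 8 by rewrite divr_gt0 // exprn_gt0.
have K0 : (0 < w ^ 64)%N by rewrite expn_gt0 w0.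
apply: (le_trans (return_mean mom ind o1 oc c0 s0 m0 m2 y m h0 H0 K0)).
have KE : (w ^ 64)%:R = x ^+ 64 by rewrite natrX.
rewrite KE.
have vX0 k : 0 < v ^+ k by rewrite exprn_gt0.
have S2 : expR (- x) <= C30 * v ^+ 30.
  have -> : expR (- x) = x ^+ 30 * expR (- x) * v ^+ 30 by rewrite mulrAC wvX mul1r.
  by rewrite ler_wpM2r ?(ltW (vX0 _)) // E30 // ltW.
have S1 : x ^+ 64 * expR (x ^+ 16 / 8) / m.+1%:R <= A1 * v ^+ 30.
  have hm : expR (x ^+ 16 / 4) <= 2 * m.+1%:R.
    have hN : x ^+ 16 / 4 <= (N./2)%:R / 2 + 1 / 2.
      have : x ^+ 16 <= N%:R by rewrite /x -natrX ler_nat.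
      have : (N%:R : R) <= (N./2 * 2 + 1)%:R by rewrite ler_nat leq_double_half.
      by rewrite natrD natrM; lra.
    apply: (@le_trans _ _ (expR ((N./2)%:R / 2) * expR (1 / 2))).
      by rewrite -expRD ler_expR.
    rewrite mulrC; apply: ler_pM; rewrite ?expR_ge0 ?expR_half_le2 //.
    apply: (le_trans (expR_half_le R _)); rewrite -natrX ler_nat; exact: leqW.
  rewrite ler_pdivrMr ?ltr0n //.
  set u := x ^+ 16 / 8 in H0 *.
  have uE : x ^+ 16 / 4 = u + u by rewrite /u; field.
  have xu : 1 = u ^+ 6 * (8 ^+ 6 * v ^+ 96).
    have -> : u ^+ 6 * (8 ^+ 6 * v ^+ 96) = x ^+ 96 * v ^+ 96.
      have -> : u ^+ 6 = x ^+ 96 / 8 ^+ 6 by rewrite /u expr_div_n -exprM.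
      by field.
    by rewrite wvX.
  have h3 : expR u <= expR (- u) * (2 * m.+1%:R).
    have -> : expR u = expR (- u) * expR (u + u) by rewrite -expRD; congr expR; ring.
    by rewrite ler_wpM2l ?expR_ge0 // -uE.
  have h4 : x ^+ 64 * expR (- u) <= C6 * 8 ^+ 6 * v ^+ 30.
    have -> : x ^+ 64 * expR (- u) = (u ^+ 6 * expR (- u)) * (8 ^+ 6 * (x ^+ 64 * v ^+ 96)).
      by rewrite -[LHS]mulr1 [in LHS]xu; ring.
    have -> : x ^+ 64 * v ^+ 96 = v ^+ 32.
      by rewrite (_ : v ^+ 96 = v ^+ 64 * v ^+ 32); [rewrite mulrA wvX mul1r|rewrite -exprD].
    rewrite [leRHS](_ : _ = C6 * (8 ^+ 6 * v ^+ 30)); last by ring.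
    apply: ler_pM.
    - by rewrite mulr_ge0 ?expR_ge0 // exprn_even_ge0.
    - by rewrite mulr_ge0 ?exprn_ge0 // ltW.
    - exact: E6 (ltW H0).
    - rewrite ler_pM2l ?exprn_gt0 //; apply: ler_wiXn2l => //; exact: ltW.
  apply: (@le_trans _ _ (x ^+ 64 * (expR (- u) * (2 * m.+1%:R)))).
    by rewrite ler_wpM2l // exprn_ge0 // ltW.
  have := ler_wpM2r (mulr_ge0 (ler0n R 2) (ler0n R m.+1)) h4.
  by rewrite /A1; set a := x ^+ 64; set b := 8 ^+ 6; set q := v ^+ 30; lra.
have S3 : 0 <= fail_bound cc s2 x (x ^+ 16 / 8) (w ^ 64) <= A3 * v ^+ 15.
  rewrite /fail_bound KE.
  have xX k : 0 < x ^+ k by rewrite exprn_gt0.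
  have d0 : 0 < x ^+ 16 / 8 + x + cc by lra.
  apply/andP; split.
    by rewrite addr_ge0 ?divr_ge0 ?sqr_ge0 // ltW // ?mulr_gt0 ?addr_gt0.
  rewrite /A3 [leRHS]mulrDl; apply: lerD.
    rewrite ler_pdivrMr //.
    have xc : x + cc <= (1 + cc) * x.
      by have := ler_wpM2l (ltW c0) wR; lra.
    apply: (le_trans xc).
    have -> : (1 + cc) * x = 8 * (1 + cc) * v ^+ 15 * (x ^+ 16 / 8).
      have -> : 8 * (1 + cc) * v ^+ 15 * (x ^+ 16 / 8) = (1 + cc) * (x ^+ 15 * v ^+ 15) * x.
        by rewrite [x ^+ 16]exprSr; field.
      by rewrite wvX mulr1.
    rewrite ler_wpM2l //; last by lra.
    by rewrite mulr_ge0 ?(ltW (vX0 15%N)) //; lra.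
  have hd : x ^+ 16 / 8 + x + cc <= (2 + cc) * x ^+ 16.
    by have := ler_wpM2l (ltW c0) w16; lra.
  apply: (@le_trans _ _ (((2 + cc) * x ^+ 16) ^+ 2 / (s2 * x ^+ 64))).
    apply: ler_wpM2r; first by rewrite invr_ge0 ltW // mulr_gt0.
    by rewrite lerXn2r ?nnegrE ?(ltW d0) // mulr_ge0 ?(ltW (xX 16%N)) //; lra.
  have -> : ((2 + cc) * x ^+ 16) ^+ 2 / (s2 * x ^+ 64) = (2 + cc) ^+ 2 / s2 * (x ^+ 32 / x ^+ 64).
    rewrite exprMn -exprM; field; by rewrite !gt_eqF.
  rewrite ler_wpM2l ?divr_ge0 ?sqr_ge0 ?(ltW s0) //.
  rewrite ler_pdivrMr // (exprD v 15 0) expr0 mulr1.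
  have -> : v ^+ 15 * x ^+ 64 = x ^+ 49.
    by rewrite (exprD x 15 49) mulrA [v ^+ 15 * _]mulrC wvX mul1r.
  exact: ler_weXn2l.
have S4 : fail_bound cc s2 x (x ^+ 16 / 8) (w ^ 64) ^+ 2 <= A3 ^+ 2 * v ^+ 30.
  case/andP: S3 => a1 a2; rewrite (exprM v 15 2) -exprMn lerXn2r ?nnegrE //.
  exact: le_trans a2.
have S5 := ler_wpM2l (ltW F0) (lerD S1 (ler_wpM2l (ler0n R 2) S2)).
apply: (le_trans (lerD S5 S4)).
by rewrite le_eqVlt; apply/orP; left; apply/eqP; rewrite /A2; ring.
Qed.

(** Barriers of height [3 * N] are used: [expR (- 3 * N)] beats the number of steps, at most
    [2 * expR N], and such a barrier is missing within [w ^ 42] with probability O(N ^ 2 / w ^ 42),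
    which is O(w ^ -10). *)
Lemma tail_scale : exists2 C, 0 < C &
  forall w N n, (0 < w)%N -> (w ^ 16 <= N <= (2 * w) ^ 16)%N -> (n < 2 ^ N.+1)%N ->
  Ex P (fun t => far (env_at om t) n (w ^ 42)) <= C * w%:R^-1 ^+ 10.
Proof.
have F0 := pi_factor_gt0 cc; have [mom ind o1 oc c0 s0 m0 m2] := se.
have [C10 C100 E10] := pow_expRN R 10.
have sp := s2p_gt0 c0 s0.
pose D : R := 3 * 2 ^+ 16 + cc.
exists (2 * (D ^+ 2 / s2p cc s2) + 4 * (pi_factor cc * C10)).
  by rewrite ltr_wpDl ?mulr_gt0 // mulr_ge0 // divr_ge0 ?sqr_ge0 ?(ltW sp).
move=> w N n w0 /andP[wN Nw] nN.
have wR : 1 <= w%:R :> R by rewrite ler1n.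
set x : R := w%:R; rewrite -/x in wR.
have w16 : 1 <= x ^+ 16 by exact: exprn_ege1.
have wx : x <= x ^+ 16 by rewrite -[leLHS]expr1; exact: ler_weXn2l.
have h0 : 0 < x by lra.
set v := x^-1.
have wv : x * v = 1 by rewrite mulfV // gt_eqF.
have v0 : 0 < v by rewrite invr_gt0.
have wvX k : x ^+ k * v ^+ k = 1 by rewrite -exprMn wv expr1n.
have vX0 k : 0 < v ^+ k by rewrite exprn_gt0.
have xX k : 0 < x ^+ k by rewrite exprn_gt0.
have N1 : x ^+ 16 <= N%:R by rewrite /x -natrX ler_nat.
have N2 : N%:R <= 2 ^+ 16 * x ^+ 16.
  by rewrite -exprMn /x -natrM -natrX ler_nat.
have B0 : 0 < 3 * N%:R :> R by have := xX 16; lra.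
have L0 : (0 < w ^ 42)%N by rewrite expn_gt0 w0.
apply: (le_trans (tail_mean mom ind o1 oc c0 s0 m0 m2 n B0 L0)).
have LE : (w ^ 42)%:R = x ^+ 42 by rewrite natrX.
rewrite LE [leRHS]mulrDl; apply: lerD.
  rewrite -[leRHS]mulrA ler_pM2l //.
  apply: (@le_trans _ _ ((D * x ^+ 16) ^+ 2 / (s2p cc s2 * x ^+ 42))).
    apply: ler_wpM2r; first by rewrite invr_ge0 mulr_ge0 // ltW.
    have D0 : 0 <= D by rewrite /D addr_ge0 ?(ltW c0) // mulr_ge0 // exprn_ge0.
    rewrite lerXn2r ?nnegrE //.
    - by lra.
    - by rewrite mulr_ge0 ?(ltW (xX _)).
    rewrite /D; have := ler_wpM2l (ltW c0) w16.
    by set b := 2 ^+ 16 in N2 *; set q := x ^+ 16 in N2 *; lra.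
  have -> : (D * x ^+ 16) ^+ 2 / (s2p cc s2 * x ^+ 42) = D ^+ 2 / s2p cc s2 * (x ^+ 32 / x ^+ 42).
    rewrite exprMn -exprM; field; by rewrite !gt_eqF.
  rewrite ler_wpM2l ?divr_ge0 ?sqr_ge0 ?(ltW sp) //.
  rewrite (exprD x 32 10) ler_pdivrMr ?mulr_gt0 //.
  by rewrite mulrCA [v ^+ 10 * _]mulrC wvX mulr1.
have h1 : n.+1%:R <= 2 * expR N%:R :> R.
  apply: (@le_trans _ _ (2 ^+ N.+1)); first by rewrite -natrX ler_nat.
  by rewrite exprS ler_pM2l // two_le_expR.
have h2 : expR N%:R * expR (- (3 * N%:R)) <= C10 * v ^+ 10 :> R.
  apply: (@le_trans _ _ (expR (- x))).
    rewrite -expRD ler_expR; have := xX 16; lra.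
  have -> : expR (- x) = x ^+ 10 * expR (- x) * v ^+ 10 by rewrite mulrAC wvX mul1r.
  by rewrite ler_wpM2r ?(ltW (vX0 _)) // E10 // ltW.
have E0 : 0 <= pi_factor cc * expR (- (3 * N%:R)) by rewrite mulr_ge0 ?expR_ge0 // ltW.
have h3 := ler_wpM2r E0 h1; have h4 := ler_wpM2l (ltW F0) h2.
move: h3 h4; set a := expR (- _); set b := expR N%:R; set q := v ^+ 10; set p := pi_factor cc.
by move=> h3 h4; lra.
Qed.

End Scales.

(** Monotone convergence: the series has finite mean, hence is finite almost everywhere. *)
Lemma ae_bounded_sums d (T : measurableType d) (R : realType) (P : probability T R)
    (f : nat -> T -> R) (C : R) : (forall n, bmf (f n)) -> (forall n x, 0 <= f n x) ->
  (forall B, \sum_(n < B) Ex P (f n) <= C) ->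
  {ae P, forall x, exists K, forall B, \sum_(n < B) f n x <= K}.
Proof.
move=> bf f0 fC.
have mf n : measurable_fun setT (fun x => (f n x)%:E).
  by apply/measurable_EFinP; case: (bf n).
have F0 n x : (0 <= (f n x)%:E)%E by rewrite lee_fin.
pose F x := (\sum_(n <oo) (f n x)%:E)%E.
have IF : (\int[P]_x F x <= C%:E)%E.
  rewrite /F integral_nneseries //.
  apply: lime_le; first by apply: is_cvg_nneseries => n _ _; exact: integral_ge0.
  apply: nearW => N; rewrite big_mkord.
  under eq_bigr do rewrite ExE //.
  by rewrite sumEFin lee_fin.
have mF : measurable_fun setT F by exact: ge0_emeasurable_sum.
have FF x : (0 <= F x)%E by apply: nneseries_ge0.
have iF : P.-integrable setT F.
  apply/integrableP; split => //.
  under eq_integral do rewrite gee0_abs //.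
  exact: le_lt_trans IF (ltry _).
have := integrable_ae measurableT iF.
apply: filterS => x /(_ I) fin; exists (fine (F x)) => B.
rewrite -lee_fin fineK // -sumEFin -(big_mkord xpredT (fun n => (f n x)%:E)).
exact: nneseries_lim_ge.
Qed.

Lemma half_leq_self n : (n./2 <= n)%N. Proof. by lia. Qed.

Section CollisionMean.
Context d (Om : measurableType d) (R : realType) (P : probability Om R).
Variables (om1 om2 : int -> Om -> R) (c1 c2 s1 s2 : R).
Hypotheses (se1 : sinai_env P om1 c1 s1) (se2 : sinai_env P om2 c2 s2).
Hypothesis cross : forall f g : Om -> R,
  @bmf _ (env_space om1 setT) R f -> @bmf _ (env_space om2 setT) R g ->
  Ex P (fun w => f w * g w) = Ex P f * Ex P g.

Local Notation e1 t := (env_at om1 t).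
Local Notation e2 t := (env_at om2 t).

Let h1 t k : 0 < e1 t k < 1. Proof. exact: sinai01 se1 _ _. Qed.
Let h2 t k : 0 < e2 t k < 1. Proof. exact: sinai01 se2 _ _. Qed.
Let b1 n (f : int -> R) x := bmf_env_sub (sinai_meas se1) (bmf_iter_wop (sinai01 se1) n f x).
Let b2 n (f : int -> R) x := bmf_env_sub (sinai_meas se2) (bmf_iter_wop (sinai01 se2) n f x).

Lemma Ex_cross n f x n' f' x' :
  Ex P (fun t => iter n (wop (e1 t)) f x * iter n' (wop (e2 t)) f' x') =
  Ex P (fun t => iter n (wop (e1 t)) f x) * Ex P (fun t => iter n' (wop (e2 t)) f' x').
Proof.
exact: cross (bmf_iter_wop (sinai01 se1) n f x) (bmf_iter_wop (sinai01 se2) n' f' x').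
Qed.

Lemma bmf_collide n : bmf (fun t => collide (e1 t) (e2 t) n).
Proof. by apply: bmf_sum => j; apply: bmfM; [exact: b1|exact: b2]. Qed.

Lemma collide_ge0 t n : 0 <= collide (e1 t) (e2 t) n.
Proof. by apply: sumr_ge0 => j _; apply: mulr_ge0; apply: ker_ge0; exact: wwt_ge0. Qed.

Lemma srw_sqr_le N n : (2 ^ N <= n)%N -> srw_return R n./2 ^+ 2 <= (2 ^+ N)^-1.
Proof.
move=> Nn; have := srw_return_upper R n./2; set u := srw_return _ _ ^+ 2 => h.
have p : 0 < 2 ^+ N :> R by rewrite exprn_gt0.
rewrite -[leRHS]mul1r ler_pdivlMr //; apply: le_trans h.
apply: ler_wpM2l; first exact: sqr_ge0.
have : (2 ^ N)%:R <= (n./2 * 2 + 1)%:R :> R by rewrite ler_nat (leq_trans Nn) // leq_double_half.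
by rewrite natrX natrD natrM mulrC.
Qed.

Lemma collide_block_mean N L :
  Ex P (fun t => \sum_(2 ^ N <= n < 2 ^ N.+1) srw_return R n./2 ^+ 2 * collide (e1 t) (e2 t) n) <=
  (2 ^+ N)^-1 * (\sum_(j < L + L + 1) \sum_(l < 2 ^ N)
     Ex P (fun t => kerw (e1 t) (l + l) (- L%:Z + j%:Z) (- L%:Z + j%:Z)) *
     Ex P (fun t => kerw (e2 t) (l + l) (- L%:Z + j%:Z) (- L%:Z + j%:Z)) +
   \sum_(2 ^ N <= n < 2 ^ N.+1) Ex P (fun t => far (e1 t) n L) * Ex P (fun t => far (e2 t) n L)).
Proof.
under eq_bigr do under eq_bigr do rewrite /ker -Ex_cross.
under [X in _ + X]eq_bigr do rewrite /far -Ex_cross.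
have bb n f x n' f' x' : bmf (fun t => iter n (wop (e1 t)) f x * iter n' (wop (e2 t)) f' x').
  by apply: bmfM; [exact: b1|exact: b2].
under eq_bigr do rewrite -Ex_sum //.
rewrite -!Ex_sum //; last by move=> j; exact: bmf_sum.
rewrite -ExD; [|by apply: bmf_sum => j; exact: bmf_sum|exact: bmf_sum].
have bT : bmf (fun x => \sum_(i < L + L + 1) \sum_(i0 < 2 ^ N)
   iter (i0 + i0) (wop (e1 x)) (fun z => (z == - L%:Z + i%:Z)%:R) (- L%:Z + i%:Z) *
   iter (i0 + i0) (wop (e2 x)) (fun z => (z == - L%:Z + i%:Z)%:R) (- L%:Z + i%:Z) +
   \sum_(2 ^ N <= i < 2 ^ N.+1) iter i (wop (e1 x)) (fun z => (L%:Z <= `|z|)%R%:R) 0 *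
     iter i (wop (e2 x)) (fun z => (L%:Z <= `|z|)%R%:R) 0).
  by apply: bmfD; [apply: bmf_sum => j; exact: bmf_sum|exact: bmf_sum].
rewrite -ExZ //; apply: Ex_le.
- by apply: bmf_sum => n; apply: bmfZ; exact: bmf_collide.
- exact: bmfZ.
move=> t; have p : 0 < 2 ^+ N :> R by rewrite exprn_gt0.
apply: (@le_trans _ _ ((2 ^+ N)^-1 * \sum_(2 ^ N <= n < 2 ^ N.+1) collide (e1 t) (e2 t) n)).
  rewrite mulr_sumr; apply: ler_sum_nat => n /andP[nN _].
  by apply: ler_wpM2r; [exact: collide_ge0|exact: srw_sqr_le].
rewrite ler_pM2l ?invr_gt0 //.
exact: collide_block (h1 t) (h2 t) N L.
Qed.

Lemma Ex_ker_le1 om c s (se : sinai_env P om c s) n x y :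
  0 <= Ex P (fun t => kerw (env_at om t) n x y) <= 1.
Proof.
have h t k : 0 < env_at om t k < 1 by exact: sinai01 se _ _.
apply/andP; split; first by apply: Ex_ge0 => t; apply: ker_ge0; exact: wwt_ge0.
rewrite -[leRHS](Ex_cst P); apply: Ex_le.
- have b := bmf_env_sub (sinai_meas se) (bmf_iter_wop (sinai01 se) n (fun z => (z == y)%:R) x).
  exact: b.
- exact: bmf_cst.
- by move=> t; apply: ker_le1; [exact: wwt_ge0|exact: wwt_sum1].
Qed.

(** Pays for the first [2 ^ (N / 2)] times of a block, too early for [return_scale], where return
    probabilities are bounded by 1. *)
Lemma half_block : exists2 C : R, 0 < C & forall w N, (0 < w)%N -> (w ^ 16 <= N)%N ->
  2 ^+ N./2 / 2 ^+ N <= C * w%:R^-1 ^+ 60.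
Proof.
have [C C0 E] := pow_expRN R 60.
exists (2 * (C * 4 ^+ 60)); first by rewrite !mulr_gt0 // exprn_gt0.
move=> w N w0 wN.
have wR : 1 <= w%:R :> R by rewrite ler1n.
set x : R := w%:R; rewrite -/x in wR.
have wx : x <= N%:R.
  apply: (@le_trans _ _ (x ^+ 16)); first by rewrite -[leLHS]expr1; exact: ler_weXn2l.
  by rewrite /x -natrX ler_nat.
have x0 : x != 0 by rewrite gt_eqF //; lra.
have p k : 0 < 2 ^+ k :> R by rewrite exprn_gt0.
have hN : x / 4 <= (N./2)%:R / 2 + 1 / 2.
  have : (N%:R : R) <= (N./2 * 2 + 1)%:R by rewrite ler_nat leq_double_half.
  by rewrite natrD natrM; lra.
apply: (@le_trans _ _ ((2 ^+ N./2)^-1)).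
  rewrite ler_pdivrMr // mulrC ler_pdivlMr // -exprD ler_eXn2l ?ltr1n //.
  by rewrite addnn -{2}[N]odd_double_half leq_addl.
apply: (@le_trans _ _ (2 * expR (- (x / 4)))).
  rewrite expRN -lef_pV2 ?posrE ?invr_gt0 // ?divr_gt0 ?expR_gt0 // invrK invfM invrK.
  apply: (@le_trans _ _ (2^-1 * (expR ((N./2)%:R / 2) * expR (1 / 2)))).
    by rewrite ler_pM2l ?invr_gt0 // -expRD ler_expR.
  rewrite mulrCA; have := expR_half_le R N./2; have := expR_half_le2 R.
  have := expR_gt0 ((N./2)%:R / 2 : R).
  by set a1 := expR _; set a2 := expR _; set a3 := 2 ^+ _; move=> *; nra.
rewrite -mulrA ler_pM2l // -mulrA.
have -> : expR (- (x / 4)) = (x / 4) ^+ 60 * expR (- (x / 4)) * (4 ^+ 60 * x^-1 ^+ 60).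
  rewrite mulrAC -exprMn -exprMn.
  have -> : x / 4 * (4 * x^-1) = 1 by field.
  by rewrite expr1n mul1r.
have x0' : 0 <= x by lra.
apply: ler_wpM2r; first by apply: mulr_ge0; apply: exprn_ge0; rewrite ?invr_ge0.
by apply: E; lra.
Qed.

(* With [h = w], [H = w ^ 16 / 8], exploration range [w ^ 64] and cut-off
   [L = w ^ 42], mean return probabilities are O(w ^ -30) and tails O(w ^ -10),
   so that the block contributes O(L * w ^ -60 + w ^ -20). *)
Lemma collide_scale : exists2 C, 0 < C & forall w N, (0 < w)%N ->
  (w ^ 16 <= N <= (2 * w) ^ 16)%N ->
  Ex P (fun t => \sum_(2 ^ N <= n < 2 ^ N.+1) srw_return R n./2 ^+ 2 * collide (e1 t) (e2 t) n) <=
  C * w%:R^-1 ^+ 18.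
Proof.
have [A1 A10 H1] := return_scale se1; have [A2 A20 H2] := return_scale se2.
have [B1 B10 G1] := tail_scale se1; have [B2 B20 G2] := tail_scale se2.
have [D D0 K] := half_block.
exists (3 * (D + A1 * A2) + B1 * B2).
  by rewrite addr_gt0 ?mulr_gt0 // addr_gt0 // mulr_gt0.
move=> w N w0 wN; have /andP[wN1 wN2] := wN.
pose L := (w ^ 42)%N.
apply: (le_trans (collide_block_mean N L)).
have wR : 1 <= w%:R :> R by rewrite ler1n.
set x : R := w%:R in wR *.
have x0 : 0 < x by lra.
set v := x^-1.
have xv : x * v = 1 by rewrite mulfV // gt_eqF.
have v0 : 0 < v by rewrite invr_gt0.
have v1 : v <= 1 by rewrite invf_le1.
have vX0 k : 0 < v ^+ k by rewrite exprn_gt0.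
have xvX k : x ^+ k * v ^+ k = 1 by rewrite -exprMn xv expr1n.
have p : 0 < 2 ^+ N :> R by rewrite exprn_gt0.
pose dd := A1 * A2 * v ^+ 60.
have dd0 : 0 <= dd by apply: mulr_ge0; [apply: mulr_ge0|]; exact: ltW.
have S1 (y : int) : \sum_(l < 2 ^ N) Ex P (fun t => kerw (e1 t) (l + l) y y) *
    Ex P (fun t => kerw (e2 t) (l + l) y y) <= 2 ^+ N./2 + 2 ^+ N * dd.
  have N2 : (2 ^ N./2 <= 2 ^ N)%N by rewrite leq_exp2l // half_leq_self.
  rewrite -(big_mkord xpredT (fun l => Ex P (fun t => kerw (e1 t) (l + l) y y) *
    Ex P (fun t => kerw (e2 t) (l + l) y y))) (@big_cat_nat _ _ _ (2 ^ N./2)) //=.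
  apply: lerD.
    apply: (@le_trans _ _ (\sum_(0 <= l < 2 ^ N./2) 1)).
      apply: ler_sum_nat => l _.
      have /andP[u1 u2] := Ex_ker_le1 se1 (l + l) y y; have /andP[u3 u4] := Ex_ker_le1 se2 (l + l) y y.
      by rewrite -[leRHS]mulr1; exact: ler_pM.
    by rewrite big_const_nat iter_addr addr0 subn0 natrX.
  apply: (@le_trans _ _ (\sum_(2 ^ N./2 <= l < 2 ^ N) dd)).
    apply: ler_sum_nat => l /andP[lN _].
    have /andP[u1 _] := Ex_ker_le1 se1 (l + l) y y; have /andP[u3 _] := Ex_ker_le1 se2 (l + l) y y.
    have -> : dd = (A1 * v ^+ 30) * (A2 * v ^+ 30).
      by rewrite /dd (_ : v ^+ 60 = v ^+ 30 * v ^+ 30); [ring|rewrite -exprD].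
    by apply: ler_pM => //; [exact: H1 wN1 lN|exact: H2 wN1 lN].
  rewrite sumr_const_nat -[leLHS]mulr_natl ler_wpM2r // -natrX ler_nat; exact: leq_subr.
have S2 : \sum_(2 ^ N <= n < 2 ^ N.+1) Ex P (fun t => far (e1 t) n L) * Ex P (fun t => far (e2 t) n L) <=
    2 ^+ N * (B1 * B2 * v ^+ 20).
  apply: (@le_trans _ _ (\sum_(2 ^ N <= n < 2 ^ N.+1) B1 * B2 * v ^+ 20)).
    apply: ler_sum_nat => n /andP[_ nN].
    have -> : B1 * B2 * v ^+ 20 = (B1 * v ^+ 10) * (B2 * v ^+ 10).
      by rewrite (_ : v ^+ 20 = v ^+ 10 * v ^+ 10); [ring|rewrite -exprD].
    have f0 e t : (forall k, 0 < e k < 1) -> 0 <= far e n t :> R.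
      by move=> h; apply: iter_mop_ge0; [exact: wwt_ge0|move=> z; exact: ler0n].
    apply: ler_pM; [by apply: Ex_ge0 => t; exact: f0|by apply: Ex_ge0 => t; exact: f0| |].
      exact: G1 wN nN.
    exact: G2 wN nN.
  rewrite sumr_const_nat -[leLHS]mulr_natl [leLHS]mulrC [leRHS]mulrC ler_wpM2l //.
    by rewrite !mulr_ge0 // ltW.
  by rewrite -natrX ler_nat expnS mul2n -addnn addnK.
have S3 : (L + L + 1)%:R <= 3 * x ^+ 42.
  rewrite !natrD /L natrX; have : 1 <= x ^+ 42 by exact: exprn_ege1.
  by rewrite -/x; lra.
have S4 := K w N w0 wN1; rewrite -/x -/v in S4.
apply: (@le_trans _ _ ((2 ^+ N)^-1 * ((L + L + 1)%:R * (2 ^+ N./2 + 2 ^+ N * dd) +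
   2 ^+ N * (B1 * B2 * v ^+ 20)))).
  rewrite ler_pM2l ?invr_gt0 //; apply: lerD => //.
  apply: (@le_trans _ _ (\sum_(j < L + L + 1) (2 ^+ N./2 + 2 ^+ N * dd))).
    by apply: ler_sum => j _; exact: S1.
  by rewrite sumr_const card_ord -[leLHS]mulr_natl.
have -> : (2 ^+ N)^-1 * ((L + L + 1)%:R * (2 ^+ N./2 + 2 ^+ N * dd) + 2 ^+ N * (B1 * B2 * v ^+ 20)) =
  (L + L + 1)%:R * (2 ^+ N./2 / 2 ^+ N + dd) + B1 * B2 * v ^+ 20.
  by move: (L + L + 1)%:R (2 ^+ N./2) => a b; field; rewrite gt_eqF.
rewrite mulrDl; apply: lerD; last first.
  by rewrite ler_pM2l ?mulr_gt0 //; apply: ler_wiXn2l => //; exact: ltW.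
apply: (@le_trans _ _ (3 * x ^+ 42 * ((D + A1 * A2) * v ^+ 60))).
  apply: ler_pM => //.
    by apply: addr_ge0 => //; rewrite divr_ge0 // exprn_ge0.
  by rewrite mulrDl lerD2r.
have -> : v ^+ 60 = v ^+ 42 * v ^+ 18 by rewrite -exprD.
rewrite le_eqVlt; apply/orP; left; apply/eqP.
transitivity (3 * (x ^+ 42 * v ^+ 42) * (D + A1 * A2) * v ^+ 18); first by ring.
by rewrite xvX mulr1.
Qed.

Lemma dyadic_sum (a : nat -> R) q T : (0 < q)%N ->
  \sum_(n < 2 ^ (q * T)) a n = a 0%N + \sum_(t < T) \sum_(2 ^ (q * t) <= n < 2 ^ (q * t.+1)) a n.
Proof.
move=> q0; elim: T => [|T IH]; first by rewrite muln0 expn0 big_ord1 big_ord0 addr0.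
rewrite big_ord_recr /= addrA -IH -!(big_mkord xpredT a).
rewrite (@big_cat_nat _ _ _ (2 ^ (q * T))) //=.
by rewrite leq_exp2l // leq_pmul2l.
Qed.

(** Two dyadic levels: times are grouped by their exponent [N], and exponents by [w = 2 ^ t] with
    [N] between [w ^ 16] and [(2 * w) ^ 16]. The group has O(w ^ 16) exponents, each contributing
    O(w ^ -18), so the sum over [t] is geometric. *)
Lemma collide_summable : {ae P, forall t, exists K, forall B,
  \sum_(n < B) srw_return R n./2 ^+ 2 * collide (e1 t) (e2 t) n <= K}.
Proof.
have [C C0 H] := collide_scale.
pose f n t := srw_return R n./2 ^+ 2 * collide (e1 t) (e2 t) n.
have bf n : bmf (f n) by apply: bmfZ; exact: bmf_collide.
have f0 n t : 0 <= f n t by rewrite mulr_ge0 ?sqr_ge0 // collide_ge0.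
pose a n := Ex P (f n).
have a0 n : 0 <= a n by apply: Ex_ge0.
pose g N := \sum_(2 ^ N <= n < 2 ^ N.+1) a n.
have g0 N : 0 <= g N by apply: sumr_ge0.
have gE N : g N = Ex P (fun t => \sum_(2 ^ N <= n < 2 ^ N.+1) f n t) by rewrite Ex_sum.
pose C' := 2 ^+ 16 * C.
have gT t : \sum_(2 ^ (16 * t) <= N < 2 ^ (16 * t.+1)) g N <= C' / 2 ^+ t.
  have E : (2 ^ (16 * t.+1) = (2 * 2 ^ t) ^ 16)%N by rewrite -expnS -expnM mulnC.
  have E' : (2 ^ (16 * t) = (2 ^ t) ^ 16)%N by rewrite -expnM mulnC.
  pose v : R := (2 ^+ t)^-1.
  have v0 : 0 < v by rewrite invr_gt0 exprn_gt0.
  have v1 : v <= 1 by rewrite invf_le1 ?exprn_gt0 // exprn_ege1 // ler1n.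
  apply: (@le_trans _ _ (\sum_(2 ^ (16 * t) <= N < 2 ^ (16 * t.+1)) C * v ^+ 18)).
    apply: ler_sum_nat => N /andP[n1 n2]; rewrite gE /v.
    have -> : 2 ^+ t = (2 ^ t)%N%:R :> R by rewrite natrX.
    apply: H; first by rewrite expn_gt0.
    by rewrite -E' n1 -E ltnW.
  rewrite sumr_const_nat -[leLHS]mulr_natl.
  apply: (@le_trans _ _ ((2 ^+ 16 * (2 ^+ t) ^+ 16) * (C * v ^+ 18))).
    rewrite ler_wpM2r ?mulr_ge0 ?(ltW C0) ?exprn_ge0 ?(ltW v0) //.
    rewrite -exprMn -exprS -exprM mulnC -natrX ler_nat; exact: leq_subr.
  have vE : (2 ^+ t) ^+ 16 * v ^+ 16 = 1 :> R.
    by rewrite -exprMn mulfV ?expr1n // gt_eqF // exprn_gt0.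
  have -> : v ^+ 18 = v ^+ 16 * v ^+ 2 by rewrite -exprD.
  have -> : 2 ^+ 16 * (2 ^+ t) ^+ 16 * (C * (v ^+ 16 * v ^+ 2)) =
    C' * ((2 ^+ t) ^+ 16 * v ^+ 16) * v ^+ 2.
    by rewrite /C'; set z := 2 ^+ 16; set z' := (2 ^+ t) ^+ 16; set z'' := v ^+ 16; ring.
  rewrite vE mulr1 ler_wpM2l //; first by rewrite /C' mulr_ge0 ?(ltW C0) // exprn_ge0.
  by rewrite -[leRHS]expr1 -/v; apply: ler_wiXn2l => //; exact: ltW.
have gsum T : \sum_(t < T) C' / 2 ^+ t <= 2 * C'.
  have : \sum_(t < T) C' / 2 ^+ t = 2 * C' - 2 * C' / 2 ^+ T.
    elim: T => [|T IH]; first by rewrite big_ord0 expr0 divr1 subrr.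
    by rewrite big_ord_recr /= IH exprS; field; rewrite expf_neq0 // pnatr_eq0.
  move=> ->; have : 0 <= 2 * C' / 2 ^+ T by rewrite divr_ge0 ?exprn_ge0 // /C' !mulr_ge0 ?(ltW C0) // exprn_ge0.
  by lra.
have mono (h : nat -> R) B B' : (forall n, 0 <= h n) -> (B <= B')%N ->
    \sum_(n < B) h n <= \sum_(n < B') h n.
  move=> h0 BB; rewrite -!(big_mkord xpredT h) (@big_cat_nat _ _ _ B 0 B') //= lerDl.
  by apply: sumr_ge0.
apply: (@ae_bounded_sums _ _ _ P f (a 0%N + (g 0%N + 2 * C')) bf f0) => B.
have BB : (B <= 2 ^ (16 * B))%N.
  by apply: (leq_trans (ltnW (ltn_expl B (isT : (1 < 2)%N)))); rewrite leq_exp2l // leq_pmull.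
apply: (le_trans (mono a _ _ a0 (leq_trans BB (ltnW (ltn_expl _ (isT : (1 < 2)%N)))))).
have := dyadic_sum a (2 ^ (16 * B)) (isT : (0 < 1)%N); rewrite mul1n => ->.
rewrite lerD2l; apply: (@le_trans _ _ (\sum_(N < 2 ^ (16 * B)) g N)).
  by apply: ler_sum => N _; rewrite /g !mul1n.
rewrite (dyadic_sum g B (isT : (0 < 16)%N)) lerD2l.
by apply: le_trans (gsum B); apply: ler_sum => t _; exact: gT.
Qed.

End CollisionMean.

Lemma pr0_of_geometric (R : realType) (p q : R) : 0 < p -> p <= 1 -> 0 <= q ->
  (forall n, q <= (1 - p) ^+ n) -> q = 0.
Proof.
move=> p0 p1 q0 H; apply/eqP; rewrite eq_le q0 andbT leNgt; apply/negP => q1.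
have [n hn] : exists n : nat, (p * q)^-1 < n%:R.
  have pq : 0 <= (p * q)^-1 by rewrite invr_ge0 ltW // mulr_gt0.
  by exists (Num.bound (p * q)^-1); have := archi_boundP pq.
have h1 : (1 - p) ^+ n <= expR (- (n%:R * p)).
  rewrite -mulrN expRM_natl lerXn2r ?nnegrE ?expR_ge0 ?subr_ge0 //.
  by have := expR_ge1Dx (- p); lra.
have h2 := le_trans (H n) h1; rewrite expRN in h2.
have e0 := expR_gt0 (n%:R * p); have h3 := expR_ge1Dx (n%:R * p).
have h4 : q * expR (n%:R * p) <= 1.
  by apply: le_trans (ler_wpM2r (ltW e0) h2) _; rewrite mulVf ?gt_eqF.
have h5 : 1 < n%:R * (p * q) by rewrite -ltr_pdivrMr ?mulr_gt0 // mul1r.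
have h6 : q * (1 + n%:R * p) <= q * expR (n%:R * p) by rewrite ler_pM2l.
by lra.
Qed.

Lemma ae_infinitely_often d (T : measurableType d) (R : realType) (P : probability T R)
    (A : nat -> T -> bool) (p : R) : 0 < p -> p <= 1 ->
  (forall i, measurable_fun setT (A i)) ->
  (forall i n, Ex P (fun w => \prod_(k < n) (~~ A (i + k)%N w)%:R) <= (1 - p) ^+ n) ->
  {ae P, forall w, forall i, exists2 k, (i <= k)%N & A k w}.
Proof.
move=> p0 p1 mA H; apply: ae_foralln => i.
pose B n : set T := [set w | [forall k : 'I_n, ~~ A (i + k)%N w]].
have mB n : measurable (B n).
  rewrite (_ : B n = \bigcap_(k in [set` 'I_n]) [set w | ~~ A (i + k)%N w]).
    apply: fin_bigcap_measurable => // k _.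
    have := @measurable_neg _ _ setT (A (i + k)%N) (mA _).
    by move=> h; have := h measurableT [set true] I; rewrite setTI.
  apply/seteqP; split=> w.
    by move=> /forallP h k _; exact: h.
  by move=> h; apply/forallP => k; exact: h.
have bB n : measurable_fun setT (fun w => [forall k : 'I_n, ~~ A (i + k)%N w]).
  by apply: (@measurable_fun_bool _ _ _ _ true); rewrite setTI; exact: mB.
exists (\bigcap_n B n); split.
- exact: bigcapT_measurable.
- have mC : measurable (\bigcap_n B n) by exact: bigcapT_measurable.
  suff E : pr P (\bigcap_n B n) = 0 by have := prE P mC; rewrite E.
  apply: (pr0_of_geometric p0 p1); first exact: pr_ge0.
  move=> n; apply: le_trans (H i n).
  apply: (@le_trans _ _ (pr P (B n))).
    by apply: pr_le => // w; apply.
  rewrite -Ex_bool //; apply: Ex_le.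
  + exact: bmf_bool.
  + elim: n => [|n IH].
      rewrite (_ : (fun w => _) = (fun=> 1)); first exact: bmf_cst.
      by apply/funext => w; rewrite big_ord0.
    rewrite (_ : (fun w => _) = (fun w => \prod_(k < n) (~~ A (i + k)%N w)%:R * (~~ A (i + n)%N w)%:R)).
      by apply: bmfM => //; apply: bmf_bool; exact: measurable_neg.
    by apply/funext => w; rewrite big_ord_recr.
  + move=> w; case: forallP => h; last by apply: prodr_ge0 => k _; exact: ler0n.
    by rewrite big1 // => k _; rewrite h.
- move=> w /= h n _; apply/forallP => k; apply/negP => Ak; apply: h.
  by exists (i + k)%N => //; exact: leq_addr.
Qed.

(** The exponential inequalities reduce to [key], a polynomial against [expR (N / 4)], with powers
    of 2 compared to exponentials through e^(1/2) <= 2 <= e. The constant 128 in [A] absorbs the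
    numerical factors. *)
Lemma valley_scale_eventually (R : realType) (cc : R) M : 0 < cc ->
  exists N1 : nat, forall N, (N1 <= N)%N -> valley_scale cc M N.
Proof.
move=> c0; have F1 : 1 <= pi_factor cc by rewrite /pi_factor lerDl expR_ge0.
pose D : R := M%:R * cc * 2.
have D0 : 0 <= D by rewrite /D !mulr_ge0 // ltW.
have e1 : 1 <= expR (2 * D) by rewrite -[leLHS]expR0 ler_expR; lra.
pose A := 128 * (pi_factor cc * expR (2 * D)).
have PE : 1 <= pi_factor cc * expR (2 * D) by rewrite -[leLHS]mulr1; apply: ler_pM; lra.
(* [W ^ 2] is of order [N ^ 8]; the ninth power of [N] absorbs the constants once [N >= B]. *)
have [C C0 E] := pow_expRN R 9.
pose B := (2 * M + 3)%:R ^+ 2 * A * (4 ^+ 9 * C) + 8 * D.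
have A0 : 0 < A by rewrite mulr_gt0 //; lra.
have T0 : 0 <= (2 * M + 3)%:R ^+ 2 * A * (4 ^+ 9 * C).
  apply: mulr_ge0; first by apply: mulr_ge0; [exact: sqr_ge0|exact: ltW].
  by apply: mulr_ge0; [exact: exprn_ge0|exact: ltW].
have B0 : 0 <= B by rewrite addr_ge0 // mulr_ge0.
exists (Num.bound B + 1)%N => N hN.
have NB : B <= N%:R.
  apply: (ltW (lt_le_trans (archi_boundP B0) _)); rewrite ler_nat.
  by apply: leq_trans hN; exact: leq_addr.
have N1 : 1 <= N%:R :> R by rewrite ler1n; apply: leq_trans hN; rewrite addn1.
have N0 : 0 < N%:R :> R by lra.
set W := (2 * N ^ 4 + 2 * M + 1)%N.
have W1 : 1 <= W%:R :> R by rewrite ler1n /W addn1.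
have WN : W%:R <= (2 * M + 3)%:R * N%:R ^+ 4 :> R.
  have N4 : 1 <= N%:R ^+ 4 :> R by exact: exprn_ege1.
  rewrite /W 2!natrD (natrM _ 2 (N ^ 4)) (natrX _ N 4) (natrM _ 2 M) (natrD _ (2 * M) 3) (natrM _ 2 M).
  have : 0 <= M%:R :> R by [].
  by set m := M%:R; set n4 := N%:R ^+ 4 in N4 *; nra.
have key : W%:R ^+ 2 * A <= expR (N%:R / 4).
  have h1 : W%:R ^+ 2 <= (2 * M + 3)%:R ^+ 2 * N%:R ^+ 8 :> R.
    rewrite (_ : N%:R ^+ 8 = (N%:R ^+ 4) ^+ 2); last by rewrite -exprM.
    rewrite -exprMn lerXn2r ?nnegrE ?mulr_ge0 ?exprn_ge0 //.
  have h2 : N%:R ^+ 8 * N%:R <= 4 ^+ 9 * C * expR (N%:R / 4).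
    have := E (N%:R / 4); rewrite expRN ler_pdivrMr ?expR_gt0 // => h.
    have := h (divr_ge0 (ltW N0) (ler0n R 4)) => h3.
    rewrite -exprSr (_ : N%:R ^+ 9 = 4 ^+ 9 * (N%:R / 4) ^+ 9); last first.
      by rewrite -exprMn; congr (_ ^+ _); field.
    by rewrite -mulrA ler_pM2l // exprn_gt0.
  have h3 : (2 * M + 3)%:R ^+ 2 * A * (4 ^+ 9 * C) <= N%:R by move: NB; rewrite /B; lra.
  rewrite -(ler_pM2r N0).
  have P0 : 0 <= (2 * M + 3)%:R ^+ 2 * A :> R by rewrite mulr_ge0 ?sqr_ge0 // ltW.
  have h4 := ler_wpM2l P0 h2.
  have h5 := ler_wpM2r (expR_ge0 (N%:R / 4)) h3.
  have h6 := ler_wpM2r (ltW N0) (ler_wpM2r (ltW A0) h1).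
  apply: (le_trans h6).
  have -> : (2 * M + 3)%:R ^+ 2 * N%:R ^+ 8 * A * N%:R =
     (2 * M + 3)%:R ^+ 2 * A * (N%:R ^+ 8 * N%:R) by ring.
  apply: (le_trans h4); rewrite mulrA [leRHS]mulrC; exact: h5.
have e14 : 1 <= expR (N%:R / 4) :> R by rewrite -[leLHS]expR0 ler_expR; lra.
have WW : W%:R <= W%:R ^+ 2 :> R by rewrite expr2 -[leLHS]mulr1 ler_wpM2l.
have q0 : 0 <= pi_factor cc * expR (2 * D) by lra.
have h4N : expR (2 * N%:R) <= 2 ^+ (4 * N) :> R.
  apply: le_trans (expR_half_le R _); rewrite ler_expR natrM; lra.
have W2 : 0 <= W%:R ^+ 2 :> R by exact: sqr_ge0.
have WE : W%:R * expR (2 * D) <= W%:R ^+ 2 * (pi_factor cc * expR (2 * D)).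
  have pe : expR (2 * D) <= pi_factor cc * expR (2 * D).
    by rewrite -[leLHS]mul1r; apply: ler_wpM2r => //; exact: expR_ge0.
  by apply: (le_trans (ler_wpM2r (expR_ge0 (2 * D)) WW)); exact: ler_wpM2l.
split; rewrite -/W -/D.
- rewrite addrC expRD.
  have -> : W%:R ^+ 2 * (pi_factor cc * (expR (2 * D) * expR (5 / 4 * N%:R))) =
    (W%:R ^+ 2 * A) * (expR (5 / 4 * N%:R)) / 128 by rewrite /A; field.
  have h := ler_wpM2r (expR_ge0 (5 / 4 * N%:R)) key.
  rewrite -expRD in h.
  have h2 : expR (N%:R / 4 + 5 / 4 * N%:R) <= expR (2 * N%:R) :> R by rewrite ler_expR; lra.
  have h3 := expR_ge0 (2 * N%:R : R).
  move: h h2 h3 h4N; set a := _ * A * _; set b := expR (2 * _); set c := 2 ^+ _; set z := expR (_ + _); lra.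
- rewrite expRD mulrA.
  have h1 : W%:R * expR (2 * D) <= expR (N%:R / 4) / 4.
    move: WE key; rewrite /A mulrCA; set a := _ * (_ * _); have := expR_gt0 (N%:R / 4 : R); lra.
  apply: (le_trans (ler_wpM2r (expR_ge0 _) h1)).
  have g : expR (N%:R / 4) * expR (- (6 * N%:R)) <= 1 :> R.
    by rewrite -expRD -[leRHS]expR0 ler_expR; lra.
  by move: g; set a := expR _; set b := expR _; lra.
- have h6 : 2 ^+ (6 * N) <= expR (6 * N%:R) :> R.
    by apply: (le_trans (two_le_expR R _)); rewrite natrM.
  have h1 : 2 ^+ (6 * N) + 1 <= 2 * expR (6 * N%:R) :> R.
    have : 1 <= expR (6 * N%:R) :> R by rewrite -[leLHS]expR0 ler_expR; lra.
    by lra.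
  have F0 : 0 <= pi_factor cc * expR (- 7 * N%:R) by rewrite mulr_ge0 ?expR_ge0 //; lra.
  apply: (le_trans (ler_wpM2r F0 h1)).
  have -> : 2 * expR (6 * N%:R) * (pi_factor cc * expR (- 7 * N%:R)) = 2 * pi_factor cc * expR (- N%:R).
    have -> : expR (- N%:R) = expR (6 * N%:R) * expR (- 7 * N%:R) :> R.
      by rewrite -expRD; congr expR; ring.
    by ring.
  have h2 : 2 * pi_factor cc <= expR (N%:R / 4) / 4.
    have h3 : pi_factor cc <= pi_factor cc * expR (2 * D) by rewrite -[leLHS]mulr1 ler_pM2l //; lra.
    have h5 : 1 * A <= W%:R ^+ 2 * A by rewrite ler_wpM2r // /A; lra.
    by move: key h5; rewrite /A; lra.
  apply: (le_trans (ler_wpM2r (expR_ge0 _) h2)).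
  have g : expR (N%:R / 4) * expR (- N%:R) <= 1 :> R.
    by rewrite -expRD -[leRHS]expR0 ler_expR; lra.
  by move: g; set a := expR _; set b := expR _; lra.
- rewrite expRD mulrA.
  have h1 : W%:R * expR (2 * D) <= expR (N%:R / 4).
    move: WE key; rewrite /A mulrCA; set a := _ * (_ * _); have := expR_gt0 (N%:R / 4 : R); lra.
  apply: (le_trans (ler_wpM2r (expR_ge0 _) h1)).
  by rewrite -expRD -[leRHS]expR0 ler_expR; lra.
- have h5 : W%:R ^+ 2 * 128 <= W%:R ^+ 2 * A by rewrite ler_wpM2l // /A; lra.
  have h2 : expR (N%:R / 4) <= expR (2 * N%:R) :> R by rewrite ler_expR; lra.
  move: h5 h2 h4N key; set a := W%:R ^+ 2; set b := a * A; set c := 2 ^+ _; lra.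
- by apply: le_trans NB; rewrite /B lerDr.
Qed.

Lemma quot_le (R : realType) (a s t u x : R) : 0 < s -> 0 < u -> 0 < x ->
  a <= t * x ^+ 2 -> t <= s * x ^+ 2 * u -> a / (s * x ^+ 4) <= u.
Proof.
move=> s0 u0 x0 ha ht; rewrite ler_pdivrMr ?mulr_gt0 ?exprn_gt0 //; apply: (le_trans ha).
have -> : u * (s * x ^+ 4) = s * x ^+ 2 * u * x ^+ 2 by ring.
by rewrite ler_pM2r ?exprn_gt0.
Qed.

Lemma inv_halves (R : realType) : 128^-1 <= 64^-1 - 128^-1 :> R.
Proof. by lra. Qed.

Lemma good_product (R : realType) (a b : R) : 128^-1 <= a -> b <= 63 / 64 ->
  128^-1 * 64^-1 <= a * (1 - b).
Proof. by move=> ha hb; apply: ler_pM; lra. Qed.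

Lemma summand_le (R : realType) (c u v : R) : 0 < c -> 0 < u -> 0 < v ->
  u <= 3 * c + 1 + u + v /\ v <= 3 * c + 1 + u + v.
Proof. by move=> *; split; lra. Qed.

(** * Existence of valleys *)

Section ScaleNumerics.
Variables (R : realType) (x c s sp : R).
Hypotheses (c0 : 0 < c) (s0 : 0 < s) (sp0 : 0 < sp) (x1 : 1 <= x) (cx : 3 * c <= x)
  (sx : 72 * 72 <= s * x) (spx : 64 * 56 <= sp * x).

Let x0 : 0 < x. Proof. by have h := x1; lra. Qed.

Let big k t : 0 < t -> k <= t * x -> k <= t * x ^+ 2.
Proof.
move=> t0 h; apply: (le_trans h); rewrite expr2 ler_pM2l // -[leLHS]mulr1 ler_pM2l //.
Qed.

Let sqr_le a k : 0 <= a -> a <= k * x -> a ^+ 2 <= k ^+ 2 * x ^+ 2.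
Proof. by move=> a0 h; rewrite -exprMn lerXn2r ?nnegrE //; exact: le_trans h. Qed.

(** Here [x] is the scale [N] and [x ^+ 4] the number of explored sites, so time terms are O(x ^
    -2). The thresholds 72 * 72 = 9 ^ 2 * 64 and 64 * 56 = 8 ^ 2 * 56 come from [left_numerics] and
    [stage_numerics]. *)
Lemma entry_numerics : (x / 2 + c) / (x + c) + (x + c) ^+ 2 / (s * x ^+ 4) +
  (x + c) ^+ 2 / (sp * x ^+ 4) <= 3 / 4.
Proof.
have c0' := c0; have x0' := x0; have cx' := cx.
have a1 : (x / 2 + c) / (x + c) <= 5 / 8 by rewrite ler_pdivrMr; lra.
have q : (x + c) ^+ 2 <= 2 ^+ 2 * x ^+ 2 by apply: sqr_le; lra.
have a2 : (x + c) ^+ 2 / (s * x ^+ 4) <= 1 / 16.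
  by apply: quot_le q _ => //; have := big s0 sx; set y := s * _; lra.
have a3 : (x + c) ^+ 2 / (sp * x ^+ 4) <= 1 / 16.
  by apply: quot_le q _ => //; have := big sp0 spx; set y := sp * _; lra.
by apply: (le_trans (lerD (lerD a1 a2) a3)); lra.
Qed.

Lemma stage_numerics : (7 * x + c) ^+ 2 / (sp * x ^+ 4) <= 1 / 56.
Proof.
have c0' := c0; have x0' := x0; have cx' := cx.
have q : (7 * x + c) ^+ 2 <= 8 ^+ 2 * x ^+ 2 by apply: sqr_le; lra.
by apply: quot_le q _ => //; have := big sp0 spx; set y := sp * _; lra.
Qed.

Lemma left_numerics :
  (7 * x + c) / (x / 4 + 7 * x + c) + (x / 4 + 7 * x + c) ^+ 2 / (s * x ^+ 4) <= 63 / 64.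
Proof.
have c0' := c0; have x0' := x0; have cx' := cx.
have a1 : (7 * x + c) / (x / 4 + 7 * x + c) <= 31 / 32 by rewrite ler_pdivrMr; lra.
have q : (x / 4 + 7 * x + c) ^+ 2 <= 9 ^+ 2 * x ^+ 2 by apply: sqr_le; lra.
have a2 : (x / 4 + 7 * x + c) ^+ 2 / (s * x ^+ 4) <= 1 / 64.
  by apply: quot_le q _ => //; have := big s0 sx; set y := s * _; lra.
by apply: (le_trans (lerD a1 a2)); lra.
Qed.

(** A stage is entered with probability at least 1/4, and 7 * (1 / 56) = 1/8 is half of that; the
    remaining [x / 8] is divided by [7 * x + c]. *)
Lemma good_numerics (a b : R) : a <= 3 / 4 -> b <= 1 / 56 ->
  64^-1 <= (x * (1 - a) - 7 * x * b) / (7 * x + c).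
Proof.
have c0' := c0; have x0' := x0; have cx' := cx => h1 h2.
rewrite ler_pdivlMr; last by lra.
by have b1 := ler_wpM2l (ltW x0) h1; have b2 := ler_wpM2l (ltW x0) h2; lra.
Qed.

Lemma mass_numerics (a b q : R) : 0 < a -> 0 < b -> 0 < q ->
  (a + b * ((7 * x + c) / q)) / (7 * x * (128 * (a + b * ((7 + c) / q)))) <= 128^-1.
Proof.
move=> a0 b0 q0; have c0' := c0; have x0' := x0.
set G := a + b * ((7 + c) / q).
have G0 : 0 < G by rewrite addr_gt0 // mulr_gt0 // divr_gt0 //; lra.
have h : a + b * ((7 * x + c) / q) <= G * x.
  rewrite /G [leRHS]mulrDl; apply: lerD; first by rewrite -[leLHS]mulr1 ler_pM2l.
  rewrite -mulrA ler_pM2l // mulrAC ler_pM2r ?invr_gt0 //.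
  by have := ler_wpM2l (ltW c0) x1; lra.
rewrite ler_pdivrMr; last by rewrite !mulr_gt0.
apply: (le_trans h); have -> : 128^-1 * (7 * x * (128 * G)) = 7 * (G * x) by field.
by rewrite ler_peMl ?mulr_ge0 ?(ltW G0) ?(ltW x0) // ler1n.
Qed.

End ScaleNumerics.

Arguments pot : simpl never.

Section Valleys.
Context d (Om : measurableType d) (R : realType) (P : probability Om R).
Variables (om : int -> Om -> R) (cc s2 : R).
Hypothesis se : sinai_env P om cc s2.

Definition right_sites (M k : nat) : int := M%:Z + k.+1%:Z.
Definition left_sites (M k : nat) : int := - M%:Z - k%:Z.

Lemma right_sites_inj M : injective (right_sites M).
Proof. by move=> i j; rewrite /right_sites; lia. Qed.

Lemma left_sites_inj M : injective (left_sites M).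
Proof. by move=> i j; rewrite /left_sites; lia. Qed.

Lemma sites_disjoint M k z : seen (right_sites M) k z -> seen (left_sites M) k z -> False.
Proof. by move=> [i _ ->] [j _]; rewrite /right_sites /left_sites; lia. Qed.

Definition good_right C M N : Om -> bool :=
  right_good (incr om (right_sites M) 1) cc N%:R C (N ^ 4).

(** With sign 1 the path on the left sites is minus the potential: falling by [7 * N] before rising
    by [N / 4] means that the potential reaches the wall before dipping. This event is the failure
    of that. *)
Definition bad_left M N : Om -> bool :=
  exit_fail (incr om (left_sites M) 1) (7 * N%:R) (N%:R / 4) (N ^ 4).

Definition good_scale C M N w : bool := good_right C M N w && ~~ bad_left M N w.

Lemma good_scale_valley C M N w : cc < N%:R -> good_scale C M N w ->
  exists al bb cr, valley (env_at om w) M N al bb cr C.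
Proof.
move=> cN /andP[gr /negP/negP bl].
have c0 := sinai_cc se.
have N0 : 0 < N%:R :> R by lra.
have N7 : 0 < 7 * N%:R :> R by lra.
have N4 : 0 < N%:R / 4 :> R by lra.
have [al [alK al1 _ al3]] := exit_failP N7 N4 bl.
have [b [cr [crK [b1 b2 b3 b4 _] c3 c4]]] :=
  site_right_goodP (sinai_lrho se) c0 (expr1n _ 2) cN gr.
have El k : psum (fun i => incr om (left_sites M) 1 i w) k =
    - (pot (env_at om w) (- M%:Z - k%:Z) - pot (env_at om w) (- M%:Z)).
  by rewrite pot_left opprK; apply: eq_bigr => i _; rewrite /incr mul1r.
have Er k : psum (fun i => incr om (right_sites M) 1 i w) k =
    pot (env_at om w) (M%:Z + k%:Z) - pot (env_at om w) M.
  by rewrite pot_right; apply: eq_bigr => i _; rewrite /incr mul1r.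
exists al, b, cr; split.
- by split.
- by move=> i k h; have := b3 _ _ h; rewrite !Er; lra.
- by rewrite Er in b4; lra.
- by move: c3; rewrite /draw b2 !Er; lra.
- apply: le_trans c4; rewrite /mass big_ord_recr /= -[leLHS]addr0.
  apply: lerD; last exact: expR_ge0.
  apply: ler_sum => i _; rewrite b2 (Er b) (Er i) ler_expR; lra.
- by move=> k kl; have := al3 k kl; rewrite El; lra.
- by rewrite El in al1; lra.
Qed.

(** Half-open, so that consecutive annuli are disjoint and the corresponding scales independent. *)
Definition annulus (a b : nat) : set int := [set z | (a <= `|z|)%N /\ (`|z| < b)%N].

Lemma good_right_meas C M N :
  measurable_fun (setT : set (env_space om (annulus M (M + N ^ 4 + 1)))) (good_right C M N).
Proof.
apply: (env_fun_mono (J := seen (right_sites M) (N ^ 4))).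
  by move=> x [i iN ->]; rewrite /annulus /right_sites /=; lia.
exact: site_right_good_meas (sinai01 se) (sinai_lrho se) _ _ _ _ _.
Qed.

Lemma bad_left_meas M N :
  measurable_fun (setT : set (env_space om (annulus M (M + N ^ 4 + 1)))) (bad_left M N).
Proof.
apply: (env_fun_mono (J := seen (left_sites M) (N ^ 4))).
  by move=> x [i iN ->]; rewrite /annulus /left_sites /=; lia.
exact: site_exit_meas (sinai01 se) (sinai_lrho se) _ _ _ _ _.
Qed.

Lemma good_scale_meas C M N :
  measurable_fun (setT : set (env_space om (annulus M (M + N ^ 4 + 1)))) (good_scale C M N).
Proof.
apply: measurable_and; first exact: good_right_meas.
by apply: measurable_neg; exact: bad_left_meas.
Qed.

Lemma good_scale_prob : exists2 C : R, 0 < C & exists N0 : nat, forall M N, (N0 <= N)%N ->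
  cc < N%:R /\ 128^-1 * 64^-1 <= Ex P (fun w => (good_scale C M N w)%:R).
Proof.
have [mom ind o1 oc c0 s0 m0 m2] := se.
have sp := s2p_gt0 c0 s0.
(* This value satisfies both [lam <= 1 / 2] and [lam * cc <= 1]. *)
pose lam := 1 / 2 / (1 + cc).
have c1 : 0 < 1 + cc by lra.
have lam0 : 0 < lam by rewrite divr_gt0.
have lam1 : lam <= 1 / 2 by rewrite /lam ler_pdivrMr //; lra.
have lamc : lam * cc <= 1.
  by rewrite /lam mulrAC ler_pdivrMr //; lra.
pose q := kap lam * lam ^+ 2 / 4 * s2.
have q0 : 0 < q by rewrite /q mulr_gt0 // divr_gt0 // mulr_gt0 ?exprn_gt0 // kap_gt0.
have ly0 : 0 < lya cc by exact: expR_gt0.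
have lC0 : 0 < lyC cc by rewrite /lyC mulr_gt0 ?expR_gt0 //; lra.
pose G := lya cc + lyC cc * ((7 + cc) / q).
have G0 : 0 < G by rewrite addr_gt0 // mulr_gt0 // divr_gt0 //; lra.
(* [G * N] dominates the mean of [lym], so a sum above [C] has probability at most 1/128, half of
   the 1/64 of [good_numerics]. *)
pose C := 128 * G.
have C0 : 0 < C by rewrite /C mulr_gt0.
pose B := 3 * cc + 1 + (72 * 72) / s2 + (64 * 56) / s2p cc s2.
have i0 : 0 < s2^-1 by rewrite invr_gt0.
have i1 : 0 < (s2p cc s2)^-1 by rewrite invr_gt0.
have B0 : 0 <= B by rewrite /B; lra.
exists C => //; exists (Num.bound B) => M N hN.
have NB : B <= N%:R.
  by apply: (ltW (lt_le_trans (archi_boundP B0) _)); rewrite ler_nat.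
have N1 : 1 <= N%:R :> R by move: NB; rewrite /B; lra.
set x : R := N%:R in NB N1 *.
have x0 : 0 < x by lra.
have cx : 3 * cc <= x by move: NB; rewrite /B; lra.
have cN : cc < x by lra.
split=> //.
have K0 : (0 < N ^ 4)%N by rewrite expn_gt0 -(ltr_nat R) -/x x0.
have KE : (N ^ 4)%:R = x ^+ 4 by rewrite natrX.
have t1 : 0 < 72 * 72 / s2 by rewrite divr_gt0 // mulr_gt0.
have t2 : 0 < 64 * 56 / s2p cc s2 by rewrite divr_gt0 // mulr_gt0.
have sx : 72 * 72 <= s2 * x.
  by rewrite -ler_pdivrMl // mulrC; apply: le_trans NB; case: (summand_le c0 t1 t2).
have spx : 64 * 56 <= s2p cc s2 * x.
  by rewrite -ler_pdivrMl // mulrC; apply: le_trans NB; case: (summand_le c0 t1 t2).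
have HR : 128^-1 <= Ex P (fun w => (good_right C M N w)%:R).
  have := site_right_good_prob mom ind o1 oc c0 s0 m0 m2 (@right_sites_inj M) (expr1n _ 2)
    cN lam0 lam1 lamc K0 C0.
  rewrite -/(good_right C M N); apply: le_trans.
  have h1 : entry_fail cc s2 x (N ^ 4) <= 3 / 4.
    by rewrite /entry_fail KE; exact: entry_numerics.
  have h2 : (7 * x + cc) ^+ 2 / (s2p cc s2 * (N ^ 4)%:R) <= 1 / 56.
    by rewrite KE; exact: stage_numerics.
  have h3 : lym_bound cc s2 lam (7 * x) / (7 * x * C) <= 128^-1 by exact: mass_numerics.
  have h4 := good_numerics c0 N1 cx h1 h2.
  exact: le_trans (inv_halves R) (lerB h4 h3).
have HL : Ex P (fun w => (bad_left M N w)%:R) <= 63 / 64.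
  have x7 : 0 < 7 * x by rewrite mulr_gt0.
  have x4 : 0 < x / 4 by rewrite divr_gt0.
  apply: (le_trans (site_exit_prob mom ind o1 oc c0 s0 m0 m2 (@left_sites_inj M) (expr1n _ 2) x7 x4 K0)).
  by rewrite KE; exact: left_numerics.
have mr : measurable_fun (setT : set (env_space om (seen (right_sites M) (N ^ 4)))) (good_right C M N).
  exact: site_right_good_meas o1 oc _ _ _ _ _.
have ml : measurable_fun (setT : set (env_space om (seen (left_sites M) (N ^ 4)))) (bad_left M N).
  exact: site_exit_meas o1 oc _ _ _ _ _.
have br := bmf_bool R mr; have bl := bmf_bool R (measurable_neg ml).
have -> : Ex P (fun w => (good_scale C M N w)%:R) =
    Ex P (fun w => (good_right C M N w)%:R * (~~ bad_left M N w)%:R).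
  by apply: eq_Ex => w; rewrite /good_scale; case: (good_right _ _ _ _); case: (bad_left _ _ _) => /=; rewrite ?mulr1 ?mulr0.
have := env_indep_Ex mom ind _ br bl; move=> ->; last first.
  exact: sites_disjoint.
have -> : Ex P (fun w => (~~ bad_left M N w)%:R) = 1 - Ex P (fun w => (bad_left M N w)%:R).
  rewrite -[X in X - _](Ex_cst P) -ExB; first last.
  - have b1 := bmf_bool R ml; have b2 := bmf_env_sub mom b1; exact: b2.
  - exact: bmf_cst.
  by apply: eq_Ex => w; case: (bad_left _ _ _); rewrite /= ?subrr ?subr0.
set a := Ex P _ in HR *; set b := Ex P _ in HL *.
exact: good_product.
Qed.

End Valleys.

Section Blocks.
Context d (Om : measurableType d) (R : realType) (P : probability Om R).
Variables (om : int -> Om -> R) (cc s2 : R).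
Hypothesis se : sinai_env P om cc s2.

Lemma annulus_disjoint a b c z : annulus a b z -> annulus b c z -> False.
Proof. by rewrite /annulus /=; lia. Qed.

(** Scales are taken on successive annuli, each succeeding with the same positive probability
    independently of the others, so infinitely many succeed. The constant [a] is fixed before the
    environment because [C] is uniform. *)
Lemma good_sites_ae : exists2 a : R, 0 < a <= 1 & {ae P, forall w, forall M0 : nat,
  exists M N b, [/\ (M0 <= M)%N, (0 < N)%N & good_site (env_at om w) M N b a]}.
Proof.
have [C C0 [N0 H]] := good_scale_prob se.
have F1 : 1 <= pi_factor cc by rewrite /pi_factor lerDl expR_ge0.
exists (1 / (4 * (pi_factor cc * (C + 1)))).
  have h : 1 <= 4 * (pi_factor cc * (C + 1)) by nra.
  by rewrite divr_gt0 ?ler_pdivrMr ?mul1r //; lra.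
have [N1 HN1] := choice (fun M => valley_scale_eventually M (sinai_cc se)).
pose Nf M := (maxn (maxn N0 (N1 M)) 1)%N.
(* The next region starts where the sites explored at the current scale end, and its scale is chosen
   large compared with its size. *)
pose Ms := fix Ms i := if i is i'.+1 then (Ms i' + Nf (Ms i') ^ 4 + 1)%N else 0%N.
have MsS i : Ms i.+1 = (Ms i + Nf (Ms i) ^ 4 + 1)%N by [].
have Ms_mono i j : (i <= j)%N -> (Ms i <= Ms j)%N.
  move=> /subnK <-; elim: (j - i)%N => // k IH; rewrite addSn MsS -addnA.
  exact: leq_trans IH (leq_addr _ _).
have Ms_ge i : (i <= Ms i)%N.
  elim: i => // i IH; rewrite MsS addn1 ltnS; exact: leq_trans IH (leq_addr _ _).
clearbody Ms.
pose A i w := good_scale om cc C (Ms i) (Nf (Ms i)) w.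
have mA i : measurable_fun (setT : set (env_space om (annulus (Ms i) (Ms i.+1)))) (A i).
  by rewrite MsS; exact: good_scale_meas se _ _ _.
have mom := sinai_meas se.
have HN0 M : (N0 <= Nf M)%N by rewrite /Nf !leq_max leqnn.
have HNf M : (N1 M <= Nf M)%N by rewrite /Nf !leq_max leqnn orbT.
have Nf0 M : (0 < Nf M)%N by rewrite /Nf leq_max orbT.
have pA i : 128^-1 * 64^-1 <= Ex P (fun w => (A i w)%:R).
  by have [_] := H (Ms i) _ (HN0 (Ms i)).
have p0 : 0 < 128^-1 * 64^-1 :> R by rewrite mulr_gt0 // invr_gt0.
have p1 : 128^-1 * 64^-1 <= 1 :> R.
  by rewrite -[leRHS]mulr1; apply: ler_pM; rewrite ?invr_ge0 // invf_le1 // ler1n.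
have bN i : @bmf _ (env_space om (annulus (Ms i) (Ms i.+1))) R (fun w => (~~ A i w)%:R).
  by apply: bmf_bool; apply: measurable_neg.
have bP i n : @bmf _ (env_space om (annulus (Ms i) (Ms (i + n)%N))) R
   (fun w => \prod_(k < n) (~~ A (i + k)%N w)%:R).
  elim: n => [|n IH].
    rewrite (_ : (fun w => _) = (fun=> 1)); first exact: bmf_cst.
    by apply/funext => w; rewrite big_ord0.
  rewrite (_ : (fun w => _) = (fun w => \prod_(k < n) (~~ A (i + k)%N w)%:R * (~~ A (i + n)%N w)%:R)); last first.
    by apply/funext => w; rewrite big_ord_recr.
  apply: bmfM.
    apply: bmf_env_mono IH => z; rewrite /annulus /= => -[-> h]; split => //.
    by apply: leq_trans h _; apply: Ms_mono; rewrite leq_add2l.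
  apply: bmf_env_mono (bN (i + n)%N) => z; rewrite /annulus /= -addnS => -[h ->]; split => //.
  by apply: leq_trans h; apply: Ms_mono; exact: leq_addr.
have prod i n : Ex P (fun w => \prod_(k < n) (~~ A (i + k)%N w)%:R) <= (1 - 128^-1 * 64^-1) ^+ n.
  elim: n => [|n IH].
    rewrite expr0 -[leRHS](Ex_cst P) le_eqVlt; apply/orP; left; apply/eqP/eq_Ex => w.
    by rewrite big_ord0.
  have -> : Ex P (fun w => \prod_(k < n.+1) (~~ A (i + k)%N w)%:R) =
     Ex P (fun w => \prod_(k < n) (~~ A (i + k)%N w)%:R * (~~ A (i + n)%N w)%:R).
    by apply: eq_Ex => w; rewrite big_ord_recr.
  have E := env_indep_Ex mom (sinai_ind se) (@annulus_disjoint _ _ _) (bP i n) (bN (i + n)%N).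
  rewrite E exprSr; apply: ler_pM => //.
  - by apply: Ex_ge0 => w; apply: prodr_ge0 => k _; exact: ler0n.
  - by apply: Ex_ge0 => w; exact: ler0n.
  have bA := bmf_bool R (mA (i + n)%N); have bA' := bmf_env_sub mom bA.
  have -> : Ex P (fun w => (~~ A (i + n)%N w)%:R) = 1 - Ex P (fun w => (A (i + n)%N w)%:R).
    rewrite -[X in X - _](Ex_cst P) -ExB //; last exact: bmf_cst.
    by apply: eq_Ex => w; case: (A _ _); rewrite /= ?subrr ?subr0.
  by rewrite lerD2l lerN2.
have mA' i : measurable_fun (setT : set Om) (A i) := env_fun_sub mom (mA i).
apply: filterS (ae_infinitely_often p0 p1 mA' prod) => w inf M0.
have [k kM Ak] := inf M0.
have [cN _] := H (Ms k) _ (HN0 (Ms k)).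
have [al [bb [cr va]]] := good_scale_valley se cN Ak.
exists (Ms k), (Nf (Ms k)), ((Ms k)%:Z + bb%:Z); split => //.
  exact: leq_trans kM (Ms_ge k).
apply: valley_good_site va => //.
- by move=> z; exact: sinai01 se _ _.
- by move=> z; exact: sinai_lrho se _ _.
- exact: HN1 (HNf _).
Qed.

End Blocks.

Lemma wstep_bound (z : int) b (n : nat) : `|z| <= n%:Z -> `|wstep z b| <= n.+1%:Z.
Proof. by rewrite /wstep; case: b; lia. Qed.

Lemma wstep_parity (y z : int) b c : (exists i : int, y = z + i *+ 2) ->
  exists i : int, wstep y b = wstep z c + i *+ 2.
Proof.
move=> [i ->]; rewrite /wstep; case: b; case: c.
- by exists i; lia.
- by exists (i + 1); lia.
- by exists (i - 1); lia.
- by exists i; lia.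
Qed.

(** * Recurrence in one environment *)

Section Recurrence.
Context d (T : measurableType d) (R : realType) (Q : probability T R).
Variables (m r : nat) (S : 'I_m -> nat -> {mfun T >-> int})
  (Z : 'I_r -> nat -> {mfun T >-> int}) (e : env R r) (e0 : int -> R) (a : R).
Hypothesis m2 : m = 2%N.
Hypothesis e01 : forall j y, 0 < e j y < 1.
Hypothesis ee0 : forall j y, e j y = e0 y.
Hypothesis law : quenched_law Q S Z e 0.
Hypothesis a01 : 0 < a <= 1.
Hypothesis good : forall M0 : nat, exists M N b,
  [/\ (M0 <= M)%N, (0 < N)%N & good_site e0 M N b a].

Local Notation K := ('I_m + 'I_r)%type.

Definition in_cone (n : nat) (x : {ffun K -> int}) : bool := `[< same_parity n x >].
Definition together (x : {ffun K -> int}) : bool := [forall k, forall l, x k == x l].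

Lemma in_cone_step n x mv : in_cone n x -> in_cone n.+1 (pstep x mv).
Proof.
move=> /asboolP [x1 x2]; apply/asboolP; split=> [k|k l].
  rewrite /pstep ffunE; exact: wstep_bound (x1 k).
by rewrite /pstep !ffunE; exact: wstep_parity (x2 k l).
Qed.

Definition hit_bound : R := (a / 2) ^+ r / 256.

Lemma hit_bound01 : 0 < hit_bound <= 1.
Proof.
have /andP[a0 a1] := a01; rewrite /hit_bound divr_gt0 ?exprn_gt0 ?divr_gt0 //=.
rewrite ler_pdivrMr // mul1r; apply: (@le_trans _ _ 1); last by rewrite ler1n.
by apply: exprn_ile1; [rewrite divr_ge0 // ltW|lra].
Qed.

Definition apart (t0 n : nat) (x : {ffun K -> int}) : bool := (n < t0)%N || ~~ together x.

(** Induction on [q], the number of scales tried. The bound is uniform over the cone of reachable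
    states, so the past plays no part and each scale costs a factor [1 - hit_bound]. *)
Lemma surv_apart t0 q n : (t0 <= n)%N -> exists B, forall x, in_cone n x ->
  surv (@pstep K) (pwt (walker_env e)) (apart t0) B n x <= (1 - hit_bound) ^+ q.
Proof.
have /andP[h0 h1] := hit_bound01.
have w01 := walker_env01 (m := m) e01.
have w0 := pwt_ge0 w01; have w1 := pwt_sum1 (walker_env (m := m) e).
elim: q n => [|q IH] n tn.
  exists 0%N => x _; rewrite expr0 /=; by case: (apart _ _ _).
(* As [n <= M], the walks can first be run up to time [M], when they are still within distance [M],
   and then given [2 ^ (6 * N)] steps to meet at [b]. *)
have [M [N [b [nM N0 gs]]]] := good n.
pose B := (2 ^ (6 * N)).-1.
have BE : (B.+1 = 2 ^ (6 * N))%N by rewrite /B prednK // expn_gt0.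
have [|N' HN'] := IH (M + B).+1.
  by apply: (leq_trans tn); apply: leqW; apply: (leq_trans nM); exact: leq_addr.
exists ((M - n) + (B + N').+1)%N => x Xx.
have s0 : 0 <= (1 - hit_bound) ^+ q by rewrite exprn_ge0 // subr_ge0.
apply: (surv_start w0 w1 (X := in_cone)) => //.
- by rewrite exprn_ge0 // subr_ge0.
- by move=> k z mv; exact: in_cone_step.
move=> z; rewrite subnKC // => Xz.
apply: (@le_trans _ _ (surv (@pstep K) (pwt (walker_env e)) (fun _ y => y != [ffun=> b]) B M z *
   (1 - hit_bound) ^+ q)).
  apply: (surv_avoid w0 w1 (X := in_cone)) => //.
  - by move=> k y mv; exact: in_cone_step.
  move=> k y Mk _; rewrite /apart ltnNge (leq_trans (leq_trans tn nM) Mk) /=.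
  apply: contraNneq => ->; apply/forallP => i; apply/forallP => j.
  by rewrite !ffunE.
rewrite exprS; apply: ler_wpM2r => //.
rewrite surv_first_hit // BE lerD2l lerN2.
have /andP[a0 a1] := a01.
by apply: (joint_hit_lower m2 N0 e01 ee0 a0 a1 gs); move/asboolP: Xz.
Qed.

Lemma never_again_null t0 : pr Q (\bigcap_(n in [set n | (t0 <= n)%N]) ~` [set t | meet S Z 2 r n t]) = 0.
Proof.
have /andP[h0 h1] := hit_bound01.
set A := \bigcap_(n in _) _.
have mA : measurable A.
  by apply: bigcap_measurable => [|n _]; [exists t0 => /=|apply: measurableC; exact: meet_measurable].
apply: (pr0_of_geometric h0 h1); first exact: pr_ge0.
move=> q; have [B HB] := surv_apart q (leqnn t0).
have w01 := walker_env01 (m := m) e01.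
have w0 := pwt_ge0 w01; have w1 := pwt_sum1 (walker_env (m := m) e).
apply: (@le_trans _ _ (pr Q (path_ok S Z (apart t0) 0 (t0 + B)))).
  apply: pr_le => //; first exact: path_ok_measurable.
  move=> t At k _; rewrite /apart; have [//|tk] := ltnP k t0.
  apply/negP => /forallP tg; apply: (At k tk); rewrite meetE /=.
  have i0 : K by left; rewrite m2; exact: ord0.
  exists (state S Z k t i0) => l _; have /forallP /(_ i0) /eqP := tg l; exact.
apply: (le_trans (pr_path_ok e01 law (apart t0) (t0 + B))).
apply: (surv_start w0 w1 (X := in_cone)) => //.
- by rewrite exprn_ge0 // subr_ge0.
- by move=> k z mv; exact: in_cone_step.
apply/asboolP; have E k : walker_start (0 : 'rV[int]_(m + r)) k = 0.
  by rewrite ffunE; case: k => i; rewrite mxE.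
by split=> [k|k l]; rewrite !E //; exists 0.
Qed.

Lemma meet_infinitely_often_sure : Q (meet_infinitely_often S Z 2 r) = 1%E.
Proof.
have mM := meet_infinitely_often_measurable S Z 2 r.
suff H : Q (~` meet_infinitely_often S Z 2 r) = 0%E.
  by have := probability_setC Q (measurableC mM); rewrite setCK H sube0.
pose A t0 := \bigcap_(n in [set n | (t0 <= n)%N]) ~` [set t | meet S Z 2 r n t].
have mA t0 : measurable (A t0).
  by apply: bigcap_measurable => [|n _]; [exists t0 => /=|apply: measurableC; exact: meet_measurable].
have nA t0 : Q.-negligible (A t0).
  exists (A t0); split => //; have := prE Q (mA t0); rewrite /A never_again_null; exact.
have : Q.-negligible (~` meet_infinitely_often S Z 2 r).
  apply: negligibleS (negligible_bigcup nA) => t.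
  rewrite meet_infinitely_oftenE => /= nt; apply: contrapT => H; apply: nt => n _.
  apply: contrapT => H'; apply: H; exists n => // k nk mk; apply: H'.
  by exists k.
by move/negligibleP; apply; exact: measurableC.
Qed.

End Recurrence.

(** * Clipping the environments *)

Section Clip.
Variables (R : realType) (eps : R).
Hypotheses (eps0 : 0 < eps) (eps1 : eps < 1 / 2).

(** Makes ellipticity hold surely, so that all functionals of the environment are bounded; by
    [clipped_ae] it changes almost no environment. *)
Definition clip (p : R) : R := Num.max eps (Num.min p (1 - eps)).

Lemma clip_bounds p : eps <= clip p <= 1 - eps.
Proof.
have e0 := eps0; have e1 := eps1.
rewrite /clip le_max lexx /= ge_max ge_min lexx orbT andbT; lra.
Qed.

Lemma clip_id p : eps <= p <= 1 - eps -> clip p = p.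
Proof. by move=> /andP[a b]; rewrite /clip min_l // max_r. Qed.

Lemma clip01 p : 0 < clip p < 1.
Proof.
have e0 := eps0; have e1 := eps1; have /andP[a b] := clip_bounds p.
by apply/andP; split; lra.
Qed.

Lemma measurable_clip : measurable_fun setT clip.
Proof.
apply: measurable_maxr; first exact: measurable_cst.
by apply: measurable_minr; [exact: measurable_id|exact: measurable_cst].
Qed.

Definition lclip (p : R) : R := ln (rho (clip p)).

Definition lclip_bound : R := ln ((1 - eps) / eps).

Lemma lclip_bound_gt0 : 0 < lclip_bound.
Proof.
by have e0 := eps0; have e1 := eps1; apply: ln_gt0; rewrite ltr_pdivlMr //; lra.
Qed.

Lemma lclip_le p : `|lclip p| <= lclip_bound.
Proof.
have e0 := eps0; have e1 := eps1; have /andP[a b] := clip_bounds p.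
have q0 : 0 < clip p by lra.
have r0 : 0 < rho (clip p) by rewrite /rho divr_gt0 //; lra.
have h0 : 0 < (1 - eps) / eps by rewrite divr_gt0 //; lra.
rewrite ler_norml /lclip /lclip_bound -lnV ?posrE // !ler_ln ?posrE ?invr_gt0 //.
rewrite /rho invf_div; apply/andP; split.
  rewrite ler_pdivrMr ?subr_gt0; last by lra.
  rewrite mulrAC ler_pdivlMr //; nra.
rewrite ler_pdivrMr // mulrAC ler_pdivlMr //; nra.
Qed.

Lemma measurable_lclip : measurable_fun setT lclip.
Proof.
rewrite (_ : lclip = (fun p => ln (1 - clip p) - ln (clip p))).
  apply: measurable_funB; apply: measurableT_comp => //; last exact: measurable_clip.
  by apply: measurable_funB; [exact: measurable_cst|exact: measurable_clip].
apply/funext => p; rewrite /lclip /rho; have /andP[a b] := clip01 p.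
by rewrite ln_div ?posrE ?subr_gt0.
Qed.

End Clip.

Lemma mutually_independent_sub d (T : measurableType d) (R : realType) (P : probability T R)
    (K : choiceType) (G G' : K -> set_system T) : (forall k, G' k `<=` G k) ->
  mutually_independent P G -> mutually_independent P G'.
Proof. by move=> sub ind J E GE; apply: ind => k kJ; apply: sub; exact: GE. Qed.

Lemma process_sigma_algebra_comp d (T : measurableType d) (R : realType) (K : Type)
    (X : K -> T -> R) (f : R -> R) : measurable_fun setT f ->
  process_sigma_algebra (fun k w => f (X k w)) `<=` process_sigma_algebra X.
Proof.
move=> mf; apply: smallest_sub; first exact: smallest_sigma_algebra.
move=> A [k _ [B mB <-]]; apply: sub_sigma_algebra; exists k => //.
exists (f @^-1` B); first by have := mf measurableT B mB; rewrite setTI.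
by rewrite !setTI.
Qed.

Section ClippedEnvironment.
Context d (Om : measurableType d) (R : realType) (P : probability Om R).
Variables (X : int -> {RV P >-> R}) (eps : R).
Hypotheses (eps0 : 0 < eps) (eps1 : eps < 1 / 2).
Hypothesis X01 : forall x w, 0 < X x w < 1.
Hypothesis Xiid : iid X.
Hypothesis Xeps : P [set w | eps <= X 0 w <= 1 - eps] = 1%E.
Hypothesis Xmean : ('E_P[fun w => ln (rho (X 0%R w))] = 0)%E.
Hypothesis Xvar : (0 < 'E_P[fun w => (ln (rho (X 0 w)) ^+ 2)%R])%E.

Definition clipped (x : int) (w : Om) : R := clip eps (X x w).

Lemma clipped_ae : {ae P, forall w, forall x, clipped x w = X x w}.
Proof.
have H x : {ae P, forall w, clipped x w = X x w}.
  have mI : measurable [set p : R | eps <= p <= 1 - eps].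
    rewrite (_ : [set p : R | _] = [set` `[eps, 1 - eps]]); last by apply/seteqP; split=> p /=; rewrite in_itv.
    exact: measurable_itv.
  have E : P [set w | eps <= X x w <= 1 - eps] = 1%E.
    by rewrite -Xeps; have [_ idX] := Xiid; exact: idX x 0 _ mI.
  have mA : measurable [set w | eps <= X x w <= 1 - eps].
    by have := @measurable_funP _ _ _ _ setT (X x) measurableT _ mI; rewrite setTI.
  exists (~` [set w | eps <= X x w <= 1 - eps]); split.
  - exact: measurableC.
  - have := probability_setC P mA; rewrite E subee //; exact.
  - by move=> w /= nw; apply: contra_not nw => h; apply: clip_id.
apply: filterS2 (ae_foralln (fun n : nat => H n%:Z)) (ae_foralln (fun n : nat => H (- n%:Z))).
by move=> w h1 h2 x; case: (intP x) => [|n|n]; [exact: (h1 0%N)|exact: h1|exact: h2].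
Qed.

Lemma bmf_lclip x (k : nat) : bmf (fun w => lclip eps (X x w) ^+ k).
Proof.
apply: bmfX; split; last by exists (lclip_bound eps) => w; exact: lclip_le.
by apply: measurableT_comp => //; exact: measurable_lclip.
Qed.

Lemma Ex_lclip x k : Ex P (fun w => lclip eps (X x w) ^+ k) = Ex P (fun w => lclip eps (X 0 w) ^+ k).
Proof.
have mf : measurable_fun setT (fun p : R => (lclip eps p ^+ k)%:E).
  by apply/measurable_EFinP; apply: measurable_funX; exact: measurable_lclip.
have E y : (\int[distribution P (X y)]_p (lclip eps p ^+ k)%:E =
    (Ex P (fun w => lclip eps (X y w) ^+ k))%:E)%E.
  rewrite integral_distribution //; last exact: bmf_integrable (bmf_lclip y k).
  by rewrite -ExE //; exact: bmf_lclip.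
have [_ idX] := Xiid.
apply: EFin_inj; rewrite -!E; apply: eq_measure_integral => A mA _.
exact: idX.
Qed.

Lemma measurable_lrho0 : measurable_fun setT (fun w => ln (rho (X 0 w))).
Proof.
rewrite (_ : (fun w => _) = (fun w => ln (1 - X 0 w) - ln (X 0 w))).
  apply: measurable_funB; apply: measurableT_comp => //.
  by apply: measurable_funB => //; exact: measurable_cst.
apply/funext => w; rewrite /rho; have /andP[a b] := X01 0 w.
by rewrite ln_div ?posrE ?subr_gt0.
Qed.

Lemma Ex_lclip0 k : (\int[P]_w (ln (rho (X 0 w)) ^+ k)%:E =
  (Ex P (fun w => lclip eps (X 0 w) ^+ k))%:E)%E.
Proof.
rewrite -ExE; last exact: bmf_lclip.
apply: ae_eq_integral => //.
- by apply/measurable_EFinP; apply: measurable_funX; exact: measurable_lrho0.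
- by apply/measurable_EFinP; case: (bmf_lclip 0 k).
apply: filterS clipped_ae => w h _; by rewrite /lclip -[clip _ _]/(clipped 0 w) h.
Qed.

Lemma clipped_sinai :
  sinai_env P clipped (lclip_bound eps) (Ex P (fun w => lclip eps (X 0 w) ^+ 2)).
Proof.
split.
- by move=> x; apply: measurableT_comp => //; exact: measurable_clip.
- have [ind _] := Xiid; apply: mutually_independent_sub ind => x.
  exact: process_sigma_algebra_comp (measurable_clip eps).
- by move=> x w; exact: clip01.
- by move=> x w; exact: lclip_le.
- exact: lclip_bound_gt0.
- have := Xvar; rewrite unlock -lte_fin => h; rewrite -Ex_lclip0; exact: h.
- move=> x; have := Ex_lclip x 1; have := Ex_lclip0 1.
  have := Xmean; rewrite unlock => E1 E2 E3.
  apply: EFin_inj; transitivity (Ex P (fun w => lclip eps (X x w) ^+ 1))%:E.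
    by congr (EFin _); apply: eq_Ex => w; rewrite expr1.
  by rewrite E3 -E2 -[RHS]E1; apply: eq_integral => w _; rewrite expr1.
- by move=> x; exact: Ex_lclip x 2.
Qed.

Lemma clipped_gen (A : set Om) : measurable (A : set (env_space clipped setT)) ->
  process_sigma_algebra X A.
Proof.
move=> mA; apply: (process_sigma_algebra_comp (X := fun x w => X x w) (measurable_clip eps)).
move: mA; apply: sub_smallest2r; first exact: smallest_sigma_algebra.
by move=> B [x _ [C mC <-]]; exists x => //; exists C.
Qed.

End ClippedEnvironment.

Lemma cross_independent d (T : measurableType d) (R : realType) (P : probability T R)
    (K : choiceType) (G : K -> set_system T) (i j : K) (om1 om2 : int -> T -> R) (f g : T -> R) :
  i != j -> mutually_independent P G ->
  (forall x, measurable_fun setT (om1 x)) -> (forall x, measurable_fun setT (om2 x)) ->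
  (forall A : set T, measurable (A : set (env_space om1 setT)) -> G i A) ->
  (forall A : set T, measurable (A : set (env_space om2 setT)) -> G j A) ->
  @bmf _ (env_space om1 setT) R f -> @bmf _ (env_space om2 setT) R g ->
  Ex P (fun w => f w * g w) = Ex P f * Ex P g.
Proof.
move=> ij ind m1 m2 G1 G2 bf bg.
apply: Ex_indep.
- exact: bmf_env_sub m1 _ _ bf.
- exact: bmf_env_sub m2 _ _ bg.
move=> s t; pose A := [set x | s <= f x]; pose B := [set x | t <= g x].
have mA : measurable (A : set (env_space om1 setT)).
  by have [mf _] := bf; rewrite -[A]setTI; apply: measurable_fun_le => //; exact: measurable_cst.
have mB : measurable (B : set (env_space om2 setT)).
  by have [mg _] := bg; rewrite -[B]setTI; apply: measurable_fun_le => //; exact: measurable_cst.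
pose E k := if k == i then A else B.
have GE k : k \in [fset i; j]%fset -> G k (E k).
  rewrite !inE /E => /orP[/eqP ->|/eqP ->]; first by rewrite eqxx; exact: G1.
  by rewrite eq_sym (negbTE ij); exact: G2.
have := ind _ _ GE.
have -> : \bigcap_(k in [set` [fset i; j]%fset]) E k = [set x | (s <= f x) && (t <= g x)].
  apply/seteqP; split=> x /=.
    move=> h; apply/andP; split.
      by have := h i; rewrite /= !inE eqxx /E eqxx; apply.
    by have := h j; rewrite /= !inE eqxx orbT /E eq_sym (negbTE ij); apply.
  by move=> /andP[h1 h2] k _; rewrite /E; case: ifP.
rewrite big_fsetU1 ?inE //= big_seq_fset1 /E eqxx eq_sym (negbTE ij) /pr => ->.
have mA' : measurable (A : set T) := env_space_sub m1 mA.
have mB' : measurable (B : set T) := env_space_sub m2 mB.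
by rewrite fineM //; exact: fin_num_measure.
Qed.

Section MeetingTimes.
Context d (T : measurableType d) (R : realType) (Q : probability T R).
Variables (m r : nat) (S : 'I_m -> nat -> {mfun T >-> int})
  (Z : 'I_r -> nat -> {mfun T >-> int}).

Lemma finite_meetings_ae a b : Q (meet_infinitely_often S Z a b) = 0%E ->
  {ae Q, forall t, finite_set [set n | meet S Z m r n t]}.
Proof.
move=> Q0; exists (meet_infinitely_often S Z a b); split => //.
  exact: meet_infinitely_often_measurable.
move=> t /= inf fin; apply: inf; apply: sub_finite_set fin => n [y [HS HZ]].
by exists y; split=> [i _|j _]; [exact: HS|exact: HZ].
Qed.

Lemma two_env_null (e : env R r) (m2 : (2 <= m)%N) (r2 : (2 <= r)%N) (K : R) :
  (forall j y, 0 < e j y < 1) -> quenched_law Q S Z e 0 ->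
  (forall B, \sum_(n < B) srw_return R n./2 ^+ 2 *
     collide (e (widen_ord r2 ord0)) (e (widen_ord r2 (lift ord0 ord0))) n <= K) ->
  Q (meet_infinitely_often S Z 2 2) = 0%E.
Proof.
move=> e01 law H; apply: (@meet_null _ _ _ _ _ _ S Z 2 2 K) => N; apply: le_trans (H N).
apply: ler_sum => n _.
apply: (le_trans (@pr_meet_le _ _ _ _ _ _ S Z e e01 law 2 2 n (inl (Ordinal m2)) _)) => //.
rewrite /collide /window mulr_sumr; apply: ler_sum => j _.
rewrite (prod_selected _ m2 r2) !big_ord_recl big_ord0 mulr1.
have h0 : 0 <= kerw (fun=> 1 / 2 : R) n 0 (- n%:Z + j%:Z).
  by apply: ker_ge0; exact: wwt_half_ge0.
apply: ler_wpM2r.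
  by apply: mulr_ge0; apply: ker_ge0; apply: wwt_ge0.
by rewrite lerXn2r ?nnegrE ?srw_return_ge0 // kerw_half_le.
Qed.

End MeetingTimes.

Theorem theorem1p2 (R : realType) (m r I : nat) (d_gt0 : (0 < m + r)%N)
    (leIr : (I <= r)%N)
    (dO : measure_display) (Om : measurableType dO) (P : probability Om R)
    (omega : 'I_r -> int -> {RV P >-> R})
    (dT : measure_display) (T : measurableType dT)
    (S : 'I_m -> nat -> {mfun T >-> int})
    (Z : 'I_r -> nat -> {mfun T >-> int})
    (PQ : env R r -> 'rV[int]_(m + r) -> probability T R) :
  random_environment leIr omega ->
  (forall (e : env R r) (x : 'rV[int]_(m + r)),
     (forall j y, 0 < e j y < 1) -> quenched_law (PQ e x) S Z e x) ->
  [/\ (3 <= m)%N -> (1 <= r)%N ->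
        {ae P, forall w : Om,
           PQ (realization omega w) 0 (meet_infinitely_often S Z 3 1) = 0%E} /\
        {ae P, forall w : Om, {ae PQ (realization omega w) 0, forall t : T,
           finite_set [set n | meet S Z m r n t]}},
      m = 2%N -> I = 1%N ->
        {ae P, forall w : Om,
           PQ (realization omega w) 0 (meet_infinitely_often S Z 2 r) = 1%E} &
      m = 2%N -> (2 <= I)%N ->
        {ae P, forall w : Om,
           PQ (realization omega w) 0 (meet_infinitely_often S Z 2 2) = 0%E} /\
        {ae P, forall w : Om, {ae PQ (realization omega w) 0, forall t : T,
           finite_set [set n | meet S Z m r n t]}}].
Proof.
move=> [range iids indep copy [eps [/andP[eps0 eps1] sinai]]] law.
have e01 w j y : 0 < realization omega w j y < 1 by exact: range.
have Q w := law (realization omega w) 0 (e01 w).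
have clip_env j := clipped_sinai eps0 eps1 (range j) (iids j).
have clip_eq j := clipped_ae (eps := eps) (iids j).
split.
- move=> m3 r1.
  have H w : PQ (realization omega w) 0 (meet_infinitely_often S Z 3 1) = 0%E.
    exact: three_srw_null (e01 w) (Q w) m3 r1.
  by split; apply: aeW => w //; exact: finite_meetings_ae (H w).
- move=> m2 I1.
  have I0 : (0 < I)%N by rewrite I1.
  pose j0 := widen_ord leIr (Ordinal I0).
  (* With a single independent environment every other index is a copy of the first. *)
  have same w j y : realization omega w j y = realization omega w j0 y.
    have [Ij|jI] := leqP I j.
      have [J HJ] := copy j Ij; rewrite /realization HJ; congr (omega _ _ _).
      apply: val_inj; apply/eqP; rewrite /= -leqn0 -ltnS.
      by apply: leq_trans (ltn_ord J) _; rewrite I1.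
    rewrite /realization; congr (omega _ _ _); apply: val_inj => /=.
    by move: jI; rewrite I1; case: (val j).
  have [s1 s2 s3] := sinai j0.
  have [a a01 good] := good_sites_ae (clip_env j0 s1 s2 s3).
  apply: filterS2 good (clip_eq j0 s1) => w gw cw.
  apply: (meet_infinitely_often_sure (e0 := realization omega w j0) m2 (e01 w) (same w) (Q w) a01).
  move=> M0; have [M [N [b [h1 h2 h3]]]] := gw M0; exists M, N, b; split => //.
  have -> // : realization omega w j0 = env_at (clipped (omega j0) eps) w.
  by apply/funext => x; rewrite /env_at cw.
- move=> m2 I2.
  have r2 : (2 <= r)%N := leq_trans I2 leIr.
  (* The first two environments have indices below [I] and are therefore independent. *)
  pose i0 : 'I_I := widen_ord I2 ord0; pose i1 : 'I_I := widen_ord I2 (lift ord0 ord0).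
  pose j0 : 'I_r := widen_ord r2 ord0; pose j1 : 'I_r := widen_ord r2 (lift ord0 ord0).
  have E0 : j0 = widen_ord leIr i0 by exact: val_inj.
  have E1 : j1 = widen_ord leIr i1 by exact: val_inj.
  have [s1 s2 s3] := sinai j0; have [t1 t2 t3] := sinai j1.
  have se0 := clip_env j0 s1 s2 s3; have se1 := clip_env j1 t1 t2 t3.
  have ij : i0 != i1 by [].
  have H : {ae P, forall w, PQ (realization omega w) 0 (meet_infinitely_often S Z 2 2) = 0%E}.
    have sum := collide_summable se0 se1.
    have /sum {}sum : forall f g : Om -> R,
      @bmf _ (env_space (clipped (omega j0) eps) setT) R f ->
      @bmf _ (env_space (clipped (omega j1) eps) setT) R g ->
      Ex P (fun w => f w * g w) = Ex P f * Ex P g.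
      move=> f g; apply: (cross_independent ij indep (sinai_meas se0) (sinai_meas se1)).
        by move=> A mA; rewrite -E0; exact: clipped_gen mA.
      by move=> A mA; rewrite -E1; exact: clipped_gen mA.
    apply: filterS3 sum (clip_eq j0 s1) (clip_eq j1 t1) => w [K HK] c0 c1.
    have m2' : (2 <= m)%N by rewrite m2.
    apply: (two_env_null (r2 := r2) (K := K) m2' (e01 w) (Q w)) => B.
    apply: le_trans (HK B); rewrite le_eqVlt; apply/orP; left.
    apply/eqP/eq_bigr => n _; congr (_ * collide _ _ _).
      by apply/funext => x; rewrite /env_at c0.
    by apply/funext => x; rewrite /env_at c1.
  by split => //; apply: filterS H => w Hw; exact: finite_meetings_ae Hw.
Qed.
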